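(* Let $m\in\mathbb{N}$, $m\ge 1$, and let $\gamma$ be the hypocycloid in the plane $\{x_3=0\}$ of inner radius $r=\frac{1}{m+2}$ and outer radius $R=\frac{2m+2}{m(m+2)}$. (a) If $m$ is even, then $\gamma$ has exactly $m+1$ cusps, and (up to a translation of $\mathbb{R}^3$) the surface $H_m$ is the unique minimal surface obtained as solution of the Björling problem for $\gamma$ when the prescribed unit normal field $\eta$ is the unit normal vector field to $\gamma$ as a planar curve. (b) If $m$ is odd, then $\gamma$ has exactly $2m+2$ cusps, and (up to a translation of $\mathbb{R}^3$) the conjugate surface $H_m^*$ of $H_m$ is the unique solution of the Björling problem for $\gamma$ when the prescribed unit normal field $\eta$ is the unit normal vector field to $\gamma$ as a planar curve.
   Context: Hypocycloid: for $0<r<R$, the hypocycloid of inner radius $r$ and outer radius $R$ is the image of $\alpha(t)=(x(t),y(t),0)$, $t\in\mathbb{R}$, with $x(t)=-(R-r)\sin t+r\sin\left(\frac{R-r}{r}t\right)$, $y(t)=-(R-r)\cos t-r\cos\left(\frac{R-r}{r}t\right)$. Its cusps are the points of the plane where $\alpha'$ vanishes. Björling problem: given a regular analytic curve $\gamma\colon J\subset\mathbb{R}\to\mathbb{R}^3$ and an analytic unit vector field $\eta$ along $\gamma$ with $\langle\gamma',\eta\rangle=0$, the solution is the minimal surface, locally unique around $\gamma$, that contains $\gamma$ and has $\eta$ as unit normal along $\gamma$; it is parametrized by $\mathrm{Re}\left(\widetilde\gamma(w)-i\int_{w_0}^w\widetilde\eta\times\widetilde\gamma'\,dw\right)$ with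 $\widetilde\gamma,\widetilde\eta$ the analytic extensions. For a planar analytic curve with finitely many singular points (zeros of the derivative), the problem is posed on each regular arc obtained after removing those points, and a surface is a solution if it is the Björling solution along every regular arc. Surfaces: let $\epsilon_m=1$ for $m$ odd, $\epsilon_m=i$ for $m$ even. $H_m$ is the branched minimal surface $X=\mathrm{Re}\int\left(\frac12(1-g^2)\omega,\frac i2(1+g^2)\omega,g\omega\right)$ on $\mathbb{C}\setminus\{0\}$ with $g(z)=z$, $\omega=\epsilon_m z^{-m-3}(z^{2m+2}-1)\,dz$ (well defined up to translation). Its conjugate surface $H_m^*$ is given by the same formula with $\omega$ replaced by $i\omega$. The curve $\gamma$ is the image of the unit circle $\{|z|=1\}$ under the corresponding parametrization, suitably translated. *)

(* Defs.v *)
From Stdlib Require Import Reals List.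
From Coquelicot Require Import Coquelicot.
Open Scope R_scope.

Definition R3 : Type := (R * R * R)%type.
Definition C3 : Type := (C * C * C)%type.

Definition x1 (p : R3) : R := fst (fst p).
Definition x2 (p : R3) : R := snd (fst p).
Definition x3 (p : R3) : R := snd p.

Definition zero3 : R3 := (0, 0, 0).
Definition add3 (p q : R3) : R3 := (x1 p + x1 q, x2 p + x2 q, x3 p + x3 q).
Definition sub3 (p q : R3) : R3 := (x1 p - x1 q, x2 p - x2 q, x3 p - x3 q).
Definition dot3 (p q : R3) : R := x1 p * x1 q + x2 p * x2 q + x3 p * x3 q.
Definition norm3 (p : R3) : R := sqrt (dot3 p p).
Definition cross3 (p q : R3) : R3 :=
  (x2 p * x3 q - x3 p * x2 q, x3 p * x1 q - x1 p * x3 q,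
   x1 p * x2 q - x2 p * x1 q).

Definition has_card {T : Type} (S : T -> Prop) (n : nat) : Prop :=
  exists l : list T, NoDup l /\ length l = n /\ forall x, In x l <-> S x.

(** ** Planar curves, cusps and the hypocycloid *)

Definition hypocycloid (r Rad t : R) : R3 :=
  (- (Rad - r) * sin t + r * sin ((Rad - r) / r * t),
   - (Rad - r) * cos t - r * cos ((Rad - r) / r * t),
   0).

Definition velocity (c : R -> R3) (t : R) : R3 :=
  (Derive (fun s => x1 (c s)) t, Derive (fun s => x2 (c s)) t,
   Derive (fun s => x3 (c s)) t).

(** Cusps are points of the trace, so that a cusp reached at several
    parameters is counted once. *)
Definition cusp (c : R -> R3) (p : R3) : Prop :=
  exists t, velocity c t = zero3 /\ p = c t.

(** [(a, b)] is a component of the set of regular parameters. Only bounded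
    components are considered: a closed curve with a cusp has no others. *)
Definition regular_arc (c : R -> R3) (a b : R) : Prop :=
  a < b /\ velocity c a = zero3 /\ velocity c b = zero3 /\
  forall t, a < t < b -> velocity c t <> zero3.

(** The velocity, rotated by a quarter turn in the plane [x3 = 0] and
    normalized; meaningless at cusps. *)
Definition planar_normal (c : R -> R3) (t : R) : R3 :=
  let v := velocity c t in (- x2 v / norm3 v, x1 v / norm3 v, 0).

(** ** Branched minimal surfaces

    A surface is a map on an open subset of the complex plane with coordinate
    [z = u + i v], given by a total function [C -> R3] whose values off that
    subset are irrelevant. *)

Definition Du (X : C -> R3) (z : C) : R3 :=
  (partial_derive 1 0 (fun u v => x1 (X (u, v))) (Re z) (Im z),
   partial_derive 1 0 (fun u v => x2 (X (u, v))) (Re z) (Im z),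
   partial_derive 1 0 (fun u v => x3 (X (u, v))) (Re z) (Im z)).

Definition Dv (X : C -> R3) (z : C) : R3 :=
  (partial_derive 0 1 (fun u v => x1 (X (u, v))) (Re z) (Im z),
   partial_derive 0 1 (fun u v => x2 (X (u, v))) (Re z) (Im z),
   partial_derive 0 1 (fun u v => x3 (X (u, v))) (Re z) (Im z)).

Definition harmonic_on (D : C -> Prop) (f : R -> R -> R) : Prop :=
  forall u v, D (u, v) ->
    ex_diff_n f 2 u v /\ partial_derive 2 0 f u v + partial_derive 0 2 f u v = 0.

Definition immersed_at (X : C -> R3) (z : C) : Prop :=
  cross3 (Du X z) (Dv X z) <> zero3.

(** A conformal harmonic map with isolated branch points. *)
Definition branched_minimal_surface (D : C -> Prop) (X : C -> R3) : Prop :=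
  open D /\
  (harmonic_on D (fun u v => x1 (X (u, v))) /\
   harmonic_on D (fun u v => x2 (X (u, v))) /\
   harmonic_on D (fun u v => x3 (X (u, v)))) /\
  (forall z, D z ->
     dot3 (Du X z) (Du X z) = dot3 (Dv X z) (Dv X z) /\
     dot3 (Du X z) (Dv X z) = 0) /\
  (forall z, D z -> exists e : posreal,
     forall w, D w -> w <> z -> Cmod (w - z) < e -> immersed_at X w).

(** ** The Björling problem *)

(** Surfaces are not oriented: the surfaces [is_H m] below are one-sided for
    even [m], and [planar_normal] changes sides at cusps. A unit normal is a
    unit vector orthogonal to the tangent plane. *)
Definition unit_normal_at (X : C -> R3) (z : C) (n : R3) : Prop :=
  immersed_at X z /\ norm3 n = 1 /\ dot3 n (Du X z) = 0 /\ dot3 n (Dv X z) = 0.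

(** The surface [X] contains the arc [c] over [(a, b)], as the image of the
    curve [beta] of the parameter domain, and has [eta] as unit normal there. *)
Definition solves_along (D : C -> Prop) (X : C -> R3) (beta : R -> C)
    (c eta : R -> R3) (a b : R) : Prop :=
  forall t, a < t < b ->
    continuous beta t /\ D (beta t) /\ X (beta t) = c t /\
    unit_normal_at X (beta t) (eta t).

Definition holomorphic_on (U : C -> Prop) (h : C -> C) : Prop :=
  forall z, U z -> @ex_derive C_AbsRing C_NormedModule h z.

(** Near the curve [beta1], the surface [X1] is a conformal or anticonformal
    injective reparametrization of [X2] that takes [beta1] to [beta2]. *)
Definition coincide_along (D1 : C -> Prop) (X1 : C -> R3) (beta1 : R -> C)
    (D2 : C -> Prop) (X2 : C -> R3) (beta2 : R -> C) (a b : R) : Prop :=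
  exists (U : C -> Prop) (h : C -> C),
    open U /\
    (forall t, a < t < b -> U (beta1 t) /\ h (beta1 t) = beta2 t) /\
    (holomorphic_on U h \/ holomorphic_on U (fun z => Cconj (h z))) /\
    (forall z w, U z -> U w -> h z = h w -> z = w) /\
    (forall z, U z -> D1 z /\ D2 (h z) /\ X1 z = X2 (h z)).

(** The minimal surface [X] solves the Björling problem along the arc, and any
    other solution along this arc coincides with it around the arc. *)
Definition is_the_solution_along (D : C -> Prop) (X : C -> R3)
    (c eta : R -> R3) (a b : R) : Prop :=
  exists beta : R -> C,
    solves_along D X beta c eta a b /\
    forall (D' : C -> Prop) (Y : C -> R3) (beta' : R -> C),
      branched_minimal_surface D' Y ->
      solves_along D' Y beta' c eta a b ->
      coincide_along D' Y beta' D X beta a b.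

Definition is_the_bjorling_solution (D : C -> Prop) (X : C -> R3)
    (c eta : R -> R3) : Prop :=
  branched_minimal_surface D X /\
  forall a b, regular_arc c a b -> is_the_solution_along D X c eta a b.

(** ** Weierstrass representation *)

Definition weierstrass (g f : C -> C) (z : C) : C3 :=
  ((/ 2 * (1 - g z ^ 2) * f z)%C, (Ci / 2 * (1 + g z ^ 2) * f z)%C,
   (g z * f z)%C).

Definition Re_mult3 (phi : C3) (w : C) : R3 :=
  (Re (fst (fst phi) * w)%C, Re (snd (fst phi) * w)%C, Re (snd phi * w)%C).

(** [X] is [Re (int phi dz)] on [D]: the increments of [X] are the integrals
    along all continuously differentiable paths in [D]. This forces the real
    periods of [phi dz] to vanish, and determines [X] up to a translation
    when [D] is connected. *)
Definition is_Re_integral (D : C -> Prop) (phi : C -> C3) (X : C -> R3) : Prop :=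
  forall (p dp : R -> C) (a b : R), a < b ->
    (forall t, a <= t <= b ->
       D (p t) /\ is_derive p t (dp t) /\ continuous dp t) ->
    is_RInt (fun t => Re_mult3 (phi (p t)) (dp t)) a b (sub3 (X (p b)) (X (p a))).

Definition punctured_plane (z : C) : Prop := z <> 0.

Definition eps (m : nat) : C := if Nat.even m then Ci else 1.

(** [omega = omega_coef m z dz]. *)
Definition omega_coef (m : nat) (z : C) : C :=
  (eps m * (z ^ (2 * m + 2) - 1) / z ^ (m + 3))%C.

Definition is_H (m : nat) (X : C -> R3) : Prop :=
  is_Re_integral punctured_plane (weierstrass (fun z => z) (omega_coef m)) X.

Definition is_H_conjugate (m : nat) (X : C -> R3) : Prop :=
  is_Re_integral punctured_plane
    (weierstrass (fun z => z) (fun z => Ci * omega_coef m z)%C) X.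

Definition translate (v : R3) (X : C -> R3) (z : C) : R3 := add3 (X z) v.

(** [is_surface] is meant to define a surface on [D] up to translation. *)
Definition is_the_bjorling_solution_up_to_translation
    (D : C -> Prop) (is_surface : (C -> R3) -> Prop) (c eta : R -> R3) : Prop :=
  (exists X, is_surface X) /\
  forall X, is_surface X ->
    exists v : R3, is_the_bjorling_solution D (translate v X) c eta.

(* Main.v *)
Require Import Defs.
From Stdlib Require Import Reals Ranalysis5 Lra Lia ZArith List FinFun.
From Coquelicot Require Import Coquelicot.
Open Scope R_scope.

(** In both parities the surface has Weierstrass data [g = z], [f = i (z ^ (m - 1) - z ^ (- m - 3))];
    the primitives are elementary, and [z = exp (i t / m)] is carried to the point of parameter [t]
    of the hypocycloid. There [z] is the Gauss map and the hypocycloid has velocity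
    [(2 / m) sin ((m + 1) t / m) (- sin (t / m), cos (t / m))], so its planar normal is normal to
    the surface.

    For uniqueness, let [Y] be another solution and [P = Y_u - i Y_v] its (null, holomorphic)
    gradient. Along the curve [P] is a nonzero null vector orthogonal to the normal, hence lies on
    one of two complex lines; by continuity always on the same one, and after a reflection of the
    parameter domain the Gauss map [h = P3 / (P1 - i P2)] of [Y] agrees with that of the surface.
    Then [h] is the change of parameters: [P1 - i P2 - f(h) h'] vanishes along the curve, hence
    near it by the identity theorem, which makes [Y] and the composite of the surface with [h]
    have the same gradient. The identity theorem is applied to a primitive of this function, since
    [h'] is not known to be differentiable at that stage. *)

(** * Complex differentiation *)

(** The local changes of parameter are all restrictions of one function, the Gauss map [h], so
    patching them costs nothing; what has to be secured is injectivity on the union of the discs.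
    This rests on [beta] being an embedding of the arc, which holds because a regular arc covers an
    angle of at most pi / 2 on the unit circle.

    Holomorphic functions are handled here as functions with a given continuous complex derivative.
    This is exactly what differentiation under the integral sign requires, and it is what a harmonic
    map supplies: its second partial derivatives are continuous, so its complex gradient has a
    continuous derivative. *)

Ltac cring := match goal with |- @eq _ ?a ?b => change (@eq C a b) end; cbv beta; ring.

Lemma Cmod_le_Re_Im (z : C) : Cmod z <= Rabs (Re z) + Rabs (Im z).
Proof.
  replace z with (RtoC (Re z) + Ci * RtoC (Im z))%C at 1
    by (destruct z; unfold Re, Im, RtoC, Ci, Cmult, Cplus; simpl; f_equal; ring).
  eapply Rle_trans; [apply Cmod_triangle|].
  rewrite Cmod_mult, Cmod_Ci, !Cmod_R; lra.
Qed.

Lemma im_le_Cmod (z : C) : Rabs (Im z) <= Cmod z.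
Proof. eapply Rle_trans; [apply Rmax_r|apply Rmax_Cmod]. Qed.

Lemma C_ext (z w : C) : Re z = Re w -> Im z = Im w -> z = w.
Proof. destruct z, w; simpl; congruence. Qed.

(** The topology of [C] is that of a product, with squares as balls; the bounds max(|x|, |y|) <= |z|
    <= |x| + |y| pass between squares and discs. *)
Lemma locally_Cmod (z : C) (P : C -> Prop) :
  locally (T := C_UniformSpace) z P <->
  exists e, 0 < e /\ forall w, Cmod (w - z) < e -> P w.
Proof.
  split.
  - intros [e He]. exists e; split; [apply cond_pos|].
    intros w Hw; apply He. split.
    + apply Rle_lt_trans with (2 := Hw).
      apply (re_le_Cmod (w - z)%C).
    + apply Rle_lt_trans with (2 := Hw).
      apply (im_le_Cmod (w - z)%C).
  - intros [e [He H]].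
    assert (He2 : 0 < e / 2) by lra.
    exists (mkposreal _ He2). intros w [H1 H2]. apply H.
    eapply Rle_lt_trans; [apply Cmod_le_Re_Im|].
    change (Rabs (Re (w - z)) < e / 2) in H1.
    change (Rabs (Im (w - z)) < e / 2) in H2. lra.
Qed.

Lemma open_Cmod (D : C -> Prop) (z : C) : open D -> D z ->
  exists e, 0 < e /\ forall w, Cmod (w - z) < e -> D w.
Proof. intros HD Hz. apply locally_Cmod, HD, Hz. Qed.

Lemma open_of_balls (D : C -> Prop) :
  (forall z, D z -> exists e, 0 < e /\ forall w, Cmod (w - z) < e -> D w) -> open D.
Proof. intros H z Hz. apply locally_Cmod, H, Hz. Qed.

Lemma continuous_Cmod {U : UniformSpace} (f : U -> C) (x : U) :
  continuous f x <->
  forall eps, 0 < eps -> locally x (fun y => Cmod (f y - f x) < eps).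
Proof.
  split.
  - intros H eps He. apply (H (fun w => Cmod (w - f x) < eps)).
    apply locally_Cmod. exists eps; auto.
  - intros H P HP. apply locally_Cmod in HP. destruct HP as [e [He HP]].
    unfold filtermap. apply filter_imp with (2 := H e He). auto.
Qed.

Lemma continuous_Re {U : UniformSpace} (f : U -> C) (x : U) :
  continuous f x -> continuous (fun y => Re (f y)) x.
Proof.
  intros H. apply (continuous_comp f Re); auto.
  destruct (f x); apply continuous_fst.
Qed.

Lemma continuous_Im {U : UniformSpace} (f : U -> C) (x : U) :
  continuous f x -> continuous (fun y => Im (f y)) x.
Proof.
  intros H. apply (continuous_comp f Im); auto.
  destruct (f x); apply continuous_snd.
Qed.

Lemma continuous_Cpair {U : UniformSpace} (f : U -> C) (x : U) :
  continuous (fun y => Re (f y)) x -> continuous (fun y => Im (f y)) x ->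
  continuous f x.
Proof.
  intros H1 H2. apply continuous_Cmod. intros eps He.
  apply filterlim_locally with (eps := mkposreal _ (is_pos_div_2 (mkposreal _ He))) in H1.
  apply filterlim_locally with (eps := mkposreal _ (is_pos_div_2 (mkposreal _ He))) in H2.
  generalize (filter_and _ _ H1 H2). apply filter_imp. intros y [A B].
  eapply Rle_lt_trans; [apply Cmod_le_Re_Im|].
  change (Rabs (Re (f y - f x)) < eps / 2) in A.
  change (Rabs (Im (f y - f x)) < eps / 2) in B. lra.
Qed.

Lemma continuous_Cplus {U : UniformSpace} (f g : U -> C) (x : U) :
  continuous f x -> continuous g x -> continuous (fun y => f y + g y)%C x.
Proof.
  intros Hf Hg. apply continuous_Cpair.
  - apply (continuous_plus (fun y => Re (f y)) (fun y => Re (g y)));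
      now apply continuous_Re.
  - apply (continuous_plus (fun y => Im (f y)) (fun y => Im (g y)));
      now apply continuous_Im.
Qed.

Lemma continuous_Cmult {U : UniformSpace} (f g : U -> C) (x : U) :
  continuous f x -> continuous g x -> continuous (fun y => f y * g y)%C x.
Proof.
  intros Hf Hg.
  pose proof (continuous_Re f x Hf) as Rf. pose proof (continuous_Im f x Hf) as If.
  pose proof (continuous_Re g x Hg) as Rg. pose proof (continuous_Im g x Hg) as Ig.
  apply continuous_Cpair.
  - apply (continuous_minus (fun y => Re (f y) * Re (g y)) (fun y => Im (f y) * Im (g y))).
    + exact (continuous_mult (fun y => Re (f y)) (fun y => Re (g y)) x Rf Rg).
    + exact (continuous_mult (fun y => Im (f y)) (fun y => Im (g y)) x If Ig).
  - apply (continuous_plus (fun y => Re (f y) * Im (g y)) (fun y => Im (f y) * Re (g y))).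
    + exact (continuous_mult (fun y => Re (f y)) (fun y => Im (g y)) x Rf Ig).
    + exact (continuous_mult (fun y => Im (f y)) (fun y => Re (g y)) x If Rg).
Qed.

Lemma continuous_Copp {U : UniformSpace} (f : U -> C) (x : U) :
  continuous f x -> continuous (fun y => - f y)%C x.
Proof.
  intros Hf.
  apply (continuous_ext (fun y => RtoC (-1) * f y)%C).
  { intros y. cring. }
  apply continuous_Cmult; auto. apply continuous_const.
Qed.

Lemma continuous_Cminus {U : UniformSpace} (f g : U -> C) (x : U) :
  continuous f x -> continuous g x -> continuous (fun y => f y - g y)%C x.
Proof. intros Hf Hg. apply continuous_Cplus; auto. now apply continuous_Copp. Qed.

Lemma continuous_RtoC {U : UniformSpace} (f : U -> R) (x : U) :
  continuous f x -> continuous (fun y => RtoC (f y)) x.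
Proof. intros Hf. apply continuous_Cpair; simpl; auto. apply continuous_const. Qed.

Lemma continuous_Cconj {U : UniformSpace} (f : U -> C) (x : U) :
  continuous f x -> continuous (fun y => Cconj (f y)) x.
Proof.
  intros Hf. apply continuous_Cpair; simpl.
  - now apply continuous_Re.
  - apply (continuous_opp (fun y => Im (f y))). now apply continuous_Im.
Qed.

(** Reduces the complex inverse to conjugation and a real inverse, for continuity and for the real
    part of the Cauchy kernel. *)
Lemma Cinv_conj_norm (z : C) : (/ z = Cconj z * RtoC (/ (Re z * Re z + Im z * Im z)))%C.
Proof.
  destruct z as [a b]. apply C_ext; unfold Cinv, Cconj, Cmult, RtoC, Re, Im; simpl;
  replace (a * (a * 1) + b * (b * 1)) with (a*a+b*b) by ring; unfold Rdiv; ring.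
Qed.

Lemma Re2_Im2_neq_0 (z : C) : z <> 0 -> Re z * Re z + Im z * Im z <> 0.
Proof.
  intros Hz H. apply Hz.
  assert (Re z = 0 /\ Im z = 0) by (split; nra).
  apply C_ext; simpl; tauto.
Qed.

Lemma continuous_Re2_Im2 {U : UniformSpace} (f : U -> C) (x : U) :
  continuous f x -> continuous (fun y => Re (f y) * Re (f y) + Im (f y) * Im (f y)) x.
Proof.
  intros Hf. pose proof (continuous_Re f x Hf) as Rf. pose proof (continuous_Im f x Hf) as If.
  apply (continuous_plus (fun y => Re (f y) * Re (f y)) (fun y => Im (f y) * Im (f y))).
  - exact (continuous_mult (fun y => Re (f y)) (fun y => Re (f y)) x Rf Rf).
  - exact (continuous_mult (fun y => Im (f y)) (fun y => Im (f y)) x If If).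
Qed.

Lemma continuous_Cinv {U : UniformSpace} (f : U -> C) (x : U) :
  f x <> 0 -> continuous f x -> continuous (fun y => / f y)%C x.
Proof.
  intros H Hf.
  apply (continuous_ext
    (fun y => Cconj (f y) * RtoC (/ (Re (f y) * Re (f y) + Im (f y) * Im (f y))))%C).
  { intros y. symmetry. apply Cinv_conj_norm. }
  apply continuous_Cmult. now apply continuous_Cconj.
  apply continuous_RtoC.
  apply (continuous_comp (fun y => Re (f y) * Re (f y) + Im (f y) * Im (f y)) Rinv);
    [|now apply continuous_Rinv, Re2_Im2_neq_0].
  now apply continuous_Re2_Im2.
Qed.

Lemma continuous_Cdiv {U : UniformSpace} (f g : U -> C) (x : U) :
  g x <> 0 -> continuous f x -> continuous g x -> continuous (fun y => f y / g y)%C x.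
Proof. intros H Hf Hg. apply continuous_Cmult; auto. now apply continuous_Cinv. Qed.

Lemma continuous_Cpow {U : UniformSpace} (f : U -> C) (n : nat) (x : U) :
  continuous f x -> continuous (fun y => f y ^ n)%C x.
Proof.
  intros Hf. induction n as [|n IH]; simpl.
  - apply continuous_const.
  - now apply continuous_Cmult.
Qed.

Lemma continuous_Cmod_comp {U : UniformSpace} (f : U -> C) (x : U) :
  continuous f x -> continuous (fun y => Cmod (f y)) x.
Proof.
  intros Hf.
  apply (continuous_ext (fun y => sqrt (Re (f y) * Re (f y) + Im (f y) * Im (f y)))).
  { intros y. unfold Cmod, Re, Im. f_equal. ring. }
  apply (continuous_comp (fun y => Re (f y) * Re (f y) + Im (f y) * Im (f y)) sqrt);
    [|apply continuous_sqrt].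
  now apply continuous_Re2_Im2.
Qed.

Lemma continuous_C_neq_0 {U : UniformSpace} (f : U -> C) (x : U) :
  continuous f x -> f x <> 0 -> locally x (fun y => f y <> 0).
Proof.
  intros Hf Hx. apply Cmod_gt_0 in Hx.
  destruct (continuous_Cmod f x) as [A _]. specialize (A Hf _ Hx).
  apply filter_imp with (2 := A). intros y Hy E. rewrite E in Hy.
  replace (0 - f x)%C with (- f x)%C in Hy by ring. rewrite Cmod_opp in Hy. lra.
Qed.

(** The complex derivative, in the encoding of [holomorphic_on]. *)
Definition is_Cderive (F : C -> C) (z l : C) : Prop :=
  @is_derive C_AbsRing C_NormedModule F z l.

Lemma is_Cderive_eps (F : C -> C) (z l : C) :
  is_Cderive F z l <->
  forall eps, 0 < eps -> exists del, 0 < del /\ forall w, Cmod (w - z) < del ->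
    Cmod (F w - F z - l * (w - z)) <= eps * Cmod (w - z).
Proof.
  split.
  - intros [_ H] eps He.
    specialize (H z (fun P HP => HP) (mkposreal _ He)).
    apply locally_C in H. apply locally_Cmod in H. destruct H as [d [Hd H]].
    exists d; split; auto. intros w Hw. specialize (H w Hw).
    simpl in H. 
    replace (F w - F z - l * (w - z))%C with (F w - F z - (w - z) * l)%C by ring.
    exact H.
  - intros H. split; [apply is_linear_scal_l|].
    intros x Hx eps.
    apply (is_filter_lim_locally_unique (V := AbsRing_NormedModule C_AbsRing)) in Hx. simpl in Hx. subst x.
    apply locally_C, locally_Cmod. destruct (H eps (cond_pos eps)) as [d [Hd Hw]].
    exists d; split; auto. intros w Hwd. specialize (Hw w Hwd).
    replace (F w - F z - l * (w - z))%C with (F w - F z - (w - z) * l)%C in Hw by ring.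
    exact Hw.
Qed.

(* Carathéodory's criterion: derivatives of products, quotients and composites reduce to
   the continuity of the difference quotient [Q]. *)
Lemma is_Cderive_slope (F : C -> C) (z l : C) :
  is_Cderive F z l <->
  exists Q : C -> C, continuous Q z /\ Q z = l /\ forall w, F w = (F z + Q w * (w - z))%C.
Proof.
  rewrite is_Cderive_eps. split.
  - intros H.
    exists (fun w => if Ceq_dec w z then l else (F w - F z) / (w - z))%C.
    assert (Hz : (if Ceq_dec z z then l else (F z - F z) / (z - z))%C = l)
      by (destruct (Ceq_dec z z); congruence).
    split; [|split; [exact Hz|]].
    + apply continuous_Cmod. intros eps He. rewrite Hz.
      destruct (H (eps/2)) as [d [Hd Hw]]; [lra|].
      apply locally_Cmod. exists d; split; auto. intros w Hwd.
      destruct (Ceq_dec w z) as [->|N].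
      * replace (l - l)%C with (RtoC 0) by ring. now rewrite Cmod_0.
      * assert (N' : (w - z)%C <> 0).
        { intros E. apply N. replace w with (w - z + z)%C by ring. rewrite E. ring. }
        replace ((F w - F z) / (w - z) - l)%C
          with ((F w - F z - l * (w - z)) / (w - z))%C by (field; auto).
        rewrite Cmod_div; auto. apply Cmod_gt_0 in N'.
        apply Rle_lt_trans with (eps / 2); [|lra].
        apply Rle_div_l; auto.
    + intros w. destruct (Ceq_dec w z) as [->|N]; [ring|].
      field. intros E. apply N. replace w with (w - z + z)%C by ring. rewrite E. ring.
  - intros [Q [HQ [E Hw]]] eps He.
    destruct (continuous_Cmod Q z) as [A _]. specialize (A HQ _ He).
    apply locally_Cmod in A. destruct A as [d [Hd A]].
    exists d; split; auto. intros w Hwd. rewrite (Hw w).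
    replace (F z + Q w * (w - z) - F z - l * (w - z))%C with ((Q w - l) * (w - z))%C by ring.
    rewrite Cmod_mult. apply Rmult_le_compat_r; [apply Cmod_ge_0|].
    subst l. left. now apply A.
Qed.

Lemma is_Cderive_ext_loc (F G : C -> C) (z l : C) :
  (exists e, 0 < e /\ forall w, Cmod (w - z) < e -> F w = G w) ->
  is_Cderive F z l -> is_Cderive G z l.
Proof.
  intros H. apply is_derive_ext_loc. apply locally_C, locally_Cmod, H.
Qed.

Lemma is_Cderive_eq (F : C -> C) (z l l' : C) :
  is_Cderive F z l -> l = l' -> is_Cderive F z l'.
Proof. now intros H <-. Qed.

Lemma is_Cderive_continuous (F : C -> C) (z l : C) :
  is_Cderive F z l -> @continuous C_UniformSpace C_UniformSpace F z.
Proof.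
  intros H. apply is_Cderive_slope in H. destruct H as [Q [HQ [_ H]]].
  apply (continuous_ext (fun w => F z + Q w * (w - z))%C).
  { intros w. now rewrite <- H. }
  apply continuous_Cplus; [apply continuous_const|].
  apply continuous_Cmult; auto.
  apply continuous_Cminus; [apply continuous_id|apply continuous_const].
Qed.

Lemma is_Cderive_const (c z : C) : is_Cderive (fun _ => c) z 0.
Proof.
  apply is_Cderive_slope. exists (fun _ => RtoC 0). split; [apply continuous_const|].
  split; auto. intros; cring.
Qed.

Lemma is_Cderive_id (z : C) : is_Cderive (fun w => w) z 1.
Proof.
  apply is_Cderive_slope. exists (fun _ => RtoC 1). split; [apply continuous_const|].
  split; auto. intros; cring.
Qed.

Lemma is_Cderive_plus (F G : C -> C) (z l k : C) :
  is_Cderive F z l -> is_Cderive G z k -> is_Cderive (fun w => F w + G w)%C z (l + k).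
Proof. exact (@is_derive_plus C_AbsRing C_NormedModule F G z l k). Qed.

Lemma is_Cderive_mult (F G : C -> C) (z l k : C) :
  is_Cderive F z l -> is_Cderive G z k ->
  is_Cderive (fun w => F w * G w)%C z (l * G z + F z * k).
Proof.
  intros HF HG. pose proof (is_Cderive_continuous _ _ _ HG) as CG.
  apply is_Cderive_slope in HF. destruct HF as [Q [HQ [EQ H]]].
  apply is_Cderive_slope in HG. destruct HG as [P [HP [EP K]]].
  apply is_Cderive_slope. exists (fun w => Q w * G w + F z * P w)%C.
  split; [|split].
  - apply continuous_Cplus; apply continuous_Cmult; auto. apply continuous_const.
  - now rewrite EQ, EP.
  - intros w. rewrite (H w). rewrite (K w). ring.
Qed.

Lemma is_Cderive_scal (c : C) (F : C -> C) (z l : C) :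
  is_Cderive F z l -> is_Cderive (fun w => c * F w)%C z (c * l).
Proof.
  intros H. eapply is_Cderive_eq.
  - apply is_Cderive_mult; [apply is_Cderive_const|exact H].
  - cring.
Qed.

Lemma is_Cderive_minus (F G : C -> C) (z l k : C) :
  is_Cderive F z l -> is_Cderive G z k -> is_Cderive (fun w => F w - G w)%C z (l - k).
Proof. exact (@is_derive_minus C_AbsRing C_NormedModule F G z l k). Qed.

Lemma is_Cderive_comp (F G : C -> C) (z l k : C) :
  is_Cderive F (G z) l -> is_Cderive G z k -> is_Cderive (fun w => F (G w)) z (l * k).
Proof.
  intros HF HG. pose proof (is_Cderive_continuous _ _ _ HG) as CG.
  apply is_Cderive_slope in HF. destruct HF as [Q [HQ [EQ H]]].
  apply is_Cderive_slope in HG. destruct HG as [P [HP [EP K]]].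
  apply is_Cderive_slope. exists (fun w => Q (G w) * P w)%C.
  split; [|split].
  - apply continuous_Cmult; auto. apply (continuous_comp G Q); auto.
  - now rewrite EQ, EP.
  - intros w. rewrite (H (G w)).
    replace (G w - G z)%C with (P w * (w - z))%C by (rewrite (K w); ring). ring.
Qed.

Lemma is_Cderive_inv (z : C) : z <> 0 -> is_Cderive Cinv z (- / (z * z)).
Proof.
  intros Hz. apply is_Cderive_eps. intros eps He.
  assert (Hm : 0 < Cmod z) by now apply Cmod_gt_0.
  assert (Hc : 0 < eps * Cmod z ^ 3 / 2) by (apply Rdiv_lt_0_compat; [|lra]; apply Rmult_lt_0_compat; auto; apply pow_lt; auto).
  (* Once |w| >= |z| / 2, the factor 1 / |w z z| is at most 2 / |z|^3, which dictates the second
     radius. *)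
  exists (Rmin (Cmod z / 2) (eps * Cmod z ^ 3 / 2)). split.
  { apply Rmin_pos; lra. }
  intros w Hw.
  assert (H1 := Rlt_le_trans _ _ _ Hw (Rmin_l _ _)).
  assert (H2 := Rlt_le_trans _ _ _ Hw (Rmin_r _ _)).
  assert (Hwm : Cmod z / 2 <= Cmod w).
  { pose proof (Cmod_triangle w (z - w)) as T. replace (w + (z - w))%C with z in T by ring.
    replace (z - w)%C with (- (w - z))%C in T by ring. rewrite Cmod_opp in T. lra. }
  assert (Hw0 : w <> 0) by (apply Cmod_gt_0; lra).
  replace (/ w - / z - - / (z * z) * (w - z))%C with ((w - z) / (w * z * z) * (w - z))%C by (field; auto).
  rewrite Cmod_mult. apply Rmult_le_compat_r; [apply Cmod_ge_0|].
  rewrite Cmod_div, !Cmod_mult by (apply Cmod_gt_0; rewrite !Cmod_mult; repeat apply Rmult_lt_0_compat; lra).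
  apply Rle_div_l; [repeat apply Rmult_lt_0_compat; lra|].
  apply Rle_trans with (1 := Rlt_le _ _ H2).
  apply Rle_trans with (eps * (Cmod z / 2 * Cmod z * Cmod z)); [right; field|].
  apply Rmult_le_compat_l; [lra|]. apply Rmult_le_compat_r; [lra|]. apply Rmult_le_compat_r; lra.
Qed.

Lemma is_Cderive_div (F G : C -> C) (z l k : C) : G z <> 0 ->
  is_Cderive F z l -> is_Cderive G z k ->
  is_Cderive (fun w => F w / G w)%C z ((l * G z - F z * k) / (G z * G z)).
Proof.
  intros H0 HF HG. eapply is_Cderive_eq.
  - apply (is_Cderive_mult F (fun w => / G w)%C); [exact HF|].
    apply (is_Cderive_comp Cinv G); [now apply is_Cderive_inv|exact HG].
  - field; auto.
Qed.

Lemma is_Cderive_pow (n : nat) (z : C) :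
  is_Cderive (fun w => w ^ n)%C z (RtoC (INR n) * z ^ pred n).
Proof.
  induction n as [|n IH].
  - eapply is_Cderive_eq; [apply (is_Cderive_const 1)|]. simpl. ring.
  - eapply is_Cderive_eq.
    + apply (is_Cderive_mult (fun w => w) (fun w => w ^ n)%C); [apply is_Cderive_id|exact IH].
    + rewrite S_INR, RtoC_plus. destruct n; simpl; ring.
Qed.

Lemma is_Cderive_unique (F : C -> C) (z l k : C) :
  is_Cderive F z l -> is_Cderive F z k -> l = k.
Proof.
  intros H K. rewrite <- (is_C_derive_unique _ _ _ H). now apply is_C_derive_unique.
Qed.

(** Serves to reflect the parameter domain of a surface whose Gauss map has the opposite
    orientation. *)
Lemma is_Cderive_conj (F : C -> C) (z l : C) :
  is_Cderive F (Cconj z) l -> is_Cderive (fun w => Cconj (F (Cconj w))) z (Cconj l).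
Proof.
  rewrite !is_Cderive_eps. intros H eps He. destruct (H eps He) as [d [Hd K]].
  exists d; split; auto. intros w Hw.
  assert (E : forall a b, (Cconj a - Cconj b)%C = Cconj (a - b)).
  { intros a b. unfold Cminus. now rewrite Cplus_conj, Copp_conj. }
  specialize (K (Cconj w)). rewrite E, Cmod_conj in K. specialize (K Hw).
  rewrite E. replace (w - z)%C with (Cconj (Cconj (w - z))) at 1 by apply Cconj_conj.
  rewrite <- Cmult_conj, E, Cmod_conj. exact K.
Qed.

(** * Curves and mean values *)

Lemma is_derive_Cpair (p : R -> C) (t : R) (l : C) :
  is_derive p t l <->
  is_derive (fun s => Re (p s)) t (Re l) /\ is_derive (fun s => Im (p s)) t (Im l).
Proof.
  split.
  - intros H. split.
    + apply (filterdiff_comp' p fst t (fun y => scal y l) fst); [exact H|].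
      apply filterdiff_linear, is_linear_fst.
    + apply (filterdiff_comp' p snd t (fun y => scal y l) snd); [exact H|].
      apply filterdiff_linear, is_linear_snd.
  - intros [H1 H2].
    apply (filterdiff_ext_lin _ (fun y : R => (scal y (Re l), scal y (Im l)))).
    2: { intros y. destruct l; reflexivity. }
    apply (filterdiff_ext (fun s => (Re (p s), Im (p s)))).
    { intros s. now destruct (p s). }
    apply (filterdiff_comp'_2 (fun s => Re (p s)) (fun s => Im (p s)) (fun x y => (x, y)) t
      (fun y => scal y (Re l)) (fun y => scal y (Im l)) (fun x y => (x, y))); auto.
    apply (filterdiff_ext (fun x : R * R => x)); [now intros []|].
    apply (filterdiff_ext_lin _ (fun x : R * R => x)); [|now intros []].
    apply filterdiff_id.
Qed.

Lemma is_derive_R_slope (f : R -> R) (t l : R) :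
  is_derive f t l <->
  exists q : R -> R, continuous q t /\ q t = l /\ forall s, f s = f t + q s * (s - t).
Proof.
  split.
  - intros H. apply is_derive_Reals in H.
    exists (fun s => if Req_dec_T s t then l else (f s - f t) / (s - t)).
    assert (Ht : (if Req_dec_T t t then l else (f t - f t) / (t - t)) = l)
      by (destruct (Req_dec_T t t); congruence).
    split; [|split; auto].
    + apply continuity_pt_filterlim. intros eps He.
      destruct (H eps He) as [d Hd]. exists d. split; [apply cond_pos|].
      intros x [_ Hx]. simpl in *. unfold Rdist in *. rewrite Ht.
      destruct (Req_dec_T x t) as [->|N]; [rewrite Rminus_diag, Rabs_R0; auto|].
      assert (Hxt : x - t <> 0) by lra.
      specialize (Hd _ Hxt Hx). now replace (t + (x - t)) with x in Hd by ring.
    + intros s. destruct (Req_dec_T s t) as [->|N]; [ring|]. field. lra.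
  - intros [q [Hq [E Hs]]]. apply is_derive_Reals. intros eps He.
    apply continuity_pt_filterlim in Hq. destruct (Hq eps He) as [d [Hd H]].
    exists (mkposreal _ Hd). intros h Hh Hhd. simpl in *. unfold Rdist in H.
    rewrite (Hs (t + h)).
    replace ((f t + q (t + h) * (t + h - t) - f t) / h - l) with (q (t + h) - q t)
      by (rewrite E; field; auto).
    apply H. split; [split; [exact I|lra]|]. now replace (t + h - t) with h by ring.
Qed.

Lemma is_derive_C_slope (p : R -> C) (t : R) (l : C) :
  is_derive p t l <->
  exists Q : R -> C, continuous Q t /\ Q t = l /\
    forall s, p s = (p t + Q s * RtoC (s - t))%C.
Proof.
  rewrite is_derive_Cpair. split.
  - intros [H1 H2]. apply is_derive_R_slope in H1. apply is_derive_R_slope in H2.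
    destruct H1 as [q1 [C1 [E1 K1]]], H2 as [q2 [C2 [E2 K2]]].
    exists (fun s => (q1 s, q2 s)). split; [|split].
    + now apply continuous_Cpair.
    + apply C_ext; simpl; auto.
    + intros s. apply C_ext; simpl; [rewrite (K1 s)|rewrite (K2 s)]; unfold Re, Im; ring.
  - intros [Q [HQ [E K]]]. split; apply is_derive_R_slope.
    + exists (fun s => Re (Q s)). split; [now apply continuous_Re|]. split; [congruence|].
      intros s. rewrite (K s). simpl. unfold Re, Im. ring.
    + exists (fun s => Im (Q s)). split; [now apply continuous_Im|]. split; [congruence|].
      intros s. rewrite (K s). simpl. unfold Re, Im. ring.
Qed.

Lemma is_derive_C_continuous (p : R -> C) (t : R) (l : C) :
  is_derive p t l -> continuous p t.
Proof. intros H. apply (ex_derive_continuous p). now exists l. Qed.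

Lemma is_derive_C_comp (F : C -> C) (p : R -> C) (t : R) (l k : C) :
  is_Cderive F (p t) l -> is_derive p t k -> is_derive (fun s => F (p s)) t (l * k)%C.
Proof.
  intros HF Hp. pose proof (is_derive_C_continuous _ _ _ Hp) as Cp.
  apply is_Cderive_slope in HF. destruct HF as [Q [HQ [EQ H]]].
  apply is_derive_C_slope in Hp. destruct Hp as [P [HP [EP K]]].
  apply is_derive_C_slope. exists (fun s => Q (p s) * P s)%C.
  split; [|split].
  - apply continuous_Cmult; auto. apply (continuous_comp p Q); auto.
  - now rewrite EQ, EP.
  - intros s. rewrite (H (p s)).
    replace (p s - p t)%C with (P s * RtoC (s - t))%C by (rewrite (K s); ring). ring.
Qed.

Lemma is_derive_C_mult (p q : R -> C) (t : R) (k l : C) :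
  is_derive p t k -> is_derive q t l ->
  is_derive (fun s => p s * q s)%C t (k * q t + p t * l)%C.
Proof.
  intros Hp Hq. pose proof (is_derive_C_continuous _ _ _ Hq) as Cq.
  apply is_derive_C_slope in Hp. destruct Hp as [P [HP [EP K]]].
  apply is_derive_C_slope in Hq. destruct Hq as [Q [HQ [EQ H]]].
  apply is_derive_C_slope. exists (fun s => P s * q s + p t * Q s)%C.
  split; [|split].
  - apply continuous_Cplus; apply continuous_Cmult; auto. apply continuous_const.
  - now rewrite EQ, EP.
  - intros s. rewrite (K s). rewrite (H s). ring.
Qed.

Lemma is_derive_segment (z d : C) (s : R) :
  is_derive (fun s : R => (z + RtoC s * d)%C) s d.
Proof.
  apply is_derive_C_slope. exists (fun _ => d). split; [apply continuous_const|].
  split; auto. intros x. rewrite RtoC_minus. ring.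
Qed.

(* The differentiability of [p] is a conclusion: it is inherited from that of [G o p]. *)
Lemma is_derive_C_comp_inv (G : C -> C) (p : R -> C) (t : R) (A k : C) :
  A <> 0 -> is_Cderive G (p t) A -> continuous p t ->
  is_derive (fun s => G (p s)) t k -> is_derive p t (k / A)%C.
Proof.
  intros HA HG Cp Hk.
  apply is_Cderive_slope in HG. destruct HG as [Q [HQ [EQ H]]].
  assert (CQ : continuous (fun s => Q (p s)) t) by (apply (continuous_comp p Q); auto).
  assert (N : locally t (fun s => Q (p s) <> 0)).
  { apply (continuous_C_neq_0 (fun s => Q (p s)) t); auto. now rewrite EQ. }
  apply is_derive_C_slope in Hk. destruct Hk as [P [HP [EP K]]].
  assert (D : is_derive (fun s => p t + P s / Q (p s) * RtoC (s - t))%C t (k / A)%C).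
  { apply is_derive_C_slope. exists (fun s => P s / Q (p s))%C. split; [|split].
    - apply continuous_Cdiv; auto. now rewrite EQ.
    - now rewrite EP, EQ.
    - intros s. rewrite Rminus_diag. ring. }
  apply is_derive_ext_loc with (2 := D).
  generalize N. apply filter_imp. intros s Hs.
  assert (E : (P s * RtoC (s - t))%C = (Q (p s) * (p s - p t))%C).
  { transitivity (G (p s) - G (p t))%C; [rewrite (K s)|rewrite (H (p s))]; ring. }
  match goal with |- @eq _ ?a ?b => change (@eq C a b) end.
  replace (P s / Q (p s) * RtoC (s - t))%C with (P s * RtoC (s - t) / Q (p s))%C
    by (field; auto).
  rewrite E. field. auto.
Qed.

Lemma ball_convex (z0 z w : C) (r s : R) : 0 <= s <= 1 ->
  Cmod (z - z0) < r -> Cmod (w - z0) < r ->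
  Cmod (z + RtoC s * (w - z) - z0) < r.
Proof.
  intros Hs Hz Hw.
  replace (z + RtoC s * (w - z) - z0)%C
    with (RtoC (1 - s) * (z - z0) + RtoC s * (w - z0))%C by (rewrite RtoC_minus; ring).
  eapply Rle_lt_trans; [apply Cmod_triangle|].
  rewrite !Cmod_mult, !Cmod_R, !Rabs_right by lra. 
  destruct (Req_dec s 0) as [->|N]; [lra|]. nra.
Qed.

Lemma real_mean_value (f df : R -> R) (M : R) :
  (forall s, 0 <= s <= 1 -> is_derive f s (df s)) ->
  (forall s, 0 <= s <= 1 -> Rabs (df s) <= M) -> Rabs (f 1 - f 0) <= M.
Proof.
  intros H1 H2. destruct (MVT_gen f 0 1 df) as [c [Hc E]].
  - intros x. rewrite Rmin_left, Rmax_right by lra. intros Hx. apply H1. lra.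
  - intros x. rewrite Rmin_left, Rmax_right by lra. intros Hx.
    apply continuity_pt_filterlim, (ex_derive_continuous f). exists (df x). now apply H1.
  - rewrite Rmin_left, Rmax_right in Hc by lra. rewrite E, Rminus_0_r, Rmult_1_r. auto.
Qed.

(** The mean value theorem is applied to the real and imaginary parts separately, hence the factor
    2. *)
Lemma C_mean_value (p dp : R -> C) (M : R) :
  (forall s, 0 <= s <= 1 -> is_derive p s (dp s)) ->
  (forall s, 0 <= s <= 1 -> Cmod (dp s) <= M) -> Cmod (p 1 - p 0) <= 2 * M.
Proof.
  intros H1 H2. eapply Rle_trans; [apply Cmod_le_Re_Im|].
  assert (A : Rabs (Re (p 1) - Re (p 0)) <= M).
  { apply (real_mean_value (fun s => Re (p s)) (fun s => Re (dp s))).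
    - intros s Hs. now apply is_derive_Cpair, H1.
    - intros s Hs. eapply Rle_trans; [apply re_le_Cmod|auto]. }
  assert (B : Rabs (Im (p 1) - Im (p 0)) <= M).
  { apply (real_mean_value (fun s => Im (p s)) (fun s => Im (dp s))).
    - intros s Hs. now apply is_derive_Cpair, H1.
    - intros s Hs. eapply Rle_trans; [apply im_le_Cmod|auto]. }
  change (Re (p 1 - p 0)) with (Re (p 1) - Re (p 0)).
  change (Im (p 1 - p 0)) with (Im (p 1) - Im (p 0)). lra.
Qed.

Lemma Cderive_lipschitz (F F' : C -> C) (z0 : C) (r M : R) :
  (forall w, Cmod (w - z0) < r -> is_Cderive F w (F' w)) ->
  (forall w, Cmod (w - z0) < r -> Cmod (F' w) <= M) ->
  forall z w, Cmod (z - z0) < r -> Cmod (w - z0) < r ->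
  Cmod (F w - F z) <= 2 * (M * Cmod (w - z)).
Proof.
  intros H1 H2 z w Hz Hw.
  pose (p := fun s : R => F (z + RtoC s * (w - z))%C).
  assert (A := C_mean_value p (fun s => F' (z + RtoC s * (w - z)) * (w - z))%C
                 (M * Cmod (w - z))).
  unfold p in A. 
  replace (z + RtoC 1 * (w - z))%C with w in A by ring.
  replace (z + RtoC 0 * (w - z))%C with z in A by ring.
  apply A.
  - intros s Hs. apply is_derive_C_comp; [|apply is_derive_segment].
    apply H1. now apply ball_convex.
  - intros s Hs. rewrite Cmod_mult. apply Rmult_le_compat_r; [apply Cmod_ge_0|].
    apply H2. now apply ball_convex.
Qed.

Lemma curve_derive_0_constant (p : R -> C) (a b : R) :
  (forall t, a < t < b -> is_derive p t (RtoC 0)) ->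
  forall s t, a < s < b -> a < t < b -> p s = p t.
Proof.
  intros H s t Hs Ht.
  assert (A : Cmod (p (s + 1 * (t - s)) - p (s + 0 * (t - s))) <= 2 * 0).
  { apply (C_mean_value (fun x => p (s + x * (t - s))) (fun _ => RtoC 0)).
    - intros x Hx.
      assert (D := is_derive_comp p (fun x => s + x * (t - s)) x (RtoC 0) (t - s)).
      match type of D with _ -> _ -> is_derive _ _ ?l =>
        replace l with (RtoC 0) in D
          by (apply C_ext; simpl; unfold scal, Re, Im; simpl; unfold mult; simpl; ring)
      end.
      apply D.
      + apply H. destruct (Rle_dec s t); split; nra.
      + auto_derive; auto. ring.
    - intros; rewrite Cmod_0; lra. }
  replace (s + 1 * (t - s)) with t in A by ring. replace (s + 0 * (t - s)) with s in A by ring.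
  assert (E : (p t - p s)%C = 0).
  { apply Cmod_eq_0. pose proof (Cmod_ge_0 (p t - p s)). lra. }
  replace (p t) with (p t - p s + p s)%C by ring. rewrite E. ring.
Qed.

(** Continuity of the derivative is built in: Cauchy's formula is obtained below by differentiating
    under the integral sign. *)
Definition C1_holomorphic (F F' : C -> C) (z0 : C) (r : R) : Prop :=
  forall w, Cmod (w - z0) < r ->
    is_Cderive F w (F' w) /\ @continuous C_UniformSpace C_UniformSpace F' w.

(* If [F'] is close to [F' z0 <> 0] on a small disc, [F - F' z0 * id] contracts there. *)
Lemma C1_holomorphic_locally_injective (F F' : C -> C) (z0 : C) (r : R) :
  0 < r -> C1_holomorphic F F' z0 r -> F' z0 <> 0 ->
  exists e, 0 < e <= r /\ forall z w, Cmod (z - z0) < e -> Cmod (w - z0) < e ->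
    F z = F w -> z = w.
Proof.
  intros Hr H HN. assert (Hm := HN). apply Cmod_gt_0 in Hm.
  assert (H0 : Cmod (z0 - z0) < r).
  { replace (z0 - z0)%C with (RtoC 0) by ring. now rewrite Cmod_0. }
  destruct (H z0 H0) as [_ HC].
  (* With the factor 2 of [Cderive_lipschitz], a quarter makes the Lipschitz constant of the
     perturbation half of |F' z0|. *)
  assert (Hm4 : 0 < Cmod (F' z0) / 4) by lra.
  destruct (continuous_Cmod (U := C_UniformSpace) F' z0) as [A _].
  specialize (A HC _ Hm4). apply locally_Cmod in A. destruct A as [e [He A]].
  exists (Rmin e r). split; [split; [apply Rmin_pos; auto|apply Rmin_r]|].
  intros z w Hz Hw E.
  assert (L := Cderive_lipschitz (fun w => F w - F' z0 * w)%C (fun w => F' w - F' z0)%C z0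
    (Rmin e r) (Cmod (F' z0) / 4)).
  assert (L' : Cmod (F w - F' z0 * w - (F z - F' z0 * z)) <= 2 * (Cmod (F' z0) / 4 * Cmod (w - z))).
  { apply L; auto.
    - intros v Hv. apply is_Cderive_minus.
      + apply H. eapply Rlt_le_trans; [exact Hv|apply Rmin_r].
      + eapply is_Cderive_eq; [apply is_Cderive_scal, is_Cderive_id|]. ring.
    - intros v Hv. left. apply A. eapply Rlt_le_trans; [exact Hv|apply Rmin_l]. }
  rewrite E in L'.
  replace (F w - F' z0 * w - (F w - F' z0 * z))%C with (- (F' z0 * (w - z)))%C in L' by ring.
  rewrite Cmod_opp, Cmod_mult in L'.
  assert (Z : (w - z)%C = 0).
  { apply Cmod_eq_0. pose proof (Cmod_ge_0 (w - z)). nra. }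
  replace w with (w - z + z)%C by ring. rewrite Z. ring.
Qed.

(** * Cauchy's formula, the identity theorem and primitives *)

(** The margin [d] around [a, b] is there because joint continuity at an endpoint looks at values of
    [t] outside the interval. *)
Lemma is_derive_RInt_param_continuous (W V : R -> R -> R) (a b l0 d : R) :
  0 < d -> a <= b ->
  (forall l t, Rabs (l - l0) < d -> a - d < t < b + d ->
     is_derive (fun x => W x t) l (V l t) /\ continuous (W l) t) ->
  (forall t, a <= t <= b ->
     continuous (fun q : R * R => V (fst q) (snd q)) (l0, t)) ->
  is_derive (fun l => RInt (W l) a b) l0 (RInt (V l0) a b).
Proof.
  intros Hd Hab H1 H2.
  assert (H0 : Rabs (l0 - l0) < d) by (rewrite Rminus_diag, Rabs_R0; auto).
  assert (E : RInt (fun t => Derive (fun u => W u t) l0) a b = RInt (V l0) a b).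
  { apply RInt_ext. intros t. rewrite Rmin_left, Rmax_right by lra. intros Ht.
    apply is_derive_unique, H1; auto. lra. }
  rewrite <- E.
  apply is_derive_RInt_param.
  - exists (mkposreal _ Hd). intros l Hl t. rewrite Rmin_left, Rmax_right by lra. intros Ht.
    exists (V l t). apply H1; [exact Hl|lra].
  - intros t. rewrite Rmin_left, Rmax_right by lra. intros Ht.
    apply (continuity_2d_pt_ext_loc V).
    + exists (mkposreal _ Hd). intros u v Hu Hv. simpl in *. symmetry.
      apply is_derive_unique, H1; auto. apply Rabs_def2 in Hv. lra.
    + apply continuity_2d_pt_filterlim. now apply H2.
  - exists (mkposreal _ Hd). intros l Hl. apply (ex_RInt_continuous (W l)).
    intros t. rewrite Rmin_left, Rmax_right by lra. intros Ht. apply H1; [exact Hl|lra].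
Qed.

(** Taken componentwise, so that estimates and differentiation under the integral sign are those of
    real integrals. *)
Definition CRInt (f : R -> C) (a b : R) : C :=
  (RInt (fun t => Re (f t)) a b, RInt (fun t => Im (f t)) a b).

Lemma ex_RInt_Re (f : R -> C) (a b : R) :
  (forall t, continuous f t) -> ex_RInt (fun t => Re (f t)) a b.
Proof. intros H. apply (ex_RInt_continuous (fun t => Re (f t))). intros. now apply continuous_Re. Qed.

Lemma ex_RInt_Im (f : R -> C) (a b : R) :
  (forall t, continuous f t) -> ex_RInt (fun t => Im (f t)) a b.
Proof. intros H. apply (ex_RInt_continuous (fun t => Im (f t))). intros. now apply continuous_Im. Qed.

Lemma CRInt_ext (f g : R -> C) (a b : R) : (forall t, f t = g t) -> CRInt f a b = CRInt g a b.
Proof.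
  intros H. unfold CRInt. f_equal; apply RInt_ext; intros; now rewrite H.
Qed.

Lemma CRInt_plus (f g : R -> C) (a b : R) :
  (forall t, continuous f t) -> (forall t, continuous g t) ->
  CRInt (fun t => f t + g t)%C a b = (CRInt f a b + CRInt g a b)%C.
Proof.
  intros Hf Hg. apply C_ext; simpl.
  - apply (RInt_plus (fun t => Re (f t)) (fun t => Re (g t))); now apply ex_RInt_Re.
  - apply (RInt_plus (fun t => Im (f t)) (fun t => Im (g t))); now apply ex_RInt_Im.
Qed.

Lemma CRInt_scal (c : C) (f : R -> C) (a b : R) :
  (forall t, continuous f t) ->
  CRInt (fun t => c * f t)%C a b = (c * CRInt f a b)%C.
Proof.
  intros Hf.
  assert (S : forall k (h : R -> R), ex_RInt h a b -> RInt (fun t => k * h t) a b = k * RInt h a b).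
  { intros k h Hh. exact (RInt_scal h a b k Hh). }
  assert (S' : forall k (h : R -> R), ex_RInt h a b -> ex_RInt (fun t => k * h t) a b).
  { intros k h Hh. exact (ex_RInt_scal h a b k Hh). }
  pose proof (ex_RInt_Re f a b Hf) as HR. pose proof (ex_RInt_Im f a b Hf) as HI.
  apply C_ext; simpl.
  - rewrite <- !S by auto.
    exact (RInt_minus (fun t => Re c * Re (f t)) (fun t => Im c * Im (f t)) a b
             (S' _ _ HR) (S' _ _ HI)).
  - rewrite <- !S by auto.
    exact (RInt_plus (fun t => Re c * Im (f t)) (fun t => Im c * Re (f t)) a b
             (S' _ _ HI) (S' _ _ HR)).
Qed.

Lemma Cmod_CRInt_le (f : R -> C) (a b M : R) : a <= b ->
  (forall t, continuous f t) -> (forall t, a <= t <= b -> Cmod (f t) <= M) ->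
  Cmod (CRInt f a b) <= 2 * ((b - a) * M).
Proof.
  intros Hab Hf HM. eapply Rle_trans; [apply Cmod_le_Re_Im|]. simpl.
  assert (A : Rabs (RInt (fun t => Re (f t)) a b) <= (b - a) * M).
  { apply abs_RInt_le_const; auto. now apply ex_RInt_Re.
    intros t Ht. eapply Rle_trans; [apply re_le_Cmod|auto]. }
  assert (B : Rabs (RInt (fun t => Im (f t)) a b) <= (b - a) * M).
  { apply abs_RInt_le_const; auto. now apply ex_RInt_Im.
    intros t Ht. eapply Rle_trans; [apply im_le_Cmod|auto]. }
  lra.
Qed.

(** * The Cauchy integral over a circle *)

Definition expi (t : R) : C := (cos t, sin t).

Lemma Cmod_expi (t : R) : Cmod (expi t) = 1.
Proof.
  unfold Cmod, expi; simpl. replace (_ + _) with 1; [apply sqrt_1|].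
  pose proof (sin2_cos2 t) as H. unfold Rsqr in H. lra.
Qed.

Lemma expi_neq_0 (t : R) : expi t <> 0.
Proof. apply Cmod_gt_0. rewrite Cmod_expi. lra. Qed.

Lemma is_derive_expi (k t : R) : is_derive (fun s => expi (k * s)) t (RtoC k * Ci * expi (k * t))%C.
Proof.
  apply is_derive_Cpair; simpl. split; auto_derive; auto; ring.
Qed.

Lemma continuous_expi (k t : R) : continuous (fun s => expi (k * s)) t.
Proof. eapply is_derive_C_continuous, is_derive_expi. Qed.

Lemma continuous_expi_1 (t : R) : continuous expi t.
Proof.
  apply (continuous_ext (fun s => expi (1 * s))); [intros; now rewrite Rmult_1_l|].
  apply continuous_expi.
Qed.

Lemma expi_periodic (t : R) : expi (t + 2 * PI) = expi t.
Proof. unfold expi. now rewrite cos_plus, sin_plus, cos_2PI, sin_2PI, !Rmult_1_r, !Rmult_0_r, Rminus_0_r, Rplus_0_r. Qed.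

(** Controls how far the point (1 - l) z + l w leaves the disc when [l] is allowed to exceed [0, 1]
    by [d]. *)
Lemma Rabs_convex_extended (d l r s : R) : 0 <= r -> 0 <= s -> 0 <= d -> s <= r ->
  - d <= l <= 1 + d -> Rabs (1 - l) * s + Rabs l * r <= (1 + 2 * d) * r.
Proof.
  intros. assert (Rabs (1 - l) + Rabs l <= 1 + 2 * d).
  { unfold Rabs; destruct (Rcase_abs (1 - l)), (Rcase_abs l); lra. }
  pose proof (Rabs_pos (1 - l)). pose proof (Rabs_pos l). nra.
Qed.

Lemma C1_holomorphic_continuous (F F' : C -> C) (z0 : C) (r : R) (w : C) :
  C1_holomorphic F F' z0 r -> Cmod (w - z0) < r ->
  @continuous C_UniformSpace C_UniformSpace F w.
Proof. intros H Hw. eapply is_Cderive_continuous, H, Hw. Qed.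

Lemma C1_holomorphic_scal (c : C) (F F' : C -> C) (z0 : C) (r : R) :
  C1_holomorphic F F' z0 r -> C1_holomorphic (fun w => c * F w)%C (fun w => c * F' w)%C z0 r.
Proof.
  intros H w Hw. destruct (H w Hw). split; [now apply is_Cderive_scal|].
  apply continuous_Cmult; auto. apply continuous_const.
Qed.

(** The Cauchy kernel: for w = z0 + r exp (i t), the form dw / (i (w - z)) is [kernel z0 r z t]
    dt. *)
Definition kernel (z0 : C) (r : R) (z : C) (t : R) : C :=
  (RtoC r * expi t / (z0 + RtoC r * expi t - z))%C.

Lemma kernel_denominator (z0 z : C) (r t : R) : Cmod (z - z0) < r ->
  (z0 + RtoC r * expi t - z)%C <> 0 /\ r - Cmod (z - z0) <= Cmod (z0 + RtoC r * expi t - z).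
Proof.
  intros Hz.
  assert (L : r - Cmod (z - z0) <= Cmod (z0 + RtoC r * expi t - z)).
  { pose proof (Cmod_triangle (z0 + RtoC r * expi t - z) (z - z0)) as T.
    replace (z0 + RtoC r * expi t - z + (z - z0))%C with (RtoC r * expi t)%C in T by ring.
    rewrite Cmod_mult, Cmod_R, Cmod_expi, Rabs_right in T; [lra|].
    pose proof (Cmod_ge_0 (z - z0)). lra. }
  split; auto. apply Cmod_gt_0. lra.
Qed.

Lemma continuous_kernel (z0 z : C) (r t : R) : Cmod (z - z0) < r ->
  continuous (kernel z0 r z) t.
Proof.
  intros Hz. unfold kernel. apply continuous_Cdiv.
  - now apply kernel_denominator.
  - apply continuous_Cmult; [apply continuous_const|apply continuous_expi_1].
  - apply continuous_Cminus; [apply continuous_Cplus|]; try apply continuous_const.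
    apply continuous_Cmult; [apply continuous_const|apply continuous_expi_1].
Qed.

(** The kernel is 1 / (1 - x) with x = (z - z0) / (r exp (i t)) in the unit disc, and x -> 1 / (1 -
    x) sends that disc into the half plane Re > 1/2. *)
Lemma Re_kernel (z0 z : C) (r t : R) : Cmod (z - z0) < r -> / 2 <= Re (kernel z0 r z t).
Proof.
  intros Hz. destruct (kernel_denominator z0 z r t Hz) as [N _].
  unfold kernel, Cdiv. rewrite Cinv_conj_norm. apply Re2_Im2_neq_0 in N.
  set (d := (z0 + RtoC r * expi t - z)%C) in *.
  assert (P : 0 < Re d * Re d + Im d * Im d) by nra.
  replace (Re (RtoC r * expi t * (Cconj d * RtoC (/ (Re d * Re d + Im d * Im d)))))
    with ((r * cos t * Re d + r * sin t * Im d) / (Re d * Re d + Im d * Im d)).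
  2: { unfold Rdiv, Re, Im. simpl. ring. }
  apply Rle_div_r; auto.
  assert (S : Re (z - z0) * Re (z - z0) + Im (z - z0) * Im (z - z0) <= r * r).
  { pose proof (Cmod2_alt (z - z0)) as Q. pose proof (Cmod_ge_0 (z - z0)). nra. }
  assert (D1 : Re d = r * cos t - Re (z - z0)) by (unfold d, Re; simpl; ring).
  assert (D2 : Im d = r * sin t - Im (z - z0)) by (unfold d, Im; simpl; ring).
  pose proof (sin2_cos2 t) as T. unfold Rsqr in T.
  rewrite D1, D2. set (u := Re (z - z0)) in *. set (v := Im (z - z0)) in *.
  assert (r * r * (sin t * sin t + cos t * cos t) = r * r) by (rewrite T; ring). nra.
Qed.

(** The integral equals 2 pi, but the identity theorem only divides by it, so a positive lower bound
    on its real part is enough. *)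
Lemma CRInt_kernel_neq_0 (z0 z : C) (r : R) : Cmod (z - z0) < r ->
  CRInt (kernel z0 r z) 0 (2 * PI) <> 0.
Proof.
  intros Hz E. apply (f_equal Re) in E.
  change (RInt (fun t => Re (kernel z0 r z t)) 0 (2 * PI) = 0) in E.
  assert (A : RInt (fun _ => / 2) 0 (2 * PI) <= RInt (fun t => Re (kernel z0 r z t)) 0 (2 * PI)).
  { pose proof PI_RGT_0. apply RInt_le; [lra| | |].
    - apply ex_RInt_const.
    - apply ex_RInt_Re. intros. now apply continuous_kernel.
    - intros. now apply Re_kernel. }
  rewrite RInt_const, E in A. unfold scal in A; simpl in A. unfold mult in A; simpl in A.
  pose proof PI_RGT_0. lra.
Qed.

(* Deform the circle to the point [z] along [z + l * (w - z)], [l] from 1 to 0: the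
   derivative of the integral in [l] is the integral of a derivative in [t]. *)
Lemma Cauchy_formula_Re (F F' : C -> C) (z0 z : C) (r r0 : R) :
  r < r0 -> Cmod (z - z0) < r -> C1_holomorphic F F' z0 r0 ->
  RInt (fun t => Re (F (z0 + RtoC r * expi t) * kernel z0 r z t)%C) 0 (2 * PI) =
  RInt (fun t => Re (F z * kernel z0 r z t)%C) 0 (2 * PI).
Proof.
  intros Hr Hz HF. pose proof (Cmod_ge_0 (z - z0)) as Hz0. pose proof PI_RGT_0 as HPI.
  pose (zeta := fun l t => (z + RtoC l * (z0 + RtoC r * expi t - z))%C).
  (* Differentiating at l = 0 and l = 1 needs room on both sides; this [d] keeps the deformed circle
     within radius (1 + 2 d) r = r + (r0 - r) / 2 < r0. *)
  pose (d := (r0 - r) / (4 * r)).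
  assert (Hd : 0 < d) by (apply Rdiv_lt_0_compat; lra).
  assert (Hdr : (1 + 2 * d) * r < r0).
  { unfold d. replace ((1 + 2 * ((r0 - r) / (4 * r))) * r) with (r + (r0 - r) / 2) by (field; lra). lra. }
  assert (Z : forall l t, - d <= l <= 1 + d -> Cmod (zeta l t - z0) < r0).
  { intros l t Hl. eapply Rle_lt_trans; [|exact Hdr].
    replace (zeta l t - z0)%C with (RtoC (1 - l) * (z - z0) + RtoC l * (RtoC r * expi t))%C
      by (unfold zeta; rewrite RtoC_minus; ring).
    eapply Rle_trans; [apply Cmod_triangle|].
    rewrite !Cmod_mult, !Cmod_R, Cmod_expi, Rmult_1_r, (Rabs_right r) by lra.
    apply Rabs_convex_extended; lra. }
  pose (J := fun l => RInt (fun t => Re (F (zeta l t) * kernel z0 r z t)%C) 0 (2 * PI)).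
  (* The factor w - z produced by the [l]-derivative cancels the denominator of the kernel, so the
     derivative of the integrand has no singularity. *)
  pose (V := fun l t => Re (F' (zeta l t) * (RtoC r * expi t))%C).
  assert (Czt : forall l t, continuous (zeta l) t).
  { intros l t. unfold zeta. apply continuous_Cplus; [apply continuous_const|].
    apply continuous_Cmult; [apply continuous_const|].
    apply continuous_Cminus; [apply continuous_Cplus|]; try apply continuous_const.
    apply continuous_Cmult; [apply continuous_const|apply continuous_expi_1]. }
  assert (DJ : forall l, 0 <= l <= 1 -> is_derive J l (RInt (V l) 0 (2 * PI))).
  { intros l Hl.
    apply (is_derive_RInt_param_continuous (fun l t => Re (F (zeta l t) * kernel z0 r z t)%C) V _ _ l d);
      [exact Hd|lra| |].
    - intros x t Hx _. apply Rabs_def2 in Hx. split.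
      + assert (D : is_derive (fun x => F (zeta x t) * kernel z0 r z t)%C x
          (F' (zeta x t) * (z0 + RtoC r * expi t - z) * kernel z0 r z t + F (zeta x t) * 0)%C).
        { apply (is_derive_C_mult (fun x => F (zeta x t)) (fun _ => kernel z0 r z t)).
          - apply is_derive_C_comp; [|apply is_derive_segment].
            apply HF, Z. lra.
          - apply (is_derive_const (kernel z0 r z t : prod_NormedModule _ _ _)). }
        replace (V x t) with (Re (F' (zeta x t) * (z0 + RtoC r * expi t - z) * kernel z0 r z t + F (zeta x t) * 0)%C).
        * exact (proj1 (proj1 (is_derive_Cpair _ _ _) D)).
        * unfold V. f_equal. unfold kernel. field. now apply kernel_denominator.
      + apply (continuous_Re (fun t => F (zeta x t) * kernel z0 r z t)%C).
        apply continuous_Cmult; [|now apply continuous_kernel].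
        apply (continuous_comp (zeta x) F); auto.
        eapply C1_holomorphic_continuous; [exact HF|]. apply Z. lra.
    - intros t _. unfold V.
      apply (continuous_Re (fun q : R * R => F' (zeta (fst q) (snd q)) * (RtoC r * expi (snd q)))%C).
      assert (Ce : continuous (fun q : R * R => expi (snd q)) (l, t)).
      { apply (continuous_comp snd expi); [apply continuous_snd|apply continuous_expi_1]. }
      apply continuous_Cmult.
      + apply (continuous_comp (fun q : R * R => zeta (fst q) (snd q)) F').
        * unfold zeta. apply continuous_Cplus; [apply continuous_const|].
          apply continuous_Cmult; [apply (continuous_RtoC fst), continuous_fst|].
          apply continuous_Cminus; [apply continuous_Cplus|]; try apply continuous_const.
          apply continuous_Cmult; [apply continuous_const|exact Ce].
        * apply HF, Z. simpl. lra.
      + apply continuous_Cmult; [apply continuous_const|exact Ce]. }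
  (* [V l t] is the [t]-derivative of Im (F (zeta l t)) / l, which has period 2 pi. The division
     excludes l = 0, and the mean value theorem only asks for the derivative on the open
     interval. *)
  assert (V0 : forall l, 0 < l < 1 -> RInt (V l) 0 (2 * PI) = 0).
  { intros l Hl. apply is_RInt_unique.
    assert (E0 : minus (/ l * Im (F (zeta l (2 * PI)))) (/ l * Im (F (zeta l 0))) = 0).
    { replace (zeta l (2 * PI)) with (zeta l 0); [unfold minus, plus, opp; simpl; ring|].
      unfold zeta. replace (2 * PI) with (0 + 2 * PI) by ring. now rewrite expi_periodic. }
    enough (I : is_RInt (V l) 0 (2 * PI)
      (minus (/ l * Im (F (zeta l (2 * PI)))) (/ l * Im (F (zeta l 0)))))
      by (rewrite E0 in I; exact I).
    apply (is_RInt_derive (fun t => / l * Im (F (zeta l t))) (V l)).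
    - intros t _.
      assert (D : is_derive (fun t => F (zeta l t)) t (F' (zeta l t) * (RtoC l * (RtoC r * (Ci * expi t))))%C).
      { apply is_derive_C_comp; [apply HF, Z; lra|].
        apply is_derive_Cpair. split; unfold zeta, Re, Im; simpl; auto_derive; auto; ring. }
      apply is_derive_Cpair in D. destruct D as [_ D].
      replace (V l t) with (/ l * Im (F' (zeta l t) * (RtoC l * (RtoC r * (Ci * expi t))))%C).
      + apply (is_derive_scal (fun t => Im (F (zeta l t))) t (/ l)). exact D.
      + unfold V, Re, Im. simpl. field. lra.
    - intros t _. unfold V. apply (continuous_Re (fun t => F' (zeta l t) * (RtoC r * expi t))%C).
      apply continuous_Cmult.
      + apply (continuous_comp (zeta l) F'); auto. apply HF, Z. lra.
      + apply continuous_Cmult; [apply continuous_const|apply continuous_expi_1]. }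
  assert (E : J 1 = J 0).
  { destruct (MVT_gen J 0 1 (fun _ => 0)) as [c [_ E]].
    - intros x. rewrite Rmin_left, Rmax_right by lra. intros Hx.
      rewrite <- (V0 x Hx). apply DJ. lra.
    - intros x. rewrite Rmin_left, Rmax_right by lra. intros Hx.
      apply continuity_pt_filterlim, (ex_derive_continuous J). eexists. now apply DJ.
    - lra. }
  unfold J, zeta in E.
  transitivity (RInt (fun t => Re (F (z + RtoC 1 * (z0 + RtoC r * expi t - z)) * kernel z0 r z t)%C) 0 (2 * PI)).
  { apply RInt_ext. intros t _. do 3 f_equal. ring. }
  rewrite E. apply RInt_ext. intros t _. do 3 f_equal. ring.
Qed.

Lemma continuous_circle (F F' : C -> C) (z0 : C) (r r0 t : R) :
  0 <= r < r0 -> C1_holomorphic F F' z0 r0 -> continuous (fun t => F (z0 + RtoC r * expi t)%C) t.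
Proof.
  intros Hr HF. apply (continuous_comp (fun t => (z0 + RtoC r * expi t)%C) F).
  - apply continuous_Cplus; [apply continuous_const|].
    apply continuous_Cmult; [apply continuous_const|apply continuous_expi_1].
  - eapply C1_holomorphic_continuous; [exact HF|].
    replace (z0 + RtoC r * expi t - z0)%C with (RtoC r * expi t)%C by ring.
    rewrite Cmod_mult, Cmod_R, Cmod_expi, Rabs_right; lra.
Qed.

Lemma Cauchy_formula (F F' : C -> C) (z0 z : C) (r r0 : R) :
  r < r0 -> Cmod (z - z0) < r -> C1_holomorphic F F' z0 r0 ->
  CRInt (fun t => F (z0 + RtoC r * expi t) * kernel z0 r z t)%C 0 (2 * PI) =
  (F z * CRInt (kernel z0 r z) 0 (2 * PI))%C.
Proof.
  intros Hr Hz HF. rewrite <- CRInt_scal by (intros; now apply continuous_kernel).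
  (* The imaginary part is the real part after multiplication by - i. *)
  assert (H := C1_holomorphic_scal (- Ci) _ _ _ _ HF).
  unfold CRInt. apply f_equal2.
  - exact (Cauchy_formula_Re F F' z0 z r r0 Hr Hz HF).
  - assert (I : forall w v : C, Im (w * v) = Re (- Ci * w * v)%C).
    { intros w v. unfold Re, Im; simpl; ring. }
    etransitivity; [|etransitivity; [exact (Cauchy_formula_Re _ _ z0 z r r0 Hr Hz H)|]];
      apply RInt_ext; intros t _; cbv beta; [|symmetry]; apply I.
Qed.

(** * Taylor expansion with remainder and the identity theorem *)

Lemma Cmod_circle (r t : R) : 0 < r -> Cmod (RtoC r * expi t) = r.
Proof. intros Hr. rewrite Cmod_mult, Cmod_R, Cmod_expi, Rabs_right; lra. Qed.

Lemma circle_neq_0 (r t : R) : 0 < r -> (RtoC r * expi t)%C <> 0.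
Proof. intros Hr. apply Cmod_gt_0. rewrite Cmod_circle; auto. Qed.

(** One step of the geometric series in (z - z0) / (r exp (i t)). Iterated under the integral, it
    gives the Taylor expansion with remainder [cauchy_term n]. *)
Lemma kernel_expansion (z0 z : C) (r t : R) : 0 < r -> Cmod (z - z0) < r ->
  kernel z0 r z t = (1 + (z - z0) * (/ (RtoC r * expi t) * kernel z0 r z t))%C.
Proof.
  intros Hr Hz. unfold kernel.
  destruct (kernel_denominator z0 z r t Hz) as [N _]. pose proof (circle_neq_0 r t Hr) as N'.
  set (w := (RtoC r * expi t)%C) in *. field. auto.
Qed.

Lemma Cmod_kernel_le (z0 z : C) (r t : R) : 0 < r -> Cmod (z - z0) < r ->
  Cmod (kernel z0 r z t) <= r / (r - Cmod (z - z0)).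
Proof.
  intros Hr Hz. destruct (kernel_denominator z0 z r t Hz) as [N L].
  unfold kernel. rewrite Cmod_div by auto. rewrite Cmod_circle by auto.
  apply Rmult_le_compat_l; [lra|]. apply Rinv_le_contravar; lra.
Qed.

(* [cauchy_term 0] is the Cauchy integral of [F], and [cauchy_term n] that of
   [F w / (w - z0) ^ n]. *)
Definition cauchy_term (F : C -> C) (z0 : C) (r : R) (n : nat) (z : C) : C :=
  CRInt (fun t => F (z0 + RtoC r * expi t) * / (RtoC r * expi t) ^ n * kernel z0 r z t)%C 0 (2 * PI).

(** For [F] holomorphic on a larger disc, this is 2 pi times its [n]-th Taylor coefficient at
    [z0]. *)
Definition cauchy_coef (F : C -> C) (z0 : C) (r : R) (n : nat) : C :=
  CRInt (fun t => F (z0 + RtoC r * expi t) * / (RtoC r * expi t) ^ n)%C 0 (2 * PI).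

Lemma continuous_cauchy_coef (F F' : C -> C) (z0 : C) (r r0 : R) (n : nat) (t : R) :
  0 < r < r0 -> C1_holomorphic F F' z0 r0 ->
  continuous (fun t => F (z0 + RtoC r * expi t) * / (RtoC r * expi t) ^ n)%C t.
Proof.
  intros Hr HF. apply continuous_Cmult.
  - apply (continuous_circle F F' z0 r r0); auto. lra.
  - apply continuous_Cinv; [apply Cpow_nz, circle_neq_0; lra|].
    apply continuous_Cpow. apply continuous_Cmult; [apply continuous_const|apply continuous_expi_1].
Qed.

Lemma cauchy_term_step (F F' : C -> C) (z0 z : C) (r r0 : R) (n : nat) :
  0 < r < r0 -> Cmod (z - z0) < r -> C1_holomorphic F F' z0 r0 ->
  cauchy_term F z0 r n z = (cauchy_coef F z0 r n + (z - z0) * cauchy_term F z0 r (S n) z)%C.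
Proof.
  intros Hr Hz HF. unfold cauchy_term, cauchy_coef.
  assert (HK := continuous_kernel z0 z r).
  rewrite <- CRInt_scal.
  2: { intros t. apply continuous_Cmult; [|now apply HK].
       eapply continuous_cauchy_coef; eauto. }
  rewrite <- CRInt_plus.
  - apply CRInt_ext. intros t. rewrite (kernel_expansion z0 z r t) at 1 by lra.
    assert (N := circle_neq_0 r t (proj1 Hr)). rewrite Cpow_S.
    set (w := (RtoC r * expi t)%C) in *. pose proof (Cpow_nz w n N). field. auto.
  - intros t. eapply continuous_cauchy_coef; eauto.
  - intros t. apply continuous_Cmult; [apply continuous_const|].
    apply continuous_Cmult; [|now apply HK]. eapply continuous_cauchy_coef; eauto.
Qed.

Lemma circle_bound (F F' : C -> C) (z0 : C) (r r0 : R) :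
  0 < r < r0 -> C1_holomorphic F F' z0 r0 ->
  exists M, 0 < M /\ forall t, 0 <= t <= 2 * PI -> Cmod (F (z0 + RtoC r * expi t)%C) <= M.
Proof.
  intros Hr HF.
  destruct (continuous_ab_maj_consistent (fun t => Cmod (F (z0 + RtoC r * expi t)%C)) 0 (2 * PI))
    as [x [Hx _]].
  - pose proof PI_RGT_0. lra.
  - intros t _. apply (continuous_Cmod_comp (fun t => F (z0 + RtoC r * expi t))%C).
    apply (continuous_circle F F' z0 r r0); auto. lra.
  - exists (Cmod (F (z0 + RtoC r * expi x)%C) + 1). split.
    + pose proof (Cmod_ge_0 (F (z0 + RtoC r * expi x)%C)). lra.
    + intros t Ht. specialize (Hx t Ht). cbv beta in Hx. lra.
Qed.

Lemma cauchy_term_bound (F F' : C -> C) (z0 : C) (r r0 : R) :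
  0 < r < r0 -> C1_holomorphic F F' z0 r0 ->
  exists M, 0 < M /\ forall n z, Cmod (z - z0) < r ->
    Cmod (cauchy_term F z0 r n z) <= M * (/ r) ^ n * (r / (r - Cmod (z - z0))).
Proof.
  intros Hr HF. destruct (circle_bound F F' z0 r r0 Hr HF) as [M [HM HB]].
  pose proof PI_RGT_0 as HPI.
  exists (4 * PI * M). split; [nra|]. intros n z Hz.
  replace (4 * PI * M * (/ r) ^ n * (r / (r - Cmod (z - z0))))
    with (2 * ((2 * PI - 0) * (M * (/ r) ^ n * (r / (r - Cmod (z - z0)))))) by ring.
  apply Cmod_CRInt_le; [lra| |].
  - intros t. apply continuous_Cmult; [|now apply continuous_kernel].
    eapply continuous_cauchy_coef; eauto.
  - intros t Ht. rewrite !Cmod_mult.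
    assert (P : 0 <= (/ r) ^ n) by (apply pow_le, Rlt_le, Rinv_0_lt_compat; lra).
    assert (E : Cmod (/ (RtoC r * expi t) ^ n) = (/ r) ^ n).
    { rewrite Cmod_inv, Cmod_pow, Cmod_circle by (try apply Cpow_nz, circle_neq_0; lra).
      now rewrite pow_inv. }
    rewrite E.
    apply Rmult_le_compat; try apply Cmod_ge_0.
    + apply Rmult_le_pos; auto. apply Cmod_ge_0.
    + apply Rmult_le_compat_r; auto.
    + apply Cmod_kernel_le; lra.
Qed.

(** If the first [n] coefficients vanish, then at a zero w the next one equals -(w - z0) times a
    bounded remainder; letting w tend to [z0] kills it too. So F z times the kernel integral is (z -
    z0)^n [cauchy_term n] for every [n], a quantity of order (|z - z0| / r)^n, hence zero. *)
Lemma identity_theorem (F F' : C -> C) (z0 : C) (r r0 : R) :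
  0 < r < r0 -> C1_holomorphic F F' z0 r0 ->
  (forall eps, 0 < eps -> exists w, w <> z0 /\ Cmod (w - z0) < eps /\ F w = 0) ->
  forall z, Cmod (z - z0) < r -> F z = 0.
Proof.
  intros Hr HF HZ.
  destruct (cauchy_term_bound F F' z0 r r0 Hr HF) as [M [HM HB]].
  assert (Claim : forall n z, Cmod (z - z0) < r ->
    (F z * CRInt (kernel z0 r z) 0 (2 * PI))%C = ((z - z0) ^ n * cauchy_term F z0 r n z)%C).
  { induction n as [|n IH].
    - intros z Hz. rewrite <- (Cauchy_formula F F' z0 z r r0) by (auto; lra).
      change ((z - z0) ^ 0)%C with (RtoC 1). rewrite Cmult_1_l. apply CRInt_ext. intros t.
      change ((RtoC r * expi t) ^ 0)%C with (RtoC 1). field.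
    - assert (A : cauchy_coef F z0 r n = 0).
      { destruct (Ceq_dec (cauchy_coef F z0 r n) 0) as [|N]; auto. exfalso.
        apply Cmod_gt_0 in N. set (a := Cmod (cauchy_coef F z0 r n)) in *.
        assert (Pn : 0 < (/ r) ^ S n) by (apply pow_lt, Rinv_0_lt_compat; lra).
        assert (HK : 0 < M * (/ r) ^ S n * 2) by (apply Rmult_lt_0_compat; [apply Rmult_lt_0_compat|]; lra).
        (* For |w - z0| < r / 2 the factor r / (r - |w - z0|) in the bound of the remainder is at
           most 2; the second radius then makes |w - z0| times the remainder smaller than [a], a
           contradiction. *)
        destruct (HZ (Rmin (r / 2) (a / (M * (/ r) ^ S n * 2)))) as [w [Hw0 [Hw Fw]]].
        { apply Rmin_pos; [lra|]. now apply Rdiv_lt_0_compat. }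
        assert (Hw1 := Rlt_le_trans _ _ _ Hw (Rmin_l _ _)).
        assert (Hw2 := Rlt_le_trans _ _ _ Hw (Rmin_r _ _)).
        assert (Hwr : Cmod (w - z0) < r) by lra.
        specialize (IH w Hwr). rewrite Fw, Cmult_0_l in IH.
        assert (Hd : (w - z0)%C <> 0).
        { intros E. apply Hw0. replace w with (w - z0 + z0)%C by ring. rewrite E. ring. }
        assert (T0 : cauchy_term F z0 r n w = 0).
        { destruct (Ceq_dec (cauchy_term F z0 r n w) 0) as [|N']; auto. exfalso.
          apply (Cmult_neq_0 _ _ (Cpow_nz _ n Hd) N'). auto. }
        rewrite (cauchy_term_step F F' z0 w r r0) in T0 by auto.
        assert (E : a = Cmod (w - z0) * Cmod (cauchy_term F z0 r (S n) w)).
        { unfold a. rewrite <- Cmod_mult, <- (Cmod_opp ((w - z0) * _)).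
          f_equal. 
          replace (cauchy_coef F z0 r n)
            with (cauchy_coef F z0 r n + (w - z0) * cauchy_term F z0 r (S n) w
                  - (w - z0) * cauchy_term F z0 r (S n) w)%C by ring.
          rewrite T0. ring. }
        assert (B : Cmod (cauchy_term F z0 r (S n) w) <= M * (/ r) ^ S n * 2).
        { eapply Rle_trans; [now apply HB|]. apply Rmult_le_compat_l; [lra|].
          apply Rle_div_l; lra. }
        apply Rlt_div_r in Hw2; auto.
        pose proof (Cmod_ge_0 (w - z0)). nra. }
      intros z Hz. rewrite (IH z Hz), (cauchy_term_step F F' z0 z r r0), A by auto.
      rewrite Cpow_S. ring. }
  intros z Hz. pose proof (CRInt_kernel_neq_0 z0 z r Hz) as HK.
  destruct (Ceq_dec (F z) 0) as [|N]; auto. exfalso.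
  assert (P := Cmult_neq_0 _ _ N HK). apply Cmod_gt_0 in P.
  set (q := (F z * CRInt (kernel z0 r z) 0 (2 * PI))%C) in *.
  set (c := M * (r / (r - Cmod (z - z0)))).
  assert (Hc : 0 < c) by (apply Rmult_lt_0_compat; [|apply Rdiv_lt_0_compat]; lra).
  assert (Q : forall n, Cmod q <= (Cmod (z - z0) / r) ^ n * c).
  { intros n. unfold q. rewrite (Claim n z Hz), Cmod_mult, Cmod_pow.
    unfold Rdiv. rewrite Rpow_mult_distr.
    eapply Rle_trans; [apply Rmult_le_compat_l; [apply pow_le, Cmod_ge_0|now apply HB]|].
    right. unfold c. ring. }
  assert (L1 : Rabs (Cmod (z - z0) / r) < 1).
  { rewrite Rabs_right.
    - apply Rlt_div_l; lra.
    - apply Rle_ge, Rmult_le_pos; [apply Cmod_ge_0|]. left. apply Rinv_0_lt_compat. lra. }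
  destruct (pow_lt_1_zero _ L1 (Cmod q / c)) as [n Hn]; [now apply Rdiv_lt_0_compat|].
  specialize (Hn n (Nat.le_refl n)). specialize (Q n).
  assert (Hn' := Rle_lt_trans _ _ _ (Rle_abs _) Hn).
  apply Rlt_div_r in Hn'; auto. lra.
Qed.

(** * Primitives on a disc by integration along radii *)

Definition radial_primitive (F : C -> C) (z0 z : C) : C :=
  CRInt (fun s => (z - z0) * F (z0 + RtoC s * (z - z0)))%C 0 1.

(** Leaves room around the segment from [z0] to [z], both in the endpoint and in the parameter, as
    differentiation under the integral sign demands. *)
Lemma radial_in_disc (z0 z : C) (r : R) : 0 < r -> Cmod (z - z0) < r ->
  exists d, 0 < d /\ forall s w, - d < s < 1 + d -> Cmod (w - z) < d -> Cmod (RtoC s * (w - z0)) < r.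
Proof.
  intros Hr Hz. set (q := Cmod (z - z0)) in *. assert (Hq : 0 <= q) by apply Cmod_ge_0.
  (* With d <= 1, (1 + d) (q + d) <= q + d (q + 2) <= q + (r - q) / 2 < r. *)
  pose (d := Rmin 1 ((r - q) / (2 * (q + 2)))).
  assert (P : 0 < (r - q) / (2 * (q + 2))) by (apply Rdiv_lt_0_compat; lra).
  assert (D1 : d <= 1) by apply Rmin_l.
  assert (D2 : d * (2 * (q + 2)) <= r - q).
  { apply Rle_div_r; [lra|]. apply Rmin_r. }
  assert (D0 : 0 < d) by (apply Rmin_pos; lra).
  exists d. split; auto. intros x w Hx Hw. rewrite Cmod_mult, Cmod_R.
  assert (W : Cmod (w - z0) <= q + d).
  { replace (w - z0)%C with ((w - z) + (z - z0))%C by ring.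
    eapply Rle_trans; [apply Cmod_triangle|]. fold q. lra. }
  assert (X : Rabs x <= 1 + d) by (apply Rabs_le; lra).
  pose proof (Rabs_pos x). pose proof (Cmod_ge_0 (w - z0)).
  apply Rle_lt_trans with ((1 + d) * (q + d)); [apply Rmult_le_compat; auto|]. nra.
Qed.

(* The [l]-derivative of the integrand is the [s]-derivative of
   [s * (w - z) * F (z0 + s * (z + l * (w - z) - z0))]. *)
Lemma radial_primitive_derive_Re (F F' : C -> C) (z0 z w : C) (r l : R) :
  0 < r -> C1_holomorphic F F' z0 r -> Cmod (z + RtoC l * (w - z) - z0) < r ->
  is_derive (fun l : R => Re (radial_primitive F z0 (z + RtoC l * (w - z)))) l
    (Re ((w - z) * F (z + RtoC l * (w - z)))%C).
Proof.
  intros Hr HF Hl. 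
  destruct (radial_in_disc z0 _ r Hr Hl) as [d [Hd D]].
  pose (p := fun l : R => (z + RtoC l * (w - z))%C). fold (p l) in D.
  (* The point [p l] moves with speed |w - z|; adding 1 to it covers the case w = z. *)
  pose (d' := Rmin d (d / (Cmod (w - z) + 1))).
  assert (Hm := Cmod_ge_0 (w - z)).
  assert (Hd' : 0 < d') by (apply Rmin_pos; auto; apply Rdiv_lt_0_compat; lra).
  assert (Dl : forall x s, Rabs (x - l) < d' -> 0 - d' < s < 1 + d' ->
    Cmod (z0 + RtoC s * (p x - z0) - z0) < r).
  { intros x s Hx Hs. replace (z0 + RtoC s * (p x - z0) - z0)%C with (RtoC s * (p x - z0))%C by ring.
    assert (d' <= d) by apply Rmin_l. apply D; [lra|].
    replace (p x - p l)%C with (RtoC (x - l) * (w - z))%C by (unfold p; rewrite RtoC_minus; ring).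
    rewrite Cmod_mult, Cmod_R.
    apply Rle_lt_trans with (Rabs (x - l) * (Cmod (w - z) + 1)); [apply Rmult_le_compat_l; [apply Rabs_pos|lra]|].
    apply Rlt_div_r; [lra|]. eapply Rlt_le_trans; [exact Hx|apply Rmin_r]. }
  pose (V := fun x s => Re ((w - z) * F (z0 + RtoC s * (p x - z0)) +
    (p x - z0) * (F' (z0 + RtoC s * (p x - z0)) * (RtoC s * (w - z))))%C).
  assert (l0 : Rabs (l - l) < d') by (rewrite Rminus_diag, Rabs_R0; auto).
  assert (Cp : forall s, continuous (fun s => z0 + RtoC s * (p l - z0))%C s).
  { intros s. apply continuous_Cplus; [apply continuous_const|].
    apply continuous_Cmult; [|apply continuous_const]. apply (continuous_RtoC (fun s => s)), continuous_id. }
  assert (Cq : forall s, continuous (fun q : R * R => p (fst q)) (l, s)).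
  { intros s. apply continuous_Cplus; [apply continuous_const|].
    apply continuous_Cmult; [|apply continuous_const]. apply (continuous_RtoC fst), continuous_fst. }
  assert (Cs : forall s, continuous (fun q : R * R => RtoC (snd q)) (l, s)).
  { intros s. apply (continuous_RtoC snd), continuous_snd. }
  assert (Czq : forall s, continuous (fun q : R * R => z0 + RtoC (snd q) * (p (fst q) - z0))%C (l, s)).
  { intros s. apply continuous_Cplus; [apply continuous_const|].
    apply continuous_Cmult; [apply Cs|]. apply continuous_Cminus; [apply Cq|apply continuous_const]. }
  assert (A : is_derive (fun x => RInt (fun s => Re ((p x - z0) * F (z0 + RtoC s * (p x - z0)))%C) 0 1) l (RInt (V l) 0 1)).
  { apply (is_derive_RInt_param_continuous
      (fun x s => Re ((p x - z0) * F (z0 + RtoC s * (p x - z0)))%C) V _ _ l d'); auto; [lra| |].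
    - intros x s Hx Hs.
      assert (Dp : is_derive (fun x => p x - z0)%C x (w - z)%C).
      { apply (is_derive_ext (fun x : R => (z - z0) + RtoC x * (w - z))%C).
        - intros y. unfold p. cring.
        - apply is_derive_segment. }
      assert (Ds : is_derive (fun x => z0 + RtoC s * (p x - z0))%C x (RtoC s * (w - z))%C).
      { apply (is_derive_ext (fun x : R => (z0 + RtoC s * (z - z0)) + RtoC x * (RtoC s * (w - z)))%C).
        - intros y. unfold p. cring.
        - apply is_derive_segment. }
      split.
      + assert (DD := is_derive_C_mult (fun x => p x - z0)%C (fun x => F (z0 + RtoC s * (p x - z0))%C) x
          (w - z)%C (F' (z0 + RtoC s * (p x - z0)) * (RtoC s * (w - z)))%C Dp).
        apply is_derive_Cpair in DD; [exact (proj1 DD)|].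
        apply is_derive_C_comp; auto. now apply HF, Dl.
      + apply (continuous_Re (fun s => (p x - z0) * F (z0 + RtoC s * (p x - z0)))%C).
        apply continuous_Cmult; [apply continuous_const|].
        apply (continuous_comp (fun s => z0 + RtoC s * (p x - z0))%C F).
        * apply continuous_Cplus; [apply continuous_const|].
          apply continuous_Cmult; [|apply continuous_const]. apply (continuous_RtoC (fun s => s)), continuous_id.
        * eapply C1_holomorphic_continuous; [exact HF|]. now apply Dl.
    - intros s Hs. unfold V.
      apply (continuous_Re (fun q : R * R => (w - z) * F (z0 + RtoC (snd q) * (p (fst q) - z0)) +
    (p (fst q) - z0) * (F' (z0 + RtoC (snd q) * (p (fst q) - z0)) * (RtoC (snd q) * (w - z))))%C).
      assert (Hs' : Cmod (z0 + RtoC s * (p l - z0) - z0) < r) by (apply Dl; auto; lra).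
      apply continuous_Cplus; apply continuous_Cmult; try apply continuous_const.
      + apply (continuous_comp (fun q : R * R => z0 + RtoC (snd q) * (p (fst q) - z0))%C F); auto.
        eapply C1_holomorphic_continuous; [exact HF|auto].
      + apply continuous_Cminus; [apply Cq|apply continuous_const].
      + apply continuous_Cmult.
        * apply (continuous_comp (fun q : R * R => z0 + RtoC (snd q) * (p (fst q) - z0))%C F'); auto.
          now apply HF.
        * apply continuous_Cmult; [apply Cs|apply continuous_const]. }
  assert (E : RInt (V l) 0 1 = Re ((w - z) * F (p l))%C).
  { apply is_RInt_unique.
    assert (E0 : minus (Re (RtoC 1 * ((w - z) * F (z0 + RtoC 1 * (p l - z0))))%C)
      (Re (RtoC 0 * ((w - z) * F (z0 + RtoC 0 * (p l - z0))))%C) = Re ((w - z) * F (p l))%C).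
    { replace (z0 + RtoC 1 * (p l - z0))%C with (p l) by ring.
      rewrite Cmult_1_l, Cmult_0_l. unfold minus, plus, opp; simpl. ring. }
    rewrite <- E0.
    apply (is_RInt_derive (fun s : R => Re (RtoC s * ((w - z) * F (z0 + RtoC s * (p l - z0))))%C) (V l)).
    - intros s. rewrite Rmin_left, Rmax_right by lra. intros Hs.
      assert (Hs' : Cmod (z0 + RtoC s * (p l - z0) - z0) < r) by (apply Dl; auto; lra).
      assert (D1 : is_derive (fun s : R => RtoC s) s (RtoC 1)).
      { apply (is_derive_ext (fun s : R => 0 + RtoC s * 1)%C); [intros; cring|]. apply is_derive_segment. }
      assert (D2 : is_derive (fun s => F (z0 + RtoC s * (p l - z0)))%C s
         (F' (z0 + RtoC s * (p l - z0)) * (p l - z0))%C).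
      { apply is_derive_C_comp; [now apply HF|apply is_derive_segment]. }
      assert (D3 := is_derive_C_mult (fun s : R => RtoC s * (w - z))%C
         (fun s => F (z0 + RtoC s * (p l - z0)))%C s (w - z)%C
         (F' (z0 + RtoC s * (p l - z0)) * (p l - z0))%C).
      assert (D4 : is_derive (fun s : R => RtoC s * (w - z))%C s (w - z)%C).
      { apply (is_derive_ext (fun s : R => 0 + RtoC s * (w - z))%C); [intros; cring|]. apply is_derive_segment. }
      specialize (D3 D4 D2). apply is_derive_Cpair in D3.
      replace (V l s) with (Re ((w - z) * F (z0 + RtoC s * (p l - z0)) +
          RtoC s * (w - z) * (F' (z0 + RtoC s * (p l - z0)) * (p l - z0)))%C).
      + apply (is_derive_ext (fun s : R => Re (RtoC s * (w - z) * F (z0 + RtoC s * (p l - z0)))%C)).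
        * intros x. f_equal. ring.
        * exact (proj1 D3).
      + unfold V. f_equal. ring.
    - intros s. rewrite Rmin_left, Rmax_right by lra. intros Hs. unfold V.
      assert (Hs' : Cmod (z0 + RtoC s * (p l - z0) - z0) < r) by (apply Dl; auto; lra).
      apply (continuous_Re (fun s => (w - z) * F (z0 + RtoC s * (p l - z0)) +
        (p l - z0) * (F' (z0 + RtoC s * (p l - z0)) * (RtoC s * (w - z))))%C).
      apply continuous_Cplus; apply continuous_Cmult; try apply continuous_const.
      + apply (continuous_comp (fun s => z0 + RtoC s * (p l - z0))%C F); auto.
        eapply C1_holomorphic_continuous; [exact HF|auto].
      + apply continuous_Cmult.
        * apply (continuous_comp (fun s => z0 + RtoC s * (p l - z0))%C F'); auto. now apply HF.
        * apply continuous_Cmult; [|apply continuous_const]. apply (continuous_RtoC (fun s => s)), continuous_id. }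
  unfold p in *. rewrite E in A. exact A.
Qed.

Lemma radial_primitive_derive (F F' : C -> C) (z0 z w : C) (r l : R) :
  0 < r -> C1_holomorphic F F' z0 r -> Cmod (z + RtoC l * (w - z) - z0) < r ->
  is_derive (fun l : R => radial_primitive F z0 (z + RtoC l * (w - z))%C) l
    ((w - z) * F (z + RtoC l * (w - z)))%C.
Proof.
  intros Hr HF Hl. apply is_derive_Cpair. split.
  - now apply (radial_primitive_derive_Re F F' z0 z w r l).
  - assert (H := radial_primitive_derive_Re _ _ z0 z w r l Hr (C1_holomorphic_scal (- Ci) _ _ _ _ HF) Hl).
    assert (I : forall v u : C, Re (v * (- Ci * u))%C = Im (v * u)%C).
    { intros v u. unfold Re, Im; simpl; ring. }
    cbv beta in H. rewrite I in H. apply is_derive_ext with (2 := H).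
    intros x. unfold radial_primitive, CRInt. simpl fst. apply RInt_ext. intros s _. cbv beta. apply I.
Qed.

(** The derivative along the segment from [z] to [w] is (w - z) F. Subtracting the linear term l
    F(z) (w - z) leaves a curve whose speed is at most eps / 2 |w - z| by continuity of [F], and the
    mean value inequality turns this into complex differentiability. *)
Lemma radial_primitive_correct (F F' : C -> C) (z0 z : C) (r : R) :
  0 < r -> C1_holomorphic F F' z0 r -> Cmod (z - z0) < r ->
  is_Cderive (radial_primitive F z0) z (F z).
Proof.
  intros Hr HF Hz. apply is_Cderive_eps. intros eps He.
  assert (CF := C1_holomorphic_continuous _ _ _ _ _ HF Hz).
  destruct (continuous_Cmod (U := C_UniformSpace) F z) as [A _].
  specialize (A CF (eps / 2) ltac:(lra)). apply locally_Cmod in A. destruct A as [d [Hd A]].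
  exists (Rmin d (r - Cmod (z - z0))). split; [apply Rmin_pos; lra|].
  intros w Hw. assert (Hw1 := Rlt_le_trans _ _ _ Hw (Rmin_l _ _)).
  assert (Hw2 := Rlt_le_trans _ _ _ Hw (Rmin_r _ _)).
  assert (S : forall l, 0 <= l <= 1 -> Cmod (z + RtoC l * (w - z) - z) <= Cmod (w - z)).
  { intros l Hl. replace (z + RtoC l * (w - z) - z)%C with (RtoC l * (w - z))%C by ring.
    rewrite Cmod_mult, Cmod_R, Rabs_right by lra. pose proof (Cmod_ge_0 (w - z)). nra. }
  assert (B := C_mean_value (fun l => radial_primitive F z0 (z + RtoC l * (w - z)) + RtoC l * (- (F z * (w - z))))%C
    (fun l => (w - z) * F (z + RtoC l * (w - z)) + - (F z * (w - z)))%C (eps / 2 * Cmod (w - z))).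
  cbv beta in B.
  replace (radial_primitive F z0 w - radial_primitive F z0 z - F z * (w - z))%C with
    (radial_primitive F z0 (z + 1 * (w - z)) + 1 * (- (F z * (w - z))) -
      (radial_primitive F z0 (z + 0 * (w - z)) + 0 * - (F z * (w - z))))%C.
  2: { replace (z + 1 * (w - z))%C with w by ring. replace (z + 0 * (w - z))%C with z by ring. ring. }
  eapply Rle_trans; [apply B|right; field].
  - intros l Hl.
    apply (is_derive_plus (fun l : R => radial_primitive F z0 (z + RtoC l * (w - z))%C : prod_NormedModule _ _ _) (fun l : R => (RtoC l * (- (F z * (w - z))))%C : prod_NormedModule _ _ _)).
    + apply (radial_primitive_derive F F' z0 z w r l); auto.
      replace (z + RtoC l * (w - z) - z0)%C with ((z + RtoC l * (w - z) - z) + (z - z0))%C by ring.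
      eapply Rle_lt_trans; [apply Cmod_triangle|]. specialize (S l Hl). lra.
    + apply (is_derive_ext (fun l : R => 0 + RtoC l * (- (F z * (w - z))))%C); [intros; cring|]. apply is_derive_segment.
  - intros l Hl.
    replace ((w - z) * F (z + RtoC l * (w - z)) + - (F z * (w - z)))%C with
     ((F (z + RtoC l * (w - z)) - F z) * (w - z))%C by ring.
    rewrite Cmod_mult. apply Rmult_le_compat_r; [apply Cmod_ge_0|].
    left. apply A. specialize (S l Hl). lra.
Qed.

(** * Complex gradients of harmonic maps *)

(** Real differentiability, with differential [d |-> Re (p * d)]. *)
Definition is_grad (f : C -> R) (z p : C) : Prop :=
  exists Q : C -> C, continuous Q z /\ Q z = p /\
    forall w, f w = f z + Re (Q w * (w - z))%C.

Lemma Cminus_neq_0 (z w : C) : z <> w -> (z - w)%C <> 0.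
Proof. intros N E. apply N. replace z with (z - w + w)%C by ring. rewrite E. ring. Qed.

Lemma is_grad_of_differentiable (f : C -> R) (z p : C) :
  differentiable_pt_lim (fun u v => f (u, v)) (Re z) (Im z) (Re p) (- Im p) -> is_grad f z p.
Proof.
  intros H.
  pose (q := fun w => RtoC (f w - f z - Re (p * (w - z))%C)).
  exists (fun w => if Ceq_dec w z then p else (p + q w / (w - z))%C).
  assert (Hz : (if Ceq_dec z z then p else (p + q z / (z - z))%C) = p)
    by (destruct (Ceq_dec z z); congruence).
  split; [|split; auto].
  - apply continuous_Cmod. intros eps He. rewrite Hz.
    assert (He2 : 0 < eps / 2) by lra.
    destruct (H (mkposreal _ He2)) as [d Hd]. apply locally_Cmod.
    exists d. split; [apply cond_pos|]. intros w Hw.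
    destruct (Ceq_dec w z) as [->|N].
    { replace (p - p)%C with (RtoC 0) by ring. now rewrite Cmod_0. }
    apply Cminus_neq_0 in N.
    replace (p + q w / (w - z) - p)%C with (q w / (w - z))%C by (field; auto).
    rewrite Cmod_div by auto. apply Cmod_gt_0 in N. apply Rlt_div_l; auto.
    unfold q. rewrite Cmod_R.
    assert (A : Rabs (Re w - Re z) < d) by (eapply Rle_lt_trans; [apply (re_le_Cmod (w - z))|exact Hw]).
    assert (B : Rabs (Im w - Im z) < d) by (eapply Rle_lt_trans; [apply (im_le_Cmod (w - z))|exact Hw]).
    specialize (Hd (Re w) (Im w) A B). 
    replace (Re w, Im w) with w in Hd by (destruct w; reflexivity).
    replace (Re z, Im z) with z in Hd by (destruct z; reflexivity).
    replace (Re (p * (w - z))%C) with (Re p * (Re w - Re z) + - Im p * (Im w - Im z))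
      by (unfold Re, Im; simpl; ring).
    eapply Rle_lt_trans; [exact Hd|]. simpl pos.
    assert (M : Rmax (Rabs (Re w - Re z)) (Rabs (Im w - Im z)) <= Cmod (w - z)) by apply (Rmax_Cmod (w - z)%C).
    nra.
  - intros w. destruct (Ceq_dec w z) as [->|N].
    { replace (p * (z - z))%C with (RtoC 0) by ring. simpl. ring. }
    replace ((p + q w / (w - z)) * (w - z))%C with (p * (w - z) + q w)%C
      by (field; now apply Cminus_neq_0).
    unfold q. simpl. ring.
Qed.

(** The two hypotheses are the Cauchy-Riemann equations, since Im (l d) = Re (- i l d). *)
Lemma is_Cderive_of_grad (F : C -> C) (z l : C) :
  is_grad (fun w => Re (F w)) z l -> is_grad (fun w => Im (F w)) z (- Ci * l) ->
  is_Cderive F z l.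
Proof.
  intros [Q1 [C1 [E1 H1]]] [Q2 [C2 [E2 H2]]]. apply is_Cderive_eps. intros eps He.
  destruct (continuous_Cmod Q1 z) as [A1 _]. specialize (A1 C1 (eps / 2) ltac:(lra)).
  destruct (continuous_Cmod Q2 z) as [A2 _]. specialize (A2 C2 (eps / 2) ltac:(lra)).
  assert (A := filter_and _ _ A1 A2). apply locally_Cmod in A. destruct A as [d [Hd A]].
  exists d; split; auto. intros w Hw. destruct (A w Hw) as [B1 B2]. rewrite E1 in B1. rewrite E2 in B2.
  pose proof (Cmod_ge_0 (w - z)).
  eapply Rle_trans; [apply Cmod_le_Re_Im|].
  replace (Re (F w - F z - l * (w - z))%C) with (Re ((Q1 w - l) * (w - z)))%C.
  2: { assert (T := H1 w). unfold Re, Im in *; simpl in *. lra. }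
  replace (Im (F w - F z - l * (w - z))%C) with (Re ((Q2 w - - Ci * l) * (w - z)))%C.
  2: { assert (T := H2 w). unfold Re, Im in *; simpl in *. lra. }
  assert (R1 : Rabs (Re ((Q1 w - l) * (w - z))%C) <= eps / 2 * Cmod (w - z)).
  { eapply Rle_trans; [apply re_le_Cmod|]. rewrite Cmod_mult. apply Rmult_le_compat_r; lra. }
  assert (R2 : Rabs (Re ((Q2 w - - Ci * l) * (w - z))%C) <= eps / 2 * Cmod (w - z)).
  { eapply Rle_trans; [apply re_le_Cmod|]. rewrite Cmod_mult. apply Rmult_le_compat_r; lra. }
  lra.
Qed.

Lemma is_grad_Re (F : C -> C) (z l : C) : is_Cderive F z l -> is_grad (fun w => Re (F w)) z l.
Proof.
  intros H. apply is_Cderive_slope in H. destruct H as [Q [CQ [E H]]].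
  exists Q. split; auto. split; auto. intros w. rewrite (H w). reflexivity.
Qed.

Lemma is_grad_comp (f : C -> R) (g : C -> C) (z p l : C) :
  is_grad f (g z) p -> is_Cderive g z l -> is_grad (fun w => f (g w)) z (p * l).
Proof.
  intros [Q [CQ [E H]]] Hg. pose proof (is_Cderive_continuous _ _ _ Hg) as Cg.
  apply is_Cderive_slope in Hg. destruct Hg as [P [CP [EP K]]].
  exists (fun w => Q (g w) * P w)%C. split; [|split].
  - apply continuous_Cmult; auto. apply (continuous_comp g Q); auto.
  - now rewrite E, EP.
  - intros w. rewrite (H (g w)). do 2 f_equal. rewrite (K w). ring.
Qed.

Lemma is_grad_derive (f : C -> R) (p : R -> C) (t : R) (q k : C) :
  is_grad f (p t) q -> is_derive p t k -> is_derive (fun s => f (p s)) t (Re (q * k)%C).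
Proof.
  intros [Q [CQ [E H]]] Hp. pose proof (is_derive_C_continuous _ _ _ Hp) as Cp.
  apply is_derive_C_slope in Hp. destruct Hp as [P [CP [EP K]]].
  apply is_derive_R_slope. exists (fun s => Re (Q (p s) * P s)%C). split; [|split].
  - apply (continuous_Re (fun s => Q (p s) * P s)%C). apply continuous_Cmult; auto.
    apply (continuous_comp p Q); auto.
  - now rewrite E, EP.
  - intros s. rewrite (H (p s)). replace (p s - p t)%C with (P s * RtoC (s - t))%C by (rewrite (K s); ring).
    unfold Re. simpl. ring.
Qed.

Lemma is_grad_minus (f g : C -> R) (z p q : C) :
  is_grad f z p -> is_grad g z q -> is_grad (fun w => f w - g w) z (p - q).
Proof.
  intros [Q [CQ [E H]]] [P [CP [EP K]]]. exists (fun w => Q w - P w)%C. split; [|split].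
  - now apply continuous_Cminus.
  - now rewrite E, EP.
  - intros w. rewrite (H w), (K w). unfold Re; simpl; ring.
Qed.

Lemma is_grad_0_constant (f : C -> R) (z0 : C) (r : R) :
  (forall w, Cmod (w - z0) < r -> is_grad f w 0) ->
  forall z w, Cmod (z - z0) < r -> Cmod (w - z0) < r -> f w = f z.
Proof.
  intros H z w Hz Hw.
  assert (A := real_mean_value (fun s => f (z + RtoC s * (w - z))%C) (fun _ => 0) 0).
  cbv beta in A.
  replace (z + 1 * (w - z))%C with w in A by ring. replace (z + 0 * (w - z))%C with z in A by ring.
  assert (B : Rabs (f w - f z) <= 0).
  { apply A.
    - intros s Hs. replace 0 with (Re (RtoC 0 * (w - z))%C) by (unfold Re; simpl; ring).
      apply (is_grad_derive f (fun s => z + RtoC s * (w - z))%C); [|apply is_derive_segment].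
      apply H. now apply ball_convex.
    - intros s Hs. rewrite Rabs_R0. lra. }
  assert (f w - f z = 0); [|lra].
  apply Rabs_eq_0. pose proof (Rabs_pos (f w - f z)). lra.
Qed.

Definition C1_holomorphic_on (D : C -> Prop) (F : C -> C) : Prop :=
  exists F' : C -> C, forall z, D z ->
    is_Cderive F z (F' z) /\ @continuous C_UniformSpace C_UniformSpace F' z.

(** The complex gradient [P = X_u - i X_v] of a conformal harmonic map [X]. *)
Record conformal_gradient (D : C -> Prop) (X : C -> R3) (P1 P2 P3 : C -> C) : Prop := {
  cg_open : open D;
  cg_1 : forall z, D z -> is_grad (fun w => x1 (X w)) z (P1 z);
  cg_2 : forall z, D z -> is_grad (fun w => x2 (X w)) z (P2 z);
  cg_3 : forall z, D z -> is_grad (fun w => x3 (X w)) z (P3 z);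
  cg_hol1 : C1_holomorphic_on D P1;
  cg_hol2 : C1_holomorphic_on D P2;
  cg_hol3 : C1_holomorphic_on D P3;
  cg_null : forall z, D z -> (P1 z * P1 z + P2 z * P2 z + P3 z * P3 z)%C = 0
}.

Lemma is_grad_conj (f : C -> R) (z p : C) :
  is_grad f (Cconj z) p -> is_grad (fun w => f (Cconj w)) z (Cconj p).
Proof.
  intros [Q [CQ [E H]]]. exists (fun w => Cconj (Q (Cconj w))). split; [|split].
  - apply continuous_Cconj. apply (continuous_comp (fun w : C => Cconj w) Q); auto.
    apply (continuous_Cconj (fun w => w)), continuous_id.
  - now rewrite E.
  - intros w. rewrite (H (Cconj w)). f_equal.
    unfold Re; simpl. ring.
Qed.

Lemma C1_holomorphic_on_conj (D : C -> Prop) (F : C -> C) :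
  C1_holomorphic_on D F ->
  C1_holomorphic_on (fun z => D (Cconj z)) (fun z => Cconj (F (Cconj z))).
Proof.
  intros [F' H]. exists (fun z => Cconj (F' (Cconj z))). intros z Hz. destruct (H _ Hz) as [A B].
  split; [now apply is_Cderive_conj|].
  apply continuous_Cconj. apply (continuous_comp (fun w : C => Cconj w) F'); auto.
  apply (continuous_Cconj (fun w => w)), continuous_id.
Qed.

Lemma Cmod_conj_minus (z w : C) : Cmod (Cconj z - w) = Cmod (z - Cconj w).
Proof.
  rewrite <- Cmod_conj. f_equal. unfold Cminus. now rewrite Cplus_conj, Copp_conj, Cconj_conj.
Qed.

Lemma open_conj (D : C -> Prop) : open D -> open (fun z => D (Cconj z)).
Proof.
  intros H. apply open_of_balls. intros z Hz. destruct (open_Cmod D _ H Hz) as [e [He K]].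
  exists e; split; auto. intros w Hw. apply K. now rewrite Cmod_conj_minus, Cconj_conj.
Qed.

Lemma conformal_gradient_conj (D : C -> Prop) (X : C -> R3) (P1 P2 P3 : C -> C) :
  conformal_gradient D X P1 P2 P3 ->
  conformal_gradient (fun z => D (Cconj z)) (fun z => X (Cconj z))
    (fun z => Cconj (P1 (Cconj z))) (fun z => Cconj (P2 (Cconj z))) (fun z => Cconj (P3 (Cconj z))).
Proof.
  intros [H0 H1 H2 H3 K1 K2 K3 N]. split; try now apply C1_holomorphic_on_conj.
  - now apply open_conj.
  - intros z Hz. apply (is_grad_conj (fun w => x1 (X w))). auto.
  - intros z Hz. apply (is_grad_conj (fun w => x2 (X w))). auto.
  - intros z Hz. apply (is_grad_conj (fun w => x3 (X w))). auto.
  - intros z Hz. rewrite <- !Cmult_conj, <- !Cplus_conj, (N _ Hz). apply C_ext; simpl; ring.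
Qed.

Lemma harmonic_mixed (D : C -> Prop) (f : R -> R -> R) (u v : R) :
  open D -> harmonic_on D f -> D (u, v) ->
  Derive (fun z => Derive (fun t => f z t) v) u = Derive (fun z => Derive (fun t => f t z) u) v.
Proof.
  intros HD Hf Huv. assert (L : locally_2d (fun a b => D (a, b)) u v).
  { apply locally_2d_locally. specialize (HD _ Huv). revert HD. apply filter_imp. now intros []. }
  apply Schwarz.
  - revert L. apply locally_2d_impl, locally_2d_forall. intros a b Hab.
    destruct (Hf a b Hab) as [[_ [A [B [[_ [C1 [C2 _]]] [_ [E1 [E2 _]]]]]]] _]. tauto.
  - destruct (Hf u v Huv) as [[_ [A [B [[_ [C1 [C2 [[C3 _] [C4 _]]]]] [_ [E1 [E2 [[E3 _] [E4 _]]]]]]]]] _].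
    exact E3.
  - destruct (Hf u v Huv) as [[_ [A [B [[_ [C1 [C2 [[C3 _] [C4 _]]]]] [_ [E1 [E2 [[E3 _] [E4 _]]]]]]]]] _].
    exact C4.
Qed.

Lemma differentiable_of_partials (f : R -> R -> R) (u v : R) :
  locally_2d (fun a b => ex_derive (fun x => f x b) a) u v ->
  ex_derive (fun y => f u y) v ->
  continuity_2d_pt (fun a b => Derive (fun x => f x b) a) u v ->
  differentiable_pt_lim f u v (Derive (fun x => f x v) u) (Derive (fun y => f u y) v).
Proof.
  intros H1 H2 H3. apply filterdiff_differentiable_pt_lim.
  apply (is_derive_filterdiff f u v (fun a b => Derive (fun x => f x b) a)).
  - apply locally_2d_locally in H1. revert H1. apply filter_imp. intros [a b] H.
    apply Derive_correct, H.
  - now apply Derive_correct.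
  - now apply continuity_2d_pt_filterlim in H3.
Qed.

Definition complex_gradient (f : R -> R -> R) (z : C) : C :=
  (partial_derive 1 0 f (Re z) (Im z), - partial_derive 0 1 f (Re z) (Im z)).

(** The Cauchy-Riemann equations for f_u - i f_v are the symmetry of the mixed partial derivatives
    and the vanishing of the Laplacian. *)
Lemma harmonic_complex_gradient (D : C -> Prop) (f : R -> R -> R) :
  open D -> harmonic_on D f ->
  (forall z, D z -> is_grad (fun w => f (Re w) (Im w)) z (complex_gradient f z)) /\
  C1_holomorphic_on D (complex_gradient f).
Proof.
  intros HD Hf.
  assert (L : forall z, D z -> locally_2d (fun a b => D (a, b)) (Re z) (Im z)).
  { intros z Hz. apply locally_2d_locally. specialize (HD _ Hz). destruct z as [a b].
    revert HD. apply filter_imp. now intros []. }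
  split.
  - intros z Hz. apply is_grad_of_differentiable. simpl.
    rewrite Ropp_involutive.
    destruct (Hf (Re z) (Im z)) as [[_ [A [B [[C0 _] _]]]] _]; [now destruct z|].
    apply (differentiable_of_partials f); auto.
    generalize (L z Hz). apply locally_2d_impl, locally_2d_forall. intros a b Hab.
    now destruct (Hf a b Hab) as [[_ [K _]] _].
  - exists (fun z => (partial_derive 2 0 f (Re z) (Im z), - partial_derive 1 1 f (Re z) (Im z))).
    intros z Hz. assert (Hz' : D (Re z, Im z)) by now destruct z.
    destruct (Hf (Re z) (Im z) Hz') as [[_ [A [B [[_ [C1 [C2 [[C3 _] [C4 _]]]]] [_ [E1 [E2 [[E3 _] [E4 _]]]]]]]]] LAP].
    assert (MIX := harmonic_mixed D f (Re z) (Im z) HD Hf Hz').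
    split.
    + apply is_Cderive_of_grad; apply is_grad_of_differentiable; simpl.
      * change (differentiable_pt_lim (fun u v => Derive (fun x => f x v) u) (Re z) (Im z)
          (Derive (fun x => Derive (fun x => f x (Im z)) x) (Re z))
          (- - Derive (fun x => Derive (fun y => f x y) (Im z)) (Re z))).
        rewrite Ropp_involutive, MIX.
        apply (differentiable_of_partials (fun u v => Derive (fun x => f x v) u)); auto.
        generalize (L z Hz). apply locally_2d_impl, locally_2d_forall. intros a b Hab.
        now destruct (Hf a b Hab) as [[_ [_ [_ [[_ [K _]] _]]]] _].
      * change (partial_derive 2 0 f (Re z) (Im z)) with
          (Derive (fun x => Derive (fun x => f x (Im z)) x) (Re z)) in LAP |- *.
        change (partial_derive 0 2 f (Re z) (Im z)) with
          (Derive (fun x => Derive (fun y => f (Re z) y) x) (Im z)) in LAP.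
        change (partial_derive 1 1 f (Re z) (Im z)) with
          (Derive (fun x => Derive (fun y => f x y) (Im z)) (Re z)).
        assert (N : differentiable_pt_lim (fun u v => Derive (fun y => f u y) v) (Re z) (Im z)
          (Derive (fun x => Derive (fun y => f x y) (Im z)) (Re z))
          (Derive (fun x => Derive (fun y => f (Re z) y) x) (Im z))).
        { apply (differentiable_of_partials (fun u v => Derive (fun y => f u y) v)); auto.
          generalize (L z Hz). apply locally_2d_impl, locally_2d_forall. intros a b Hab.
          now destruct (Hf a b Hab) as [[_ [_ [_ [_ [_ [K _]]]]]] _]. }
        (* The differential wanted for - f_v is the opposite of the one in [N], once f_uu is traded
           for - f_vv by harmonicity. *)
        intros eps. destruct (N eps) as [d Hd]. exists d. intros u v Hu Hv.
        specialize (Hd u v Hu Hv). rewrite <- Rabs_Ropp.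
        eapply Rle_trans; [right|exact Hd]. f_equal.
        replace (Derive (fun x => Derive (fun x => f x (Im z)) x) (Re z)) with
          (- Derive (fun x => Derive (fun y => f (Re z) y) x) (Im z)) by lra.
        change (partial_derive 0 1 f u v) with (Derive (fun y => f u y) v).
        change (partial_derive 0 1 f (Re z) (Im z)) with (Derive (fun y => f (Re z) y) (Im z)).
        ring.
    + apply continuity_2d_pt_filterlim in C3. apply continuity_2d_pt_filterlim in E3.
      destruct z as [a b].
      apply continuous_Cpair; simpl.
      * exact C3.
      * apply (continuous_opp (fun z : C => partial_derive 1 1 f (Re z) (Im z))). exact E3.
Qed.

(** * Uniqueness in terms of Weierstrass data *)

Lemma is_grad_ext (f g : C -> R) (z p : C) :
  (forall w, f w = g w) -> is_grad f z p -> is_grad g z p.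
Proof.
  intros E [Q [A [B K]]]. exists Q. split; auto. split; auto.
  intros w. rewrite <- !E. apply K.
Qed.

Lemma is_grad_lincomb (f1 f2 f3 : C -> R) (z p1 p2 p3 : C) (a b c : R) :
  is_grad f1 z p1 -> is_grad f2 z p2 -> is_grad f3 z p3 ->
  is_grad (fun w => a * f1 w + b * f2 w + c * f3 w) z
    (RtoC a * p1 + RtoC b * p2 + RtoC c * p3).
Proof.
  intros [Q1 [C1 [E1 K1]]] [Q2 [C2 [E2 K2]]] [Q3 [C3 [E3 K3]]].
  exists (fun w => RtoC a * Q1 w + RtoC b * Q2 w + RtoC c * Q3 w)%C. split; [|split].
  - apply continuous_Cplus; [apply continuous_Cplus|]; apply continuous_Cmult;
      first [assumption|apply continuous_const].
  - now rewrite E1, E2, E3.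
  - intros w. rewrite (K1 w), (K2 w), (K3 w). unfold Re; simpl; ring.
Qed.

(* A null vector [v] turns the real map [d |-> Re (om * v * d)] into a complex linear one. *)
Lemma null_projection (f1 f2 f3 : C -> R) (z om v1 v2 v3 : C) :
  (v1 * v1 + v2 * v2 + v3 * v3)%C = 0 ->
  is_grad f1 z (om * v1) -> is_grad f2 z (om * v2) -> is_grad f3 z (om * v3) ->
  is_Cderive (fun w => RtoC (f1 w) * Cconj v1 + RtoC (f2 w) * Cconj v2 + RtoC (f3 w) * Cconj v3)%C z
    (om * ((v1 * Cconj v1 + v2 * Cconj v2 + v3 * Cconj v3) / 2)).
Proof.
  intros N H1 H2 H3.
  assert (P : forall v : C, RtoC (Re v) = ((v + Cconj v) / 2)%C).
  { intros v. apply C_ext; unfold Re, Im; simpl; field. }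
  assert (Q : forall v : C, RtoC (- Im v) = (Ci * (v - Cconj v) / 2)%C).
  { intros v. apply C_ext; unfold Re, Im; simpl; field. }
  apply is_Cderive_of_grad.
  - apply (is_grad_ext (fun w => Re v1 * f1 w + Re v2 * f2 w + Re v3 * f3 w)).
    { intros w. unfold Re; simpl; ring. }
    assert (G := is_grad_lincomb f1 f2 f3 z _ _ _ (Re v1) (Re v2) (Re v3) H1 H2 H3).
    rewrite !P in G.
    replace (om * ((v1 * Cconj v1 + v2 * Cconj v2 + v3 * Cconj v3) / 2))%C with
      (om * ((v1 * Cconj v1 + v2 * Cconj v2 + v3 * Cconj v3) / 2) +
       om / 2 * (v1 * v1 + v2 * v2 + v3 * v3))%C by (rewrite N; field).
    replace (om * ((v1 * Cconj v1 + v2 * Cconj v2 + v3 * Cconj v3) / 2) +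
       om / 2 * (v1 * v1 + v2 * v2 + v3 * v3))%C with
     ((v1 + Cconj v1) / 2 * (om * v1) + (v2 + Cconj v2) / 2 * (om * v2) + (v3 + Cconj v3) / 2 * (om * v3))%C
      by field. exact G.
  - apply (is_grad_ext (fun w => - Im v1 * f1 w + - Im v2 * f2 w + - Im v3 * f3 w)).
    { intros w. unfold Im; simpl; ring. }
    assert (G := is_grad_lincomb f1 f2 f3 z _ _ _ (- Im v1) (- Im v2) (- Im v3) H1 H2 H3).
    rewrite !Q in G.
    replace (- Ci * (om * ((v1 * Cconj v1 + v2 * Cconj v2 + v3 * Cconj v3) / 2)))%C with
      (- Ci * (om * ((v1 * Cconj v1 + v2 * Cconj v2 + v3 * Cconj v3) / 2)) +
       Ci * om / 2 * (v1 * v1 + v2 * v2 + v3 * v3))%C by (rewrite N; field).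
    replace (- Ci * (om * ((v1 * Cconj v1 + v2 * Cconj v2 + v3 * Cconj v3) / 2)) +
       Ci * om / 2 * (v1 * v1 + v2 * v2 + v3 * v3))%C with
     (Ci * (v1 - Cconj v1) / 2 * (om * v1) + Ci * (v2 - Cconj v2) / 2 * (om * v2) + Ci * (v3 - Cconj v3) / 2 * (om * v3))%C
      by field. exact G.
Qed.

(** The vector ([wei1 g], [wei2 g], [g]) is the null vector of the Weierstrass representation: a
    gradient with Gauss map [g] is a complex multiple of it. *)
Definition wei1 (g : C) : C := (/ 2 * (1 - g * g))%C.
Definition wei2 (g : C) : C := (Ci / 2 * (1 + g * g))%C.

Lemma Ci2 : (Ci * Ci)%C = RtoC (-1).
Proof. apply C_ext; simpl; ring. Qed.

Lemma wei_null (g : C) : (wei1 g * wei1 g + wei2 g * wei2 g + g * g)%C = 0.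
Proof.
  unfold wei1, wei2.
  replace (/ 2 * (1 - g * g) * (/ 2 * (1 - g * g)) + Ci / 2 * (1 + g * g) * (Ci / 2 * (1 + g * g)) + g * g)%C
    with (/ 4 * (1 - g * g) * (1 - g * g) + (Ci * Ci) / 4 * (1 + g * g) * (1 + g * g) + g * g)%C by field.
  rewrite Ci2. field.
Qed.

(** Half the squared Hermitian norm of the Weierstrass vector; being nonzero, it makes the
    projection onto that vector locally invertible. The vector cannot vanish, because [wei1 0] is
    1/2. *)
Lemma wei_norm_neq_0 (g : C) :
  ((wei1 g * Cconj (wei1 g) + wei2 g * Cconj (wei2 g) + g * Cconj g) / 2)%C <> 0.
Proof.
  rewrite <- !Cmod2_conj, <- !RtoC_plus, <- RtoC_div by lra. intros E. apply RtoC_inj in E.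
  pose proof (Cmod_ge_0 (wei1 g)). pose proof (Cmod_ge_0 (wei2 g)). pose proof (Cmod_ge_0 g).
  assert (Z1 : wei1 g = 0) by (apply Cmod_eq_0; nra).
  assert (Z3 : g = 0) by (apply Cmod_eq_0; nra).
  subst g. apply (f_equal Re) in Z1. unfold wei1, Re in Z1. simpl in Z1. lra.
Qed.

(** The product of p1 - i p2 and p1 + i p2 is - p3^2, so the third component and p1 - i p2 determine
    p1 + i p2. *)
Lemma null_weierstrass (p1 p2 p3 g : C) :
  (p1 * p1 + p2 * p2 + p3 * p3)%C = 0 -> (p1 - Ci * p2)%C <> 0 -> p3 = (g * (p1 - Ci * p2))%C ->
  p1 = ((p1 - Ci * p2) * wei1 g)%C /\ p2 = ((p1 - Ci * p2) * wei2 g)%C.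
Proof.
  intros N H E. set (om := (p1 - Ci * p2)%C) in *.
  assert (A : (p1 + Ci * p2)%C = (- (g * g) * om)%C).
  { assert (M : (om * (p1 + Ci * p2))%C = (om * (- (g * g) * om))%C).
    { replace (om * (- (g * g) * om))%C with (- ((g * om) * (g * om)))%C by ring.
      rewrite <- E. replace (- (p3 * p3))%C with (p1 * p1 + p2 * p2 - (p1 * p1 + p2 * p2 + p3 * p3))%C by ring.
      rewrite N. unfold om. replace ((p1 - Ci * p2) * (p1 + Ci * p2))%C with (p1 * p1 - Ci * Ci * (p2 * p2))%C by ring.
      rewrite Ci2. ring. }
    replace (p1 + Ci * p2)%C with (om * (p1 + Ci * p2) / om)%C by (field; auto).
    rewrite M. field; auto. }
  split.
  - replace p1 with ((om + (p1 + Ci * p2)) / 2)%C at 1 by (unfold om; field).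
    rewrite A. unfold wei1. field.
  - replace p2 with (Ci * Ci * p2 * -1)%C at 1 by (rewrite Ci2; ring).
    replace (Ci * Ci * p2 * -1)%C with (Ci * -1 * ((p1 + Ci * p2) - om) / 2)%C by (unfold om; field).
    rewrite A. unfold wei2. field.
Qed.

Section Coincidence.

Variables (D' : C -> Prop) (Y : C -> R3) (P1 P2 P3 : C -> C).
Variables (D : C -> Prop) (X : C -> R3) (f : C -> C).
Variables (beta' beta dbeta : R -> C) (a b : R).

Hypothesis HY : conformal_gradient D' Y P1 P2 P3.
Hypothesis HX : conformal_gradient D X (fun z => f z * wei1 z)%C (fun z => f z * wei2 z)%C (fun z => f z * z)%C.
Hypothesis Hf : C1_holomorphic_on D f.

Let om (z : C) : C := (P1 z - Ci * P2 z)%C.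

Hypothesis Hcurve : forall t, a < t < b ->
  continuous beta' t /\ D' (beta' t) /\ D (beta t) /\ Y (beta' t) = X (beta t).
Hypothesis Hbeta : forall t, a < t < b ->
  is_derive beta t (dbeta t) /\ dbeta t <> 0 /\ f (beta t) <> 0.
Hypothesis Hgauss : forall t, a < t < b ->
  om (beta' t) <> 0 /\ P3 (beta' t) = (beta t * om (beta' t))%C.
(** [beta] is a homeomorphism onto its image. This keeps [beta'] from returning to [beta' t0], so
    that zeros really accumulate there, and it later makes the local injectivity discs
    compatible. *)
Hypothesis Hembed : forall t e, a < t < b -> 0 < e ->
  exists d, 0 < d /\ forall s, a < s < b -> Cmod (beta s - beta t) < d -> Rabs (s - t) < e.

Let h (z : C) : C := (P3 z / om z)%C.

Lemma gauss_map_on_curve (t : R) : a < t < b -> h (beta' t) = beta t.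
Proof. intros Ht. destruct (Hgauss t Ht) as [A B]. unfold h. rewrite B. field. auto. Qed.

Lemma locally_interval (t : R) : a < t < b -> locally t (fun s => a < s < b).
Proof.
  intros Ht. apply filter_and.
  - apply (open_gt a). tauto.
  - apply (open_lt b). tauto.
Qed.

(** Paired with the conjugate of the Weierstrass vector at [beta t], both surfaces become complex
    differentiable at the points in question, with nonzero derivative for [Y]. The two pairings
    agree along the curves and the one through [beta] is differentiable, so [beta'] inherits
    differentiability. *)
Lemma curve_differentiable (t : R) : a < t < b ->
  is_derive beta' t (f (beta t) * dbeta t / om (beta' t))%C.
Proof.
  intros Ht. destruct (Hcurve t Ht) as [Cb [Db' [Db _]]].
  destruct (Hbeta t Ht) as [Hd [_ _]]. destruct (Hgauss t Ht) as [Hom HP3].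
  destruct (null_weierstrass _ _ _ _ (cg_null _ _ _ _ _ HY _ Db') Hom HP3) as [E1 E2].
  set (g := beta t) in *.
  pose proof (wei_norm_neq_0 g) as HN.
  set (N := ((wei1 g * Cconj (wei1 g) + wei2 g * Cconj (wei2 g) + g * Cconj g) / 2)%C) in *.
  (* The vector is frozen at [g], so [proj] is linear over the reals; complex derivatives are
     claimed only at [beta' t] and at [g]. *)
  pose (proj := fun p : R3 => (RtoC (x1 p) * Cconj (wei1 g) + RtoC (x2 p) * Cconj (wei2 g) + RtoC (x3 p) * Cconj g)%C).
  assert (DY : is_Cderive (fun w => proj (Y w)) (beta' t) (om (beta' t) * N)).
  { apply (null_projection (fun w => x1 (Y w)) (fun w => x2 (Y w)) (fun w => x3 (Y w))).
    - apply wei_null.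
    - unfold om at 1. rewrite <- E1. now apply (cg_1 _ _ _ _ _ HY).
    - unfold om at 1. rewrite <- E2. now apply (cg_2 _ _ _ _ _ HY).
    - rewrite Cmult_comm, <- HP3. now apply (cg_3 _ _ _ _ _ HY). }
  assert (DX : is_Cderive (fun w => proj (X w)) g (f g * N)).
  { apply (null_projection (fun w => x1 (X w)) (fun w => x2 (X w)) (fun w => x3 (X w))).
    - apply wei_null.
    - now apply (cg_1 _ _ _ _ _ HX).
    - now apply (cg_2 _ _ _ _ _ HX).
    - now apply (cg_3 _ _ _ _ _ HX). }
  assert (R : is_derive beta' t (f g * N * dbeta t / (om (beta' t) * N))%C).
  { apply (is_derive_C_comp_inv (fun w => proj (Y w))); auto.
    - now apply Cmult_neq_0.
    - apply (is_derive_ext_loc (fun s => proj (X (beta s)))).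
      + generalize (locally_interval t Ht). apply filter_imp. intros s Hs.
        f_equal. symmetry. now apply Hcurve.
      + apply (is_derive_C_comp (fun w => proj (X w)) beta); auto. }
  replace (f g * dbeta t / om (beta' t))%C with (f g * N * dbeta t / (om (beta' t) * N))%C by (field; auto).
  exact R.
Qed.

Lemma C1_holomorphic_on_om : C1_holomorphic_on D' om.
Proof.
  destruct (cg_hol1 _ _ _ _ _ HY) as [P1' H1]. destruct (cg_hol2 _ _ _ _ _ HY) as [P2' H2].
  exists (fun z => P1' z - Ci * P2' z)%C. intros z Hz.
  destruct (H1 z Hz), (H2 z Hz). split.
  - apply is_Cderive_minus; auto. now apply is_Cderive_scal.
  - apply continuous_Cminus; auto. apply continuous_Cmult; auto. apply continuous_const.
Qed.

Lemma gauss_map_C1 : C1_holomorphic_on (fun z => D' z /\ om z <> 0) h.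
Proof.
  destruct C1_holomorphic_on_om as [om' H1]. destruct (cg_hol3 _ _ _ _ _ HY) as [P3' H3].
  exists (fun z => (P3' z * om z - P3 z * om' z) / (om z * om z))%C. intros z [Hz N].
  destruct (H1 z Hz) as [A1 B1], (H3 z Hz) as [A3 B3].
  pose proof (is_Cderive_continuous _ _ _ A1). pose proof (is_Cderive_continuous _ _ _ A3).
  split.
  - now apply is_Cderive_div.
  - apply continuous_Cdiv; [now apply Cmult_neq_0| |now apply continuous_Cmult].
    apply continuous_Cminus; now apply continuous_Cmult.
Qed.

Lemma is_derive_C_unique (p : R -> C) (t : R) (k l : C) :
  is_derive p t k -> is_derive p t l -> k = l.
Proof.
  intros H K. apply is_derive_Cpair in H. apply is_derive_Cpair in K.
  apply C_ext.
  - transitivity (Derive (fun s => Re (p s)) t); [symmetry|]; now apply is_derive_unique.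
  - transitivity (Derive (fun s => Im (p s)) t); [symmetry|]; now apply is_derive_unique.
Qed.

Lemma coincide_locally (t0 : R) : a < t0 < b ->
  exists r, 0 < r /\
    (forall z, Cmod (z - beta' t0) < r ->
      D' z /\ om z <> 0 /\ D (h z) /\ Y z = X (h z)) /\
    (forall z w, Cmod (z - beta' t0) < r -> Cmod (w - beta' t0) < r -> h z = h w -> z = w).
Proof.
  intros Ht0. set (z0 := beta' t0) in *.
  destruct (Hcurve t0 Ht0) as [Cb [Db' [Db HYX]]]. fold z0 in Db', HYX.
  destruct (Hgauss t0 Ht0) as [Hom _]. fold z0 in Hom.
  assert (Hz0 := gauss_map_on_curve t0 Ht0). fold z0 in Hz0.
  destruct C1_holomorphic_on_om as [om' Hom'].
  destruct gauss_map_C1 as [h' Hh']. destruct Hf as [f' Hf'].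
  destruct (open_Cmod D (beta t0) (cg_open _ _ _ _ _ HX) Db) as [r2 [Hr2 Dr2]].
  assert (LOC : exists r, 0 < r /\ forall z, Cmod (z - z0) < r ->
     D' z /\ om z <> 0 /\ Cmod (h z - beta t0) < r2).
  { destruct (open_Cmod D' z0 (cg_open _ _ _ _ _ HY) Db') as [e1 [He1 De1]].
    assert (L2 : locally (T := C_UniformSpace) z0 (fun z => om z <> 0)).
    { apply (continuous_C_neq_0 om z0); auto. eapply is_Cderive_continuous, Hom', Db'. }
    apply locally_Cmod in L2. destruct L2 as [e2 [He2 De2]].
    assert (Ch := is_Cderive_continuous _ _ _ (proj1 (Hh' z0 (conj Db' Hom)))).
    destruct (continuous_Cmod (U := C_UniformSpace) h z0) as [L3 _]. specialize (L3 Ch r2 Hr2).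
    apply locally_Cmod in L3. destruct L3 as [e3 [He3 De3]].
    exists (Rmin e1 (Rmin e2 e3)). split; [repeat apply Rmin_pos; auto|].
    intros z Hz.
    assert (A1 := Rlt_le_trans _ _ _ Hz (Rmin_l _ _)).
    assert (A2 := Rlt_le_trans _ _ _ Hz (Rle_trans _ _ _ (Rmin_r _ _) (Rmin_l _ _))).
    assert (A3 := Rlt_le_trans _ _ _ Hz (Rle_trans _ _ _ (Rmin_r _ _) (Rmin_r _ _))).
    split; [auto|]. split; [auto|]. rewrite <- Hz0. auto. }
  destruct LOC as [r [Hr LOC]].
  assert (Homr : C1_holomorphic om om' z0 r) by (intros w Hw; apply Hom', LOC, Hw).
  assert (Hfr : C1_holomorphic f f' (beta t0) r2) by (intros w Hw; apply Hf', Dr2, Hw).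
  assert (Hhr : C1_holomorphic h h' z0 r).
  { intros w Hw. apply Hh'. split; now apply LOC. }
  pose (E := fun z => (om z - f (h z) * h' z)%C).
  pose (Phi := fun z => (radial_primitive om z0 z - radial_primitive f (beta t0) (h z))%C).
  assert (HPhi : C1_holomorphic Phi E z0 r).
  { intros w Hw. destruct (LOC w Hw) as [_ [_ Hhw]]. split.
    - apply is_Cderive_minus.
      + now apply (radial_primitive_correct om om' z0 w r).
      + apply is_Cderive_comp; [|now apply Hhr].
        now apply (radial_primitive_correct f f' (beta t0) (h w) r2).
    - apply continuous_Cminus; [eapply C1_holomorphic_continuous; eauto|].
      apply continuous_Cmult; [|now apply Hhr].
      apply (continuous_comp h f); eapply C1_holomorphic_continuous; eauto. }
  (* The chain rule for h (beta' s) = beta s. It serves twice: to see that [E] vanishes along the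
     curve, and that h' is nonzero at [z0]. *)
  assert (Hdh : forall t, a < t < b -> Cmod (beta' t - z0) < r ->
    (h' (beta' t) * (f (beta t) * dbeta t / om (beta' t)))%C = dbeta t).
  { intros t Ht Hb. apply (is_derive_C_unique beta t); [|now apply Hbeta].
    apply (is_derive_ext_loc (fun s => h (beta' s))).
    - generalize (locally_interval t Ht). apply filter_imp. intros s Hs. now apply gauss_map_on_curve.
    - apply is_derive_C_comp; [now apply Hhr|now apply curve_differentiable]. }
  assert (TAU : exists tau, 0 < tau /\ forall s, t0 - tau < s < t0 + tau ->
      a < s < b /\ Cmod (beta' s - z0) < r).
  { destruct (continuous_Cmod beta' t0) as [L _].
    destruct (filter_and _ _ (L Cb r Hr) (locally_interval t0 Ht0)) as [tau K].
    exists tau. split; [apply cond_pos|]. intros s Hs.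
    destruct (K s) as [K1 K2]; [|now split]. change (Rabs (s - t0) < tau). apply Rabs_def1; lra. }
  destruct TAU as [tau [Htau TAU]].
  assert (Const : forall s, t0 - tau < s < t0 + tau -> Phi (beta' s) = Phi z0).
  { intros s Hs. apply (curve_derive_0_constant (fun s => Phi (beta' s)) (t0 - tau) (t0 + tau)); auto; [|lra].
    intros t Ht. destruct (TAU t Ht) as [Hab Hb].
    assert (Dt := is_derive_C_comp Phi beta' t _ _ (proj1 (HPhi _ Hb)) (curve_differentiable t Hab)).
    assert (Z : (E (beta' t) * (f (beta t) * dbeta t / om (beta' t)))%C = 0).
    { unfold E. rewrite gauss_map_on_curve by auto.
      replace ((om (beta' t) - f (beta t) * h' (beta' t)) * (f (beta t) * dbeta t / om (beta' t)))%C
       with (f (beta t) * dbeta t - f (beta t) * (h' (beta' t) * (f (beta t) * dbeta t / om (beta' t))))%C.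
      - rewrite Hdh by auto. ring.
      - field. now apply Hgauss. }
    rewrite Z in Dt. exact Dt. }
  (* The identity theorem asks for zeros other than [z0]; [h] recovers [beta s] from [beta' s], so a
     return to [z0] would contradict [Hembed]. *)
  assert (Hb0 : forall s, a < s < b -> s <> t0 -> beta' s <> z0).
  { intros s Hs N Eq. destruct (Hembed t0 (Rabs (s - t0)) Ht0) as [d [Hd K]].
    { apply Rabs_pos_lt. lra. }
    specialize (K s Hs). rewrite <- (gauss_map_on_curve s Hs), Eq, Hz0 in K.
    replace (beta t0 - beta t0)%C with (RtoC 0) in K by ring. rewrite Cmod_0 in K. specialize (K Hd). lra. }
  assert (PhiC : forall z, Cmod (z - z0) < r / 2 -> Phi z = Phi z0).
  { intros z Hz.
    assert (ZZ : (Phi z - Phi z0)%C = 0).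
    { apply (identity_theorem (fun z => Phi z - Phi z0)%C E z0 (r / 2) r); auto; [lra| |].
      - intros w Hw. destruct (HPhi w Hw) as [A B]. split; auto.
        eapply is_Cderive_eq; [apply is_Cderive_minus; [exact A|apply is_Cderive_const]|]. ring.
      - intros eps He. destruct (continuous_Cmod beta' t0) as [L _].
        destruct (L Cb eps He) as [k K].
        assert (Hk := cond_pos k).
        pose (s := t0 + Rmin k tau / 2).
        assert (M1 : Rmin k tau <= k) by apply Rmin_l. assert (M2 : Rmin k tau <= tau) by apply Rmin_r.
        assert (M0 : 0 < Rmin k tau) by (apply Rmin_pos; auto).
        assert (Hs : t0 - tau < s < t0 + tau) by (unfold s; lra).
        exists (beta' s). split; [|split].
        + apply Hb0; [now apply TAU|unfold s; lra].
        + apply K. change (Rabs (s - t0) < k). unfold s. apply Rabs_def1; lra.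
        + rewrite Const by auto. ring. }
    replace (Phi z) with (Phi z - Phi z0 + Phi z0)%C by ring. rewrite ZZ. ring. }
  assert (E0 : forall z, Cmod (z - z0) < r / 2 -> E z = 0).
  { intros z Hz. apply (is_Cderive_unique Phi z); [apply HPhi; lra|].
    apply (is_Cderive_ext_loc (fun _ => Phi z0)); [|apply is_Cderive_const].
    exists (r / 2 - Cmod (z - z0)). split; [lra|]. intros w Hw. symmetry. apply PhiC.
    replace (w - z0)%C with (w - z + (z - z0))%C by ring.
    eapply Rle_lt_trans; [apply Cmod_triangle|]. lra. }
  assert (Hz00 : Cmod (z0 - z0) < r / 2).
  { replace (z0 - z0)%C with (RtoC 0) by ring. rewrite Cmod_0. lra. }
  assert (Hh0 : h' z0 <> 0).
  { intros Z. assert (K := Hdh t0 Ht0). fold z0 in K. rewrite Z, Cmult_0_l in K.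
    apply (proj1 (proj2 (Hbeta t0 Ht0))). symmetry. apply K. lra. }
  destruct (C1_holomorphic_locally_injective h h' z0 r Hr Hhr Hh0) as [e [He Inj]].
  assert (EQ : forall z, Cmod (z - z0) < r / 2 ->
     (P1 z = f (h z) * wei1 (h z) * h' z /\ P2 z = f (h z) * wei2 (h z) * h' z /\ P3 z = f (h z) * h z * h' z)%C).
  { intros z Hz. destruct (LOC z) as [Dz [Oz _]]; [lra|].
    assert (OE : om z = (f (h z) * h' z)%C).
    { specialize (E0 z Hz). unfold E in E0. replace (om z) with (om z - f (h z) * h' z + f (h z) * h' z)%C by ring.
      rewrite E0. ring. }
    assert (P3E : P3 z = (h z * om z)%C) by (unfold h; field; auto).
    destruct (null_weierstrass _ _ _ _ (cg_null _ _ _ _ _ HY _ Dz) Oz P3E) as [A B].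
    fold (om z) in A, B. rewrite A, B, P3E, OE. repeat split; ring. }
  assert (GR : forall z, Cmod (z - z0) < r / 2 ->
      is_grad (fun w => x1 (Y w) - x1 (X (h w))) z 0 /\
      is_grad (fun w => x2 (Y w) - x2 (X (h w))) z 0 /\
      is_grad (fun w => x3 (Y w) - x3 (X (h w))) z 0).
  { intros z Hz. destruct (LOC z) as [Dz [Oz Hhz]]; [lra|]. destruct (EQ z Hz) as [A1 [A2 A3]].
    assert (Dh := proj1 (Hhr z ltac:(lra))). assert (DD : D (h z)) by auto.
    split; [|split].
    - replace (RtoC 0) with (P1 z - f (h z) * wei1 (h z) * h' z)%C by (rewrite A1; ring).
      apply is_grad_minus; [now apply (cg_1 _ _ _ _ _ HY)|].
      apply (is_grad_comp (fun w => x1 (X w)) h); auto. now apply (cg_1 _ _ _ _ _ HX).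
    - replace (RtoC 0) with (P2 z - f (h z) * wei2 (h z) * h' z)%C by (rewrite A2; ring).
      apply is_grad_minus; [now apply (cg_2 _ _ _ _ _ HY)|].
      apply (is_grad_comp (fun w => x2 (X w)) h); auto. now apply (cg_2 _ _ _ _ _ HX).
    - replace (RtoC 0) with (P3 z - f (h z) * h z * h' z)%C by (rewrite A3; ring).
      apply is_grad_minus; [now apply (cg_3 _ _ _ _ _ HY)|].
      apply (is_grad_comp (fun w => x3 (X w)) h); auto. now apply (cg_3 _ _ _ _ _ HX). }
  exists (Rmin (r / 2) e). split; [apply Rmin_pos; lra|]. split.
  - intros z Hz. assert (Hz1 := Rlt_le_trans _ _ _ Hz (Rmin_l _ _)).
    destruct (LOC z) as [Dz [Oz Hhz]]; [lra|].
    split; [auto|]. split; [auto|]. split; [auto|].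
    assert (C1 := is_grad_0_constant _ z0 (r / 2) (fun w Hw => proj1 (GR w Hw)) z0 z Hz00 Hz1).
    assert (C2 := is_grad_0_constant _ z0 (r / 2) (fun w Hw => proj1 (proj2 (GR w Hw))) z0 z Hz00 Hz1).
    assert (C3 := is_grad_0_constant _ z0 (r / 2) (fun w Hw => proj2 (proj2 (GR w Hw))) z0 z Hz00 Hz1).
    cbv beta in C1, C2, C3. rewrite Hz0, HYX in C1, C2, C3.
    destruct (Y z) as [[y1 y2] y3], (X (h z)) as [[u1 u2] u3]. unfold x1, x2, x3 in *. simpl in *.
    f_equal; [f_equal|]; lra.
  - intros z w Hz Hw. apply Inj; eapply Rlt_le_trans; eauto; apply Rmin_r.
Qed.

(* On a disc of radius [d] about [beta' t], [h] is close enough to [beta t] that two such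
   discs whose images meet lie in a common disc of injectivity. *)
Definition adapted_disc (t r sg d : R) : Prop :=
  a < t < b /\ 0 < d <= r / 2 /\
  (forall z, Cmod (z - beta' t) < r -> D' z /\ om z <> 0 /\ D (h z) /\ Y z = X (h z)) /\
  (forall z w, Cmod (z - beta' t) < r -> Cmod (w - beta' t) < r -> h z = h w -> z = w) /\
  (forall s, a < s < b -> Cmod (beta s - beta t) < 2 * sg -> Cmod (beta' s - beta' t) < r / 2) /\
  (forall z, Cmod (z - beta' t) < d -> Cmod (h z - beta t) < sg).

Lemma adapted_disc_exists (t : R) : a < t < b -> exists r sg d, adapted_disc t r sg d.
Proof.
  intros Ht. destruct (coincide_locally t Ht) as [r [Hr [A B]]].
  destruct (Hcurve t Ht) as [Cb [Db' _]].
  destruct (continuous_Cmod beta' t) as [L _]. destruct (L Cb (r / 2) ltac:(lra)) as [k K].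
  destruct (Hembed t k Ht (cond_pos k)) as [s [Hs S]].
  destruct gauss_map_C1 as [h' Hh'].
  assert (Ch := is_Cderive_continuous _ _ _ (proj1 (Hh' _ (conj Db' (proj1 (Hgauss t Ht)))))).
  destruct (continuous_Cmod (U := C_UniformSpace) h (beta' t)) as [L3 _].
  specialize (L3 Ch (s / 2) ltac:(lra)). apply locally_Cmod in L3. destruct L3 as [e [He E]].
  exists r, (s / 2), (Rmin e (r / 2)). split; [auto|]. split; [|split; [auto|split; [auto|split]]].
  - split; [apply Rmin_pos; lra|apply Rmin_r].
  - intros x Hx Hxs. apply K. apply (S x Hx). lra.
  - intros z Hz. rewrite <- (gauss_map_on_curve t Ht). apply E.
    eapply Rlt_le_trans; [exact Hz|apply Rmin_l].
Qed.

(** If the images meet, [beta s] and [beta t] are closer than sg + sg', at most twice the larger of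
    the two, so the corresponding disc puts the centres at distance less than r / 2. As d' <= r' / 2
    <= r / 2, both points then lie in the injectivity disc of radius [r] about [beta' t]. *)
Lemma adapted_discs_injective (t r sg d s r' sg' d' : R) (z w : C) :
  adapted_disc t r sg d -> adapted_disc s r' sg' d' -> r' <= r ->
  Cmod (z - beta' t) < d -> Cmod (w - beta' s) < d' -> h z = h w -> z = w.
Proof.
  intros [Ht [Hd [_ [Inj [M N]]]]] [Hs [Hd' [_ [_ [M' N']]]]] Hr Hz Hw E.
  assert (B : Cmod (beta s - beta t) < sg + sg').
  { specialize (N z Hz). specialize (N' w Hw). rewrite E in N.
    replace (beta s - beta t)%C with ((h w - beta t) + - (h w - beta s))%C by ring.
    eapply Rle_lt_trans; [apply Cmod_triangle|]. rewrite Cmod_opp. lra. }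
  assert (B' : Cmod (beta' s - beta' t) < r / 2).
  { destruct (Rle_dec sg' sg) as [L|L].
    - apply M; auto. lra.
    - apply Rlt_le_trans with (r' / 2); [|lra].
      rewrite <- Cmod_opp. replace (- (beta' s - beta' t))%C with (beta' t - beta' s)%C by ring.
      apply M'; auto. rewrite <- Cmod_opp.
      replace (- (beta t - beta s))%C with (beta s - beta t)%C by ring. lra. }
  apply Inj; auto; [lra|].
  replace (w - beta' t)%C with ((w - beta' s) + (beta' s - beta' t))%C by ring.
  eapply Rle_lt_trans; [apply Cmod_triangle|]. lra.
Qed.

(** The change of parameters is [h] on the union of all adapted discs; to compare two points, the
    disc with the larger [r] is taken first. *)
Lemma weierstrass_coincidence :
  exists (U : C -> Prop) (k : C -> C),
    open U /\
    (forall t, a < t < b -> U (beta' t) /\ k (beta' t) = beta t) /\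
    holomorphic_on U k /\
    (forall z w, U z -> U w -> k z = k w -> z = w) /\
    (forall z, U z -> D' z /\ D (k z) /\ Y z = X (k z)).
Proof.
  pose (U := fun z => exists t r sg d, adapted_disc t r sg d /\ Cmod (z - beta' t) < d).
  assert (HU : forall z, U z -> D' z /\ om z <> 0 /\ D (h z) /\ Y z = X (h z)).
  { intros z [t [r [sg [d [H Hz]]]]]. apply H. destruct H as [_ [H _]]. lra. }
  exists U, h. split; [|split; [|split; [|split]]].
  - apply open_of_balls. intros z [t [r [sg [d [H Hz]]]]]. exists (d - Cmod (z - beta' t)).
    split; [lra|]. intros w Hw. exists t, r, sg, d. split; auto.
    replace (w - beta' t)%C with ((w - z) + (z - beta' t))%C by ring.
    eapply Rle_lt_trans; [apply Cmod_triangle|]. lra.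
  - intros t Ht. split; [|now apply gauss_map_on_curve].
    destruct (adapted_disc_exists t Ht) as [r [sg [d H]]]. exists t, r, sg, d. split; auto.
    replace (beta' t - beta' t)%C with (RtoC 0) by ring. rewrite Cmod_0. apply H.
  - intros z Hz. destruct gauss_map_C1 as [h' Hh']. exists (h' z). apply Hh'.
    destruct (HU z Hz) as [A [B _]]. now split.
  - intros z w [t [r [sg [d [H Hz]]]]] [s [r' [sg' [d' [H' Hw]]]]] E.
    destruct (Rle_dec r' r).
    + now apply (adapted_discs_injective t r sg d s r' sg' d').
    + symmetry. apply (adapted_discs_injective s r' sg' d' t r sg d); auto. lra.
  - intros z Hz. destruct (HU z Hz) as [A [_ B]]. now split.
Qed.

End Coincidence.

(** * Real parts of holomorphic maps *)

(** The sum of the squares of the components of X_u - i X_v is |X_u|^2 - |X_v|^2 - 2 i <X_u, X_v>,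
    so conformality is nullity of the gradient. *)
Lemma branched_minimal_surface_gradient (D : C -> Prop) (X : C -> R3) :
  branched_minimal_surface D X ->
  conformal_gradient D X
    (complex_gradient (fun u v => x1 (X (u, v))))
    (complex_gradient (fun u v => x2 (X (u, v))))
    (complex_gradient (fun u v => x3 (X (u, v)))).
Proof.
  intros [HD [[H1 [H2 H3]] [HC _]]].
  destruct (harmonic_complex_gradient D _ HD H1) as [G1 K1].
  destruct (harmonic_complex_gradient D _ HD H2) as [G2 K2].
  destruct (harmonic_complex_gradient D _ HD H3) as [G3 K3].
  split; auto.
  - intros z Hz. apply (is_grad_ext (fun w => x1 (X (Re w, Im w)))); [now intros []|auto].
  - intros z Hz. apply (is_grad_ext (fun w => x2 (X (Re w, Im w)))); [now intros []|auto].
  - intros z Hz. apply (is_grad_ext (fun w => x3 (X (Re w, Im w)))); [now intros []|auto].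
  - intros z Hz. destruct (HC z Hz) as [A B]. unfold dot3, Du, Dv in A, B.
    unfold x1 at 1 3 5 7, x2 at 1 3 5 7, x3 at 1 3 5 7 in A.
    cbn [fst snd] in A, B.
    unfold complex_gradient.
    set (a1 := partial_derive 1 0 (fun u v => x1 (X (u, v))) (Re z) (Im z)) in *.
    set (a2 := partial_derive 1 0 (fun u v => x2 (X (u, v))) (Re z) (Im z)) in *.
    set (a3 := partial_derive 1 0 (fun u v => x3 (X (u, v))) (Re z) (Im z)) in *.
    set (b1 := partial_derive 0 1 (fun u v => x1 (X (u, v))) (Re z) (Im z)) in *.
    set (b2 := partial_derive 0 1 (fun u v => x2 (X (u, v))) (Re z) (Im z)) in *.
    set (b3 := partial_derive 0 1 (fun u v => x3 (X (u, v))) (Re z) (Im z)) in *.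
    change (a1 * a1 + a2 * a2 + a3 * a3 = b1 * b1 + b2 * b2 + b3 * b3) in A.
    change (a1 * b1 + a2 * b2 + a3 * b3 = 0) in B.
    apply C_ext; simpl; lra.
Qed.

Lemma unit_normal_gradient (X : C -> R3) (z : C) (n : R3) :
  unit_normal_at X z n ->
  let P1 := complex_gradient (fun u v => x1 (X (u, v))) z in
  let P2 := complex_gradient (fun u v => x2 (X (u, v))) z in
  let P3 := complex_gradient (fun u v => x3 (X (u, v))) z in
  (RtoC (x1 n) * P1 + RtoC (x2 n) * P2 + RtoC (x3 n) * P3)%C = 0 /\
  ~ (P1 = 0 /\ P2 = 0 /\ P3 = 0).
Proof.
  intros [H1 [_ [H2 H3]]] P1 P2 P3. split.
  - unfold dot3, Du, Dv in H2, H3. 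
    apply C_ext; unfold P1, P2, P3, complex_gradient; simpl.
    + unfold x1 at 2, x2 at 2, x3 at 2 in H2. cbn [fst snd] in H2. unfold x1 at 1, x2 at 1, x3 at 1. 
      etransitivity; [|exact H2]. unfold x1, x2, x3; simpl; ring.
    + apply Ropp_eq_compat in H3. rewrite Ropp_0 in H3. etransitivity; [|exact H3].
      unfold x1, x2, x3; simpl; ring.
  - intros [E1 [E2 E3]]. apply H1. unfold P1, P2, P3, complex_gradient in *.
    apply (f_equal fst) in E1. apply (f_equal fst) in E2. apply (f_equal fst) in E3. simpl fst in *.
    unfold cross3, Du, zero3. rewrite E1, E2, E3. unfold x1, x2, x3; simpl. f_equal; [f_equal|]; ring.
Qed.

Lemma is_derive_horizontal (v x : R) : is_derive (fun x : R => (x, v) : C) x (RtoC 1).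
Proof.
  apply is_derive_Cpair. simpl. split; [apply (is_derive_id (K := R_AbsRing))|].
  apply (is_derive_const v).
Qed.

Lemma is_derive_vertical (u y : R) : is_derive (fun y : R => (u, y) : C) y Ci.
Proof.
  apply is_derive_Cpair. simpl. split; [apply (is_derive_const u)|].
  apply (is_derive_id (K := R_AbsRing)).
Qed.

Lemma partial_derive_Re (G : C -> C) (g : C) (u v : R) : is_Cderive G (u, v) g ->
  is_derive (fun x => Re (G (x, v))) u (Re g) /\
  is_derive (fun y => Re (G (u, y))) v (Re (Ci * g)%C).
Proof.
  intros H. split.
  - replace g with (g * 1)%C by ring.
    exact (proj1 (proj1 (is_derive_Cpair _ _ _)
      (is_derive_C_comp G (fun x : R => (x, v) : C) u g 1 H (is_derive_horizontal v u)))).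
  - rewrite Cmult_comm.
    exact (proj1 (proj1 (is_derive_Cpair _ _ _)
      (is_derive_C_comp G (fun y : R => (u, y) : C) v g Ci H (is_derive_vertical u v)))).
Qed.

Lemma continuity_2d_Re (G : C -> C) (u v : R) :
  @continuous C_UniformSpace C_UniformSpace G (u, v) ->
  continuity_2d_pt (fun u v => Re (G (u, v))) u v.
Proof.
  intros H. apply continuity_2d_pt_filterlim. apply continuous_Re in H.
  apply (continuous_ext (T := C_UniformSpace) (U := R_UniformSpace) (fun w : C => Re (G w)) (fun z : C => Re (G (fst z, snd z)))) in H.
  - exact H.
  - now intros [].
Qed.

Lemma open_locally_2d (D : C -> Prop) (u v : R) : open D -> D (u, v) ->
  locally_2d (fun a b => D (a, b)) u v.
Proof.
  intros HD H. apply locally_2d_locally. specialize (HD _ H). revert HD. apply filter_imp. now intros [].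
Qed.

(** The partial derivatives of Re G are Re g and Re (i g), again real parts of functions of the same
    kind; this is what lets the recursion of [ex_diff_n] run. *)
Lemma ex_diff_n_Re_step (D : C -> Prop) (G g : C -> C) (n : nat) : open D ->
  (forall z, D z -> is_Cderive G z (g z)) ->
  (forall u v, D (u, v) -> ex_diff_n (fun u v => Re (g (u, v))) n u v) ->
  (forall u v, D (u, v) -> ex_diff_n (fun u v => Re (Ci * g (u, v))%C) n u v) ->
  forall u v, D (u, v) -> ex_diff_n (fun u v => Re (G (u, v))) (S n) u v.
Proof.
  intros HD HG H1 H2 u v Huv. simpl.
  assert (L := open_locally_2d D u v HD Huv).
  split; [|split; [|split; [|split]]].
  - apply continuity_2d_Re. eapply is_Cderive_continuous. now apply HG.
  - eexists. apply (partial_derive_Re G _ u v (HG _ Huv)).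
  - eexists. apply (partial_derive_Re G _ u v (HG _ Huv)).
  - apply (ex_diff_n_ext_loc (fun u v => Re (g (u, v)))); [|auto].
    revert L. apply locally_2d_impl, locally_2d_forall. intros a b Hab. symmetry.
    apply is_derive_unique. apply (partial_derive_Re G _ a b (HG _ Hab)).
  - apply (ex_diff_n_ext_loc (fun u v => Re (Ci * g (u, v))%C)); [|auto].
    revert L. apply locally_2d_impl, locally_2d_forall. intros a b Hab. symmetry.
    apply is_derive_unique. apply (partial_derive_Re G _ a b (HG _ Hab)).
Qed.

Lemma harmonic_on_Re (D : C -> Prop) (G g : C -> C) : open D ->
  (forall z, D z -> is_Cderive G z (g z)) -> C1_holomorphic_on D g ->
  harmonic_on D (fun u v => Re (G (u, v))) /\
  forall u v, D (u, v) ->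
    partial_derive 1 0 (fun u v => Re (G (u, v))) u v = Re (g (u, v)) /\
    partial_derive 0 1 (fun u v => Re (G (u, v))) u v = - Im (g (u, v)).
Proof.
  intros HD HG [k Hk].
  assert (I : forall w, Re (Ci * w)%C = - Im w) by (intros w; unfold Re, Im; simpl; ring).
  assert (HIg : forall z, D z -> is_Cderive (fun z => Ci * g z)%C z (Ci * k z)).
  { intros z Hz. apply is_Cderive_scal. now apply Hk. }
  assert (PD : forall u v, D (u, v) ->
    partial_derive 1 0 (fun u v => Re (G (u, v))) u v = Re (g (u, v)) /\
    partial_derive 0 1 (fun u v => Re (G (u, v))) u v = Re (Ci * g (u, v))%C).
  { intros u v Huv. destruct (partial_derive_Re G _ u v (HG _ Huv)) as [A B].
    split; now apply is_derive_unique. }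
  assert (E0 : forall F, (forall z, D z -> @continuous C_UniformSpace C_UniformSpace F z) ->
     forall u v, D (u, v) -> ex_diff_n (fun u v => Re (F (u, v))) 0 u v).
  { intros F HF u v Huv. split; auto. apply continuity_2d_Re. auto. }
  assert (CI : forall F, (forall z, D z -> @continuous C_UniformSpace C_UniformSpace F z) ->
     forall z, D z -> @continuous C_UniformSpace C_UniformSpace (fun z => Ci * F z)%C z).
  { intros F HF z Hz. apply continuous_Cmult; auto. apply continuous_const. }
  assert (Ck : forall z, D z -> @continuous C_UniformSpace C_UniformSpace k z) by (intros z Hz; now apply Hk).
  split.
  - intros u v Huv. split.
    + apply (ex_diff_n_Re_step D G g 1); auto.
      * apply (ex_diff_n_Re_step D g k 0); auto. intros; now apply Hk.
        apply (E0 (fun z => Ci * k z)%C); auto.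
      * apply (ex_diff_n_Re_step D (fun z => Ci * g z)%C (fun z => Ci * k z)%C 0); auto.
        -- apply (E0 (fun z => Ci * k z)%C); auto.
        -- apply (E0 (fun z => Ci * (Ci * k z))%C); auto.
    + assert (L := open_locally_2d D u v HD Huv).
      change (partial_derive 2 0 (fun u v => Re (G (u, v))) u v)
        with (Derive (fun x => Derive (fun x => Re (G (x, v))) x) u).
      change (partial_derive 0 2 (fun u v => Re (G (u, v))) u v)
        with (Derive (fun y => Derive (fun y => Re (G (u, y))) y) v).
      rewrite (Derive_ext_loc _ (fun x => Re (g (x, v)))).
      2: { apply locally_2d_1d_const_y in L. revert L. apply filter_imp. intros x Hx. now apply PD. }
      rewrite (Derive_ext_loc (fun y => Derive (fun y => Re (G (u, y))) y) (fun y => Re (Ci * g (u, y))%C)).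
      2: { apply locally_2d_1d_const_x in L. revert L. apply filter_imp. intros y Hy. now apply PD. }
      (* Differentiating twice in v brings out i * i, so the two second derivatives cancel. *)
      transitivity (Re (k (u, v)) + Re (Ci * (Ci * k (u, v)))%C).
      * apply f_equal2; apply is_derive_unique.
        -- apply (partial_derive_Re g _ u v), Hk, Huv.
        -- apply (partial_derive_Re _ _ u v (HIg _ Huv)).
      * unfold Re; simpl; ring.
  - intros u v Huv. rewrite <- I. now apply PD.
Qed.

Lemma harmonic_on_ext (D : C -> Prop) (f g : R -> R -> R) : open D ->
  (forall u v, D (u, v) -> f u v = g u v) -> harmonic_on D f -> harmonic_on D g.
Proof.
  intros HD E H u v Huv. assert (L := open_locally_2d D u v HD Huv).
  assert (L' : locally_2d (fun a b => f a b = g a b) u v).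
  { revert L. apply locally_2d_impl, locally_2d_forall. auto. }
  destruct (H u v Huv) as [A B]. split.
  - now apply (ex_diff_n_ext_loc f).
  - rewrite <- !(partial_derive_ext_loc f g) by auto. exact B.
Qed.

Lemma C1_holomorphic_on_mult (D : C -> Prop) (F G : C -> C) :
  C1_holomorphic_on D F -> C1_holomorphic_on D G -> C1_holomorphic_on D (fun z => F z * G z)%C.
Proof.
  intros [F' HF] [G' HG]. exists (fun z => F' z * G z + F z * G' z)%C. intros z Hz.
  destruct (HF z Hz) as [A1 B1], (HG z Hz) as [A2 B2].
  pose proof (is_Cderive_continuous _ _ _ A1). pose proof (is_Cderive_continuous _ _ _ A2).
  split; [now apply is_Cderive_mult|].
  apply continuous_Cplus; now apply continuous_Cmult.
Qed.

(* Surfaces are only compared on [D]: their values off [D] are junk. *)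
Lemma is_grad_ext_loc (f g : C -> R) (z p : C) :
  (exists e, 0 < e /\ forall w, Cmod (w - z) < e -> f w = g w) -> is_grad f z p -> is_grad g z p.
Proof.
  intros [e [He E]] [Q [CQ [EQ H]]].
  assert (Hzz : Cmod (z - z) < e) by (replace (z - z)%C with (RtoC 0) by ring; now rewrite Cmod_0).
  exists (fun w => if Ceq_dec w z then p else Q w + RtoC (g w - f w) / (w - z))%C.
  assert (Hz : (if Ceq_dec z z then p else (Q z + RtoC (g z - f z) / (z - z))%C) = p)
    by (destruct (Ceq_dec z z); congruence).
  split; [|split; auto].
  - apply continuous_Cmod. intros eps Heps. rewrite Hz.
    destruct (continuous_Cmod (U := C_UniformSpace) Q z) as [A _]. specialize (A CQ eps Heps).
    apply locally_Cmod in A. destruct A as [d [Hd A]]. apply locally_Cmod.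
    exists (Rmin d e). split; [now apply Rmin_pos|]. intros w Hw.
    destruct (Ceq_dec w z) as [->|N].
    { replace (p - p)%C with (RtoC 0) by ring. now rewrite Cmod_0. }
    rewrite (E w) by (eapply Rlt_le_trans; [exact Hw|apply Rmin_r]).
    replace (Q w + RtoC (g w - g w) / (w - z) - p)%C with (Q w - Q z)%C.
    + apply A. eapply Rlt_le_trans; [exact Hw|apply Rmin_l].
    + rewrite Rminus_diag, EQ. field. now apply Cminus_neq_0.
  - intros w. destruct (Ceq_dec w z) as [->|N].
    { replace (p * (z - z))%C with (RtoC 0) by ring. simpl. ring. }
    replace ((Q w + RtoC (g w - f w) / (w - z)) * (w - z))%C with (Q w * (w - z) + RtoC (g w - f w))%C
      by (field; now apply Cminus_neq_0).
    assert (T := H w). assert (T' := E z Hzz). 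
    change (Re (Q w * (w - z) + RtoC (g w - f w))%C) with (Re (Q w * (w - z))%C + (g w - f w)). lra.
Qed.

Section Primitive.

Variables (D : C -> Prop) (F1 F2 F3 f1 f2 f3 : C -> C).
Hypothesis HD : open D.
Hypothesis H1 : forall z, D z -> is_Cderive F1 z (f1 z).
Hypothesis H2 : forall z, D z -> is_Cderive F2 z (f2 z).
Hypothesis H3 : forall z, D z -> is_Cderive F3 z (f3 z).
Hypothesis K1 : C1_holomorphic_on D f1.
Hypothesis K2 : C1_holomorphic_on D f2.
Hypothesis K3 : C1_holomorphic_on D f3.

Definition Re3 (z : C) : R3 := (Re (F1 z), Re (F2 z), Re (F3 z)).

Lemma is_RInt_Re_path (F f : C -> C) (p dp : R -> C) (s t : R) : s < t ->
  (forall z, D z -> is_Cderive F z (f z)) -> C1_holomorphic_on D f ->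
  (forall x, s <= x <= t -> D (p x) /\ is_derive p x (dp x) /\ continuous dp x) ->
  is_RInt (fun x => Re (f (p x) * dp x)%C) s t (Re (F (p t)) - Re (F (p s))).
Proof.
  intros Hst HF [f' Hf] Hp.
  apply (is_RInt_derive (fun x => Re (F (p x))) (fun x => Re (f (p x) * dp x)%C));
    intros x; rewrite Rmin_left, Rmax_right by lra; intros Hx;
    destruct (Hp x Hx) as [A [B E]].
  - apply (is_derive_Cpair (fun x => F (p x))). apply is_derive_C_comp; auto.
  - apply (continuous_Re (fun x => f (p x) * dp x)%C). apply continuous_Cmult; auto.
    apply (continuous_comp p f); [eapply is_derive_C_continuous; eauto|].
    eapply is_Cderive_continuous. now apply Hf.
Qed.

Lemma is_Re_integral_primitive :
  is_Re_integral D (fun z => (f1 z, f2 z, f3 z)) Re3.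
Proof.
  intros p dp s t Hst Hp.
  apply (is_RInt_fct_extend_pair (U := prod_NormedModule R_AbsRing R_NormedModule R_NormedModule) (V := R_NormedModule));
    [apply (is_RInt_fct_extend_pair (U := R_NormedModule) (V := R_NormedModule))|]; simpl;
    now apply is_RInt_Re_path.
Qed.

Lemma Re_integral_increment (X : C -> R3) :
  is_Re_integral D (fun z => (f1 z, f2 z, f3 z)) X ->
  forall (p dp : R -> C) (s t : R), s < t ->
  (forall x, s <= x <= t -> D (p x) /\ is_derive p x (dp x) /\ continuous dp x) ->
  sub3 (X (p t)) (X (p s)) = sub3 (Re3 (p t)) (Re3 (p s)).
Proof.
  intros HX p dp s t Hst Hp.
  specialize (HX p dp s t Hst Hp). assert (H0 := is_Re_integral_primitive p dp s t Hst Hp).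
  set (I := fun x : R => Re_mult3 (f1 (p x), f2 (p x), f3 (p x)) (dp x)) in *.
  (* An integral in the product space is determined by its three real components. *)
  assert (U : forall l, is_RInt I s t l -> l =
    ((RInt (fun x => fst (fst (I x))) s t, RInt (fun x => snd (fst (I x))) s t), RInt (fun x => snd (I x)) s t)).
  { intros l Hl.
    assert (A := is_RInt_fct_extend_fst (U := prod_NormedModule R_AbsRing R_NormedModule R_NormedModule) (V := R_NormedModule) _ _ _ _ Hl).
    assert (B := is_RInt_fct_extend_snd (U := prod_NormedModule R_AbsRing R_NormedModule R_NormedModule) (V := R_NormedModule) _ _ _ _ Hl).
    assert (A1 := is_RInt_fct_extend_fst (U := R_NormedModule) (V := R_NormedModule) _ _ _ _ A).
    assert (A2 := is_RInt_fct_extend_snd (U := R_NormedModule) (V := R_NormedModule) _ _ _ _ A).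
    apply (is_RInt_unique (V := R_CompleteNormedModule)) in B.
    apply (is_RInt_unique (V := R_CompleteNormedModule)) in A1.
    apply (is_RInt_unique (V := R_CompleteNormedModule)) in A2.
    destruct l as [[l1 l2] l3]. simpl in *. congruence. }
  rewrite (U _ HX). symmetry. exact (U _ H0).
Qed.

Lemma Re_integral_segment (X : C -> R3) (z w : C) :
  is_Re_integral D (fun z => (f1 z, f2 z, f3 z)) X ->
  (forall s, 0 <= s <= 1 -> D (z + RtoC s * (w - z))%C) ->
  sub3 (X w) (X z) = sub3 (Re3 w) (Re3 z).
Proof.
  intros HX Hs.
  assert (A := Re_integral_increment X HX (fun s => z + RtoC s * (w - z))%C (fun _ => w - z)%C 0 1 Rlt_0_1).
  cbv beta in A.
  replace (z + 1 * (w - z))%C with w in A by ring. replace (z + 0 * (w - z))%C with z in A by ring.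
  apply A. intros s Hs'. split; [auto|]. split; [apply is_derive_segment|apply continuous_const].
Qed.

End Primitive.

(** * The surfaces H_m *)

(* For even [m] the factor [i] is [eps m]; for odd [m] it comes from the conjugation. *)
Definition H_coef (m : nat) (z : C) : C := (Ci * ((z ^ (2 * m + 2) - 1) / z ^ (m + 3)))%C.

Definition H_gradient (m : nat) (z : C) : C3 :=
  (H_coef m z * wei1 z, H_coef m z * wei2 z, H_coef m z * z)%C.

Lemma is_Re_integral_ext (D : C -> Prop) (phi psi : C -> C3) (X : C -> R3) :
  (forall z, phi z = psi z) -> is_Re_integral D phi X -> is_Re_integral D psi X.
Proof.
  intros E H p dp a b Hab Hp. apply (is_RInt_ext (fun t => Re_mult3 (phi (p t)) (dp t))).
  - intros x _. now rewrite E.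
  - now apply H.
Qed.

Lemma is_H_even (m : nat) (X : C -> R3) : Nat.Even m ->
  (is_H m X <-> is_Re_integral punctured_plane (H_gradient m) X).
Proof.
  intros Hm. assert (E : forall z, weierstrass (fun z => z) (omega_coef m) z = H_gradient m z).
  { intros z. unfold weierstrass, H_gradient, omega_coef, H_coef, eps, wei1, wei2.
    apply Nat.even_spec in Hm. rewrite Hm.
    apply f_equal2; [apply f_equal2|]; unfold Cdiv; simpl Cpow; ring. }
  split; apply is_Re_integral_ext; auto.
Qed.

Lemma is_H_conjugate_odd (m : nat) (X : C -> R3) : Nat.Odd m ->
  (is_H_conjugate m X <-> is_Re_integral punctured_plane (H_gradient m) X).
Proof.
  intros Hm.
  assert (E : forall z, weierstrass (fun z => z) (fun z => Ci * omega_coef m z)%C z = H_gradient m z).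
  { intros z. unfold weierstrass, H_gradient, omega_coef, H_coef, eps, wei1, wei2.
    apply Nat.odd_spec in Hm. rewrite <- Nat.negb_even in Hm. destruct (Nat.even m); [discriminate|].
    apply f_equal2; [apply f_equal2|]; unfold Cdiv; simpl Cpow; ring. }
  split; apply is_Re_integral_ext; auto.
Qed.

Lemma INR_C_neq_0 (n : nat) : RtoC (INR (S n)) <> 0.
Proof. intros E. apply RtoC_inj in E. now apply (not_0_INR (S n)). Qed.

Definition pow_term (n : nat) (z : C) : C := (z ^ n / RtoC (INR n))%C.

Lemma is_Cderive_pow_term (n : nat) (z : C) : is_Cderive (pow_term (S n)) z (z ^ n)%C.
Proof.
  apply (is_Cderive_ext_loc (fun z => / RtoC (INR (S n)) * z ^ S n)%C).
  { exists 1. split; [lra|]. intros w _. unfold pow_term, Cdiv. apply Cmult_comm. }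
  eapply is_Cderive_eq; [apply is_Cderive_scal, is_Cderive_pow|].
  simpl pred. field. apply INR_C_neq_0.
Qed.

Lemma is_Cderive_inv_term (n : nat) (z : C) : z <> 0 ->
  is_Cderive (fun z => pow_term (S n) (/ z)) z (- (/ z) ^ (S (S n)))%C.
Proof.
  intros Hz. eapply is_Cderive_eq.
  - apply (is_Cderive_comp (pow_term (S n)) Cinv); [apply is_Cderive_pow_term|now apply is_Cderive_inv].
  - rewrite !Cpow_S. field. auto.
Qed.

(** The three primitives are Laurent polynomials: the monomials of the gradient have exponents m -
    1, m, m + 1, - m - 1, - m - 2 and - m - 3, never - 1 for m >= 1, so no logarithm and no period
    appears. *)
Definition H_prim1 (m : nat) (z : C) : C :=
  (Ci / 2 * (pow_term m z + pow_term (m + 2) (/ z) - (pow_term (m + 2) z + pow_term m (/ z))))%C.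
Definition H_prim2 (m : nat) (z : C) : C :=
  (- / 2 * (pow_term m z + pow_term (m + 2) (/ z) + (pow_term (m + 2) z + pow_term m (/ z))))%C.
Definition H_prim3 (m : nat) (z : C) : C :=
  (Ci * (pow_term (m + 1) z + pow_term (m + 1) (/ z)))%C.

Definition H_surface (m : nat) : C -> R3 := Re3 (H_prim1 m) (H_prim2 m) (H_prim3 m).

Lemma H_coef_expand (k : nat) (z : C) : z <> 0 ->
  H_coef (S k) z = (Ci * (z ^ k - (/ z) ^ (k + 4)))%C.
Proof.
  intros Hz. unfold H_coef. rewrite Cpow_inv by auto.
  replace (2 * S k + 2)%nat with (k + (k + 4))%nat by lia.
  replace (S k + 3)%nat with (k + 4)%nat by lia.
  rewrite (Cpow_add_r z k (k + 4)). field. now apply Cpow_nz.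
Qed.

Lemma H_prim_derive (m : nat) (z : C) : (1 <= m)%nat -> z <> 0 ->
  is_Cderive (H_prim1 m) z (H_coef m z * wei1 z) /\
  is_Cderive (H_prim2 m) z (H_coef m z * wei2 z) /\
  is_Cderive (H_prim3 m) z (H_coef m z * z).
Proof.
  intros Hm Hz. destruct m as [|k]; [lia|].
  rewrite (H_coef_expand k z Hz). unfold H_prim1, H_prim2, H_prim3.
  replace (S k + 2)%nat with (S (k + 2)) by lia. replace (S k + 1)%nat with (S (k + 1)) by lia.
  assert (A1 := is_Cderive_plus _ _ _ _ _ (is_Cderive_pow_term k z) (is_Cderive_inv_term (k + 2) z Hz)).
  assert (A2 := is_Cderive_plus _ _ _ _ _ (is_Cderive_pow_term (k + 2) z) (is_Cderive_inv_term k z Hz)).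
  assert (A3 := is_Cderive_plus _ _ _ _ _ (is_Cderive_pow_term (k + 1) z) (is_Cderive_inv_term (k + 1) z Hz)).
  assert (Ik : forall n, ((/ z) ^ n)%C = (/ z ^ n)%C) by (intros n; now apply Cpow_inv).
  assert (Nk : (z ^ k)%C <> 0) by now apply Cpow_nz.
  replace (S (S (k + 2))) with (k + 4)%nat in A1 by lia.
  replace (S (S (k + 1))) with (k + 3)%nat in A3 by lia.
  replace (S (S k)) with (k + 2)%nat in A2 by lia.
  split; [|split].
  - eapply is_Cderive_eq; [apply is_Cderive_scal, is_Cderive_minus; [exact A1|exact A2]|].
    rewrite !Ik, !Cpow_add_r. unfold wei1. simpl Cpow. field. auto.
  - eapply is_Cderive_eq; [apply is_Cderive_scal, is_Cderive_plus; [exact A1|exact A2]|].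
    transitivity (Ci * Ci * / 2 * (1 + z * z) * (z ^ k - (/ z) ^ (k + 4)))%C.
    + rewrite Ci2, !Ik, !Cpow_add_r. simpl Cpow. field. auto.
    + unfold wei2. field.
  - eapply is_Cderive_eq; [apply is_Cderive_scal; exact A3|].
    rewrite !Ik, !Cpow_add_r. simpl Cpow. field. auto.
Qed.

Lemma C1_holomorphic_on_poly_wei (D : C -> Prop) :
  C1_holomorphic_on D wei1 /\ C1_holomorphic_on D wei2 /\ C1_holomorphic_on D (fun z => z).
Proof.
  assert (Hid : forall z, @continuous C_UniformSpace C_UniformSpace (fun w => w) z) by (intros; apply continuous_id).
  split; [|split].
  - exists (fun z => - z)%C. intros z _. split.
    + eapply is_Cderive_eq.
      * apply is_Cderive_scal, is_Cderive_minus; [apply is_Cderive_const|].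
        apply is_Cderive_mult; apply is_Cderive_id.
      * cbv beta. field.
    + apply continuous_Copp, continuous_id.
  - exists (fun z => Ci * z)%C. intros z _. split.
    + eapply is_Cderive_eq.
      * apply is_Cderive_scal, is_Cderive_plus; [apply is_Cderive_const|].
        apply is_Cderive_mult; apply is_Cderive_id.
      * cbv beta. field.
    + apply continuous_Cmult; [apply continuous_const|auto].
  - exists (fun _ => RtoC 1). intros z _. split; [apply is_Cderive_id|apply continuous_const].
Qed.

Lemma C1_holomorphic_on_H_coef (m : nat) : C1_holomorphic_on punctured_plane (H_coef m).
Proof.
  assert (P : forall n, C1_holomorphic_on punctured_plane (fun z => z ^ n)%C).
  { intros n. exists (fun z => RtoC (INR n) * z ^ pred n)%C. intros z _. split; [apply is_Cderive_pow|].
    apply continuous_Cmult; [apply continuous_const|]. apply (continuous_Cpow (fun z => z)), continuous_id. }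
  apply C1_holomorphic_on_mult.
  { exists (fun _ => RtoC 0). intros z _. split; [apply is_Cderive_const|apply continuous_const]. }
  destruct (P (2 * m + 2)%nat) as [u Hu], (P (m + 3)%nat) as [v Hv].
  exists (fun z => (u z * z ^ (m + 3) - (z ^ (2 * m + 2) - 1) * v z) / (z ^ (m + 3) * z ^ (m + 3)))%C.
  intros z Hz. destruct (Hu z Hz) as [A1 B1], (Hv z Hz) as [A2 B2].
  pose proof (Cpow_nz z (m + 3) Hz) as N.
  pose proof (is_Cderive_continuous _ _ _ A1). pose proof (is_Cderive_continuous _ _ _ A2).
  split.
  - eapply is_Cderive_eq.
    + apply is_Cderive_div; [exact N| |exact A2].
      apply is_Cderive_minus; [exact A1|apply is_Cderive_const].
    + cbv beta. field. exact N.
  - apply continuous_Cdiv; [now apply Cmult_neq_0| |now apply continuous_Cmult].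
    apply continuous_Cminus; apply continuous_Cmult; auto.
    apply continuous_Cminus; [auto|apply continuous_const].
Qed.

Lemma open_punctured_plane : open punctured_plane.
Proof.
  apply open_of_balls. intros z Hz. exists (Cmod z). split; [now apply Cmod_gt_0|].
  intros w Hw E. rewrite E in Hw. replace (0 - z)%C with (- z)%C in Hw by ring.
  rewrite Cmod_opp in Hw. lra.
Qed.

Lemma isolated_zero (F : C -> C) (z l : C) : is_Cderive F z l -> F z <> 0 \/ l <> 0 ->
  exists e, 0 < e /\ forall w, w <> z -> Cmod (w - z) < e -> F w <> 0.
Proof.
  intros HF H. destruct (Ceq_dec (F z) 0) as [Z|N].
  - destruct H as [H|H]; [contradiction|].
    apply is_Cderive_slope in HF. destruct HF as [Q [CQ [E HF]]].
    assert (L := continuous_C_neq_0 (U := C_UniformSpace) Q z CQ). rewrite E in L. specialize (L H).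
    apply locally_Cmod in L. destruct L as [e [He L]]. exists e. split; auto.
    intros w Hw Hwe. rewrite (HF w), Z, Cplus_0_l. apply Cmult_neq_0; auto. now apply Cminus_neq_0.
  - assert (L := continuous_C_neq_0 (U := C_UniformSpace) F z (is_Cderive_continuous _ _ _ HF) N).
    apply locally_Cmod in L. destruct L as [e [He L]]. exists e. split; auto.
Qed.

Lemma Cinv_nonzero (z : C) : z <> 0 -> (/ z)%C <> 0.
Proof.
  intros Hz. apply Cmod_gt_0. rewrite Cmod_inv by auto. now apply Rinv_0_lt_compat, Cmod_gt_0.
Qed.

Lemma H_coef_zero (m : nat) (z : C) : z <> 0 -> (H_coef m z = 0 <-> (z ^ (2 * m + 2))%C = 1).
Proof.
  intros Hz. pose proof (Cpow_nz z (m + 3) Hz) as N. unfold H_coef. split.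
  - intros E. destruct (Ceq_dec (z ^ (2 * m + 2) - 1)%C 0) as [Z|NZ].
    + replace (z ^ (2 * m + 2))%C with (z ^ (2 * m + 2) - 1 + 1)%C by ring. rewrite Z. ring.
    + exfalso. assert (NI : Ci <> 0) by (apply Cmod_gt_0; rewrite Cmod_Ci; lra).
      apply (Cmult_neq_0 _ _ NI (Cmult_neq_0 _ _ NZ (Cinv_nonzero _ N)) E).
  - intros ->. field. exact N.
Qed.

(** The zeros are the roots of unity of order 2 m + 2, at which the derivative of the numerator does
    not vanish. *)
Lemma H_coef_isolated_zeros (m : nat) (z : C) : z <> 0 ->
  exists e, 0 < e /\ forall w : C, w <> 0 -> w <> z -> Cmod (w - z) < e -> H_coef m w <> 0.
Proof.
  intros Hz.
  destruct (isolated_zero (fun w => w ^ (2 * m + 2) - 1)%C z (RtoC (INR (2 * m + 2)) * z ^ pred (2 * m + 2) - 0)%C)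
    as [e [He K]].
  - apply is_Cderive_minus; [apply is_Cderive_pow|apply is_Cderive_const].
  - right. replace (2 * m + 2)%nat with (S (2 * m + 1)) by lia.
    replace (RtoC (INR (S (2 * m + 1))) * z ^ pred (S (2 * m + 1)) - 0)%C
      with (RtoC (INR (S (2 * m + 1))) * z ^ pred (S (2 * m + 1)))%C by ring.
    apply Cmult_neq_0; [apply INR_C_neq_0|now apply Cpow_nz].
  - exists e. split; auto. intros w Hw0 Hw Hwe E. apply H_coef_zero in E; auto.
    apply (K w Hw Hwe). rewrite E. ring.
Qed.

(** By Lagrange's identity |X_u|^2 |X_v|^2 = <X_u, X_v>^2 + |X_u x X_v|^2. Nullity makes the inner
    product vanish and the two lengths equal, so a zero cross product forces a zero gradient. *)
Lemma immersed_of_null (X : C -> R3) (z p1 p2 p3 : C) :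
  Du X z = (Re p1, Re p2, Re p3) -> Dv X z = (- Im p1, - Im p2, - Im p3) ->
  (p1 * p1 + p2 * p2 + p3 * p3)%C = 0 -> ~ (p1 = 0 /\ p2 = 0 /\ p3 = 0) -> immersed_at X z.
Proof.
  intros HU HV N NZ E. apply NZ. unfold cross3 in E. rewrite HU, HV in E.
  assert (N1 := f_equal Re N). assert (N2 := f_equal Im N).
  unfold zero3, x1, x2, x3 in E. simpl in E.
  injection E as E1 E2 E3. unfold Re, Im in *.
  destruct p1 as [a1 b1], p2 as [a2 b2], p3 as [a3 b3]. simpl in *.
  assert (Q : (a1*a1+a2*a2+a3*a3) * (b1*b1+b2*b2+b3*b3) = 0).
  { transitivity ((a1*b1+a2*b2+a3*b3)*(a1*b1+a2*b2+a3*b3)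
     + (a2 * - b3 - a3 * - b2)*(a2 * - b3 - a3 * - b2)
     + (a3 * - b1 - a1 * - b3)*(a3 * - b1 - a1 * - b3)
     + (a1 * - b2 - a2 * - b1)*(a1 * - b2 - a2 * - b1)); [ring|].
    rewrite E1, E2, E3. replace (a1*b1+a2*b2+a3*b3) with 0 by lra. ring. }
  replace (b1*b1+b2*b2+b3*b3) with (a1*a1+a2*a2+a3*a3) in Q by lra.
  assert (Z : a1*a1+a2*a2+a3*a3 = 0) by nra.
  assert (Z' : b1*b1+b2*b2+b3*b3 = 0) by lra.
  repeat split; apply C_ext; simpl; nra.
Qed.

Lemma H_gradient_null (m : nat) (z : C) :
  (H_coef m z * wei1 z * (H_coef m z * wei1 z) + H_coef m z * wei2 z * (H_coef m z * wei2 z)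
   + H_coef m z * z * (H_coef m z * z))%C = 0.
Proof.
  set (f := H_coef m z).
  replace (f * wei1 z * (f * wei1 z) + f * wei2 z * (f * wei2 z) + f * z * (f * z))%C with
    (f * f * (wei1 z * wei1 z + wei2 z * wei2 z + z * z))%C by ring.
  rewrite wei_null. ring.
Qed.

Section HSurface.

Variables (m : nat) (X : C -> R3).
Hypothesis hm : (1 <= m)%nat.
(** Equality is asked off the origin only, since the value of a surface at 0 is arbitrary. *)
Hypothesis HX : forall z : C, z <> 0 -> X z = H_surface m z.

Lemma H_surface_partials (z : C) : z <> 0 ->
  Du X z = (Re (H_coef m z * wei1 z)%C, Re (H_coef m z * wei2 z)%C, Re (H_coef m z * z)%C) /\
  Dv X z = (- Im (H_coef m z * wei1 z)%C, - Im (H_coef m z * wei2 z)%C, - Im (H_coef m z * z)%C) /\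
  (harmonic_on punctured_plane (fun u v => x1 (X (u, v))) /\
   harmonic_on punctured_plane (fun u v => x2 (X (u, v))) /\
   harmonic_on punctured_plane (fun u v => x3 (X (u, v)))).
Proof.
  intros Hz. assert (HO := open_punctured_plane).
  destruct (C1_holomorphic_on_poly_wei punctured_plane) as [W1 [W2 W3]].
  assert (HC := C1_holomorphic_on_H_coef m).
  destruct (harmonic_on_Re punctured_plane (H_prim1 m) (fun z => H_coef m z * wei1 z)%C HO) as [A1 B1].
  { intros w Hw. now apply H_prim_derive. }
  { now apply C1_holomorphic_on_mult. }
  destruct (harmonic_on_Re punctured_plane (H_prim2 m) (fun z => H_coef m z * wei2 z)%C HO) as [A2 B2].
  { intros w Hw. now apply H_prim_derive. }
  { now apply C1_holomorphic_on_mult. }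
  destruct (harmonic_on_Re punctured_plane (H_prim3 m) (fun z => H_coef m z * z)%C HO) as [A3 B3].
  { intros w Hw. now apply H_prim_derive. }
  { now apply C1_holomorphic_on_mult. }
  assert (Ez : z = (Re z, Im z)) by now destruct z.
  assert (Hz' : punctured_plane (Re z, Im z)) by now rewrite <- Ez.
  assert (L := open_locally_2d punctured_plane (Re z) (Im z) HO Hz').
  assert (L1 : locally_2d (fun u v => Re (H_prim1 m (u, v)) = x1 (X (u, v))) (Re z) (Im z)).
  { revert L. apply locally_2d_impl, locally_2d_forall. intros u v H. now rewrite HX. }
  assert (L2 : locally_2d (fun u v => Re (H_prim2 m (u, v)) = x2 (X (u, v))) (Re z) (Im z)).
  { revert L. apply locally_2d_impl, locally_2d_forall. intros u v H. now rewrite HX. }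
  assert (L3 : locally_2d (fun u v => Re (H_prim3 m (u, v)) = x3 (X (u, v))) (Re z) (Im z)).
  { revert L. apply locally_2d_impl, locally_2d_forall. intros u v H. now rewrite HX. }
  destruct (B1 _ _ Hz') as [P1 Q1], (B2 _ _ Hz') as [P2 Q2], (B3 _ _ Hz') as [P3 Q3].
  rewrite <- Ez in *.
  split; [|split; [|split; [|split]]].
  - unfold Du. rewrite <- (partial_derive_ext_loc _ _ 1 0 _ _ L1), P1,
      <- (partial_derive_ext_loc _ _ 1 0 _ _ L2), P2, <- (partial_derive_ext_loc _ _ 1 0 _ _ L3), P3.
    reflexivity.
  - unfold Dv. rewrite <- (partial_derive_ext_loc _ _ 0 1 _ _ L1), Q1,
      <- (partial_derive_ext_loc _ _ 0 1 _ _ L2), Q2, <- (partial_derive_ext_loc _ _ 0 1 _ _ L3), Q3.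
    reflexivity.
  - apply (harmonic_on_ext _ (fun u v => Re (H_prim1 m (u, v)))); auto. intros u v H. now rewrite HX.
  - apply (harmonic_on_ext _ (fun u v => Re (H_prim2 m (u, v)))); auto. intros u v H. now rewrite HX.
  - apply (harmonic_on_ext _ (fun u v => Re (H_prim3 m (u, v)))); auto. intros u v H. now rewrite HX.
Qed.

Lemma H_surface_immersed (z : C) : z <> 0 -> H_coef m z <> 0 -> immersed_at X z.
Proof.
  intros Hz Hf. destruct (H_surface_partials z Hz) as [A [B _]].
  apply (immersed_of_null X z _ _ _ A B (H_gradient_null m z)).
  intros [E1 [_ E3]]. apply (Cmult_neq_0 _ _ Hf Hz E3).
Qed.

Lemma H_surface_branched_minimal : branched_minimal_surface punctured_plane X.
Proof.
  split; [exact open_punctured_plane|]. split; [|split].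
  (* The harmonicity clause does not depend on the point at which the lemma is used; 1 is a
     convenient nonzero one. *)
  - assert (H1 : RtoC 1 <> 0) by (intros E; apply RtoC_inj in E; lra).
    exact (proj2 (proj2 (H_surface_partials 1 H1))).
  - intros z Hz. destruct (H_surface_partials z Hz) as [A [B _]].
    assert (N := H_gradient_null m z). rewrite A, B.
    set (p1 := (H_coef m z * wei1 z)%C) in *. set (p2 := (H_coef m z * wei2 z)%C) in *.
    set (p3 := (H_coef m z * z)%C) in *.
    assert (N1 := f_equal Re N). assert (N2 := f_equal Im N).
    unfold dot3, x1, x2, x3, Re, Im in *. simpl in *. split; lra.
  - intros z Hz. destruct (H_coef_isolated_zeros m z Hz) as [e [He K]].
    exists (mkposreal e He). intros w Hw Hwz Hwe. apply H_surface_immersed; auto.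
Qed.

Lemma H_surface_conformal_gradient :
  conformal_gradient punctured_plane X
    (fun z => H_coef m z * wei1 z)%C (fun z => H_coef m z * wei2 z)%C (fun z => H_coef m z * z)%C.
Proof.
  destruct (C1_holomorphic_on_poly_wei punctured_plane) as [W1 [W2 W3]].
  assert (HC := C1_holomorphic_on_H_coef m).
  assert (L : forall z, punctured_plane z -> exists e, 0 < e /\ forall w, Cmod (w - z) < e -> X w = H_surface m w).
  { intros z Hz. destruct (open_Cmod _ z open_punctured_plane Hz) as [e [He K]].
    exists e. split; auto. intros w Hw. now apply HX, K. }
  split; try now apply C1_holomorphic_on_mult.
  - exact open_punctured_plane.
  - intros z Hz. destruct (L z Hz) as [e [He K]].
    apply (is_grad_ext_loc (fun w => Re (H_prim1 m w))); [|now apply is_grad_Re, H_prim_derive].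
    exists e. split; auto. intros w Hw. now rewrite (K w Hw).
  - intros z Hz. destruct (L z Hz) as [e [He K]].
    apply (is_grad_ext_loc (fun w => Re (H_prim2 m w))); [|now apply is_grad_Re, H_prim_derive].
    exists e. split; auto. intros w Hw. now rewrite (K w Hw).
  - intros z Hz. destruct (L z Hz) as [e [He K]].
    apply (is_grad_ext_loc (fun w => Re (H_prim3 m w))); [|now apply is_grad_Re, H_prim_derive].
    exists e. split; auto. intros w Hw. now rewrite (K w Hw).
  - intros z _. apply H_gradient_null.
Qed.

End HSurface.

Lemma segment_from_1 (w : C) : 0 < Re w \/ Im w <> 0 ->
  forall s, 0 <= s <= 1 -> punctured_plane (1 + RtoC s * (w - 1))%C.
Proof.
  intros H s Hs E. assert (E1 := f_equal Re E). assert (E2 := f_equal Im E).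
  unfold Re, Im in *. simpl in E1, E2. destruct H as [H|H].
  - destruct (Rle_lt_dec (1/2) s); nra.
  - assert (Z : s * snd w = 0) by lra. apply Rmult_integral in Z. destruct Z as [Z|Z]; [|tauto].
    rewrite Z in E1. lra.
Qed.

Lemma segment_from_Ci (w : C) : Im w = 0 -> w <> 0 ->
  forall s, 0 <= s <= 1 -> punctured_plane (Ci + RtoC s * (w - Ci))%C.
Proof.
  intros H H0 s Hs E. assert (E1 := f_equal Re E). assert (E2 := f_equal Im E).
  unfold Re, Im in *. simpl in E1, E2. apply H0.
  assert (S1 : s = 1) by (rewrite H in E2; lra).
  rewrite S1 in E1. apply C_ext; unfold Re, Im; simpl; lra.
Qed.

(** Increments are compared along segments that avoid the origin: points off the real axis are
    reached straight from 1, real ones by a detour through [Ci]. *)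
Lemma Re_integral_H_surface (m : nat) (X : C -> R3) : (1 <= m)%nat ->
  is_Re_integral punctured_plane (H_gradient m) X ->
  forall z : C, z <> 0 -> sub3 (X z) (X 1) = sub3 (H_surface m z) (H_surface m 1).
Proof.
  intros Hm HX z Hz.
  destruct (C1_holomorphic_on_poly_wei punctured_plane) as [W1 [W2 W3]].
  assert (HC := C1_holomorphic_on_H_coef m).
  assert (S : forall u v, (forall s, 0 <= s <= 1 -> punctured_plane (u + RtoC s * (v - u))%C) ->
    sub3 (X v) (X u) = sub3 (H_surface m v) (H_surface m u)).
  { intros u v. apply (Re_integral_segment punctured_plane (H_prim1 m) (H_prim2 m) (H_prim3 m)
      (fun z => H_coef m z * wei1 z)%C (fun z => H_coef m z * wei2 z)%C (fun z => H_coef m z * z)%C);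
      try (intros w Hw; now apply H_prim_derive); try now apply C1_holomorphic_on_mult.
    exact HX. }
  destruct (Req_dec (Im z) 0) as [E|N].
  - assert (A := S 1 Ci (segment_from_1 Ci (or_intror R1_neq_R0))).
    assert (B := S Ci z (segment_from_Ci z E Hz)).
    destruct (X z) as [[a1 a2] a3], (X Ci) as [[b1 b2] b3], (X 1) as [[c1 c2] c3],
      (H_surface m z) as [[d1 d2] d3], (H_surface m Ci) as [[e1 e2] e3], (H_surface m 1) as [[f1 f2] f3].
    unfold sub3, x1, x2, x3 in *. simpl in *. injection A as A1 A2 A3. injection B as B1 B2 B3.
    f_equal; [f_equal|]; lra.
  - apply S, segment_from_1. auto.
Qed.

Lemma H_surface_is_Re_integral (m : nat) : (1 <= m)%nat ->
  is_Re_integral punctured_plane (H_gradient m) (H_surface m).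
Proof.
  intros Hm.
  destruct (C1_holomorphic_on_poly_wei punctured_plane) as [W1 [W2 W3]].
  assert (HC := C1_holomorphic_on_H_coef m).
  apply (is_Re_integral_primitive punctured_plane (H_prim1 m) (H_prim2 m) (H_prim3 m)
      (fun z => H_coef m z * wei1 z)%C (fun z => H_coef m z * wei2 z)%C (fun z => H_coef m z * z)%C);
    try (intros w Hw; now apply H_prim_derive); now apply C1_holomorphic_on_mult.
Qed.

(** * The hypocycloid *)

Lemma expi_plus (s t : R) : expi (s + t) = (expi s * expi t)%C.
Proof. apply C_ext; simpl; [rewrite cos_plus|rewrite sin_plus]; ring. Qed.

Lemma expi_pow (n : nat) (t : R) : (expi t ^ n)%C = expi (INR n * t).
Proof.
  induction n as [|n IH].
  - simpl. rewrite Rmult_0_l. unfold expi. now rewrite cos_0, sin_0.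
  - rewrite Cpow_S, IH, <- expi_plus, S_INR. f_equal. ring.
Qed.

Lemma expi_inv (t : R) : (/ expi t)%C = expi (- t).
Proof.
  assert (E : (expi t * expi (- t))%C = 1).
  { rewrite <- expi_plus, Rplus_opp_r. unfold expi. now rewrite cos_0, sin_0. }
  rewrite <- (Cmult_1_r (/ expi t)), <- E. field. apply expi_neq_0.
Qed.

Definition hypo (m : nat) : R -> R3 :=
  hypocycloid (1 / (INR m + 2)) ((2 * INR m + 2) / (INR m * (INR m + 2))).

(** Here R - r = 1 / m and (R - r) / r = (m + 2) / m, so for t = m s both frequencies are
    integers. *)
Lemma hypo_angle (m : nat) (s : R) : (1 <= m)%nat ->
  hypo m (INR m * s) =
  (- / INR m * sin (INR m * s) + / (INR m + 2) * sin ((INR m + 2) * s),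
   - / INR m * cos (INR m * s) - / (INR m + 2) * cos ((INR m + 2) * s), 0).
Proof.
  intros Hm. assert (Pm : 0 < INR m) by (apply lt_0_INR; lia).
  unfold hypo, hypocycloid.
  replace ((2 * INR m + 2) / (INR m * (INR m + 2)) - 1 / (INR m + 2)) with (/ INR m) by (field; lra).
  replace (/ INR m / (1 / (INR m + 2)) * (INR m * s)) with ((INR m + 2) * s) by (field; lra).
  unfold Rdiv. rewrite Rmult_1_l. reflexivity.
Qed.

(** On the unit circle [/ z] is the conjugate of [z], so the primitives combine into sines and
    cosines; the third one becomes [Ci] times a real number, hence the curve is planar. *)
Lemma H_surface_circle (m : nat) (s : R) : (1 <= m)%nat ->
  H_surface m (expi s) = hypo m (INR m * s).
Proof.
  intros Hm. assert (Pm : 0 < INR m) by (apply lt_0_INR; lia).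
  rewrite hypo_angle by auto. unfold H_surface, Re3, H_prim1, H_prim2, H_prim3, pow_term.
  rewrite expi_inv, !expi_pow, !plus_INR. change (INR 2) with 2. change (INR 1) with 1.
  replace (INR m * - s) with (- (INR m * s)) by ring.
  replace ((INR m + 2) * - s) with (- ((INR m + 2) * s)) by ring.
  replace ((INR m + 1) * - s) with (- ((INR m + 1) * s)) by ring.
  unfold expi. rewrite !cos_neg, !sin_neg.
  unfold Cdiv, Cinv, Cmult, Cplus, Cminus, Copp, Ci, RtoC, Re. simpl.
  f_equal; [f_equal|]; field; lra.
Qed.

Lemma hypo_velocity (m : nat) (s : R) : (1 <= m)%nat ->
  velocity (hypo m) (INR m * s) =
  (2 / INR m * sin ((INR m + 1) * s) * - sin s, 2 / INR m * sin ((INR m + 1) * s) * cos s, 0).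
Proof.
  intros Hm. assert (Pm : 0 < INR m) by (apply lt_0_INR; lia).
  assert (E : forall t, hypo m t =
     (- / INR m * sin t + / (INR m + 2) * sin ((INR m + 2) * (t / INR m)),
     - / INR m * cos t - / (INR m + 2) * cos ((INR m + 2) * (t / INR m)), 0)).
  { intros t. replace t with (INR m * (t / INR m)) at 1 by (field; lra).
    rewrite hypo_angle by auto. now replace (INR m * (t / INR m)) with t by (field; lra). }
  unfold velocity.
  (* Both angles are (m + 1) s shifted by s, in opposite directions; the addition formulas then
     bring out the common factor sin ((m + 1) s). *)
  assert (S1 : INR m * s = (INR m + 1) * s - s) by ring.
  assert (S2 : (INR m + 2) * (INR m * s / INR m) = (INR m + 1) * s + s) by (field; lra).
  apply f_equal2; [apply f_equal2|]; apply is_derive_unique.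
  - apply (is_derive_ext (fun t => - / INR m * sin t + / (INR m + 2) * sin ((INR m + 2) * (t / INR m)))).
    { intros t. now rewrite E. }
    auto_derive; auto. unfold Rdiv in S2. rewrite S2, S1, cos_plus, cos_minus. field. lra.
  - apply (is_derive_ext (fun t => - / INR m * cos t - / (INR m + 2) * cos ((INR m + 2) * (t / INR m)))).
    { intros t. now rewrite E. }
    auto_derive; auto. unfold Rdiv in S2. rewrite S2, S1, sin_plus, sin_minus. field. lra.
  - apply (is_derive_ext (fun _ => 0)).
    { intros t. now rewrite E. }
    apply (is_derive_const (K := R_AbsRing) (V := R_NormedModule) 0).
Qed.

Lemma hypo_velocity_zero (m : nat) (s : R) : (1 <= m)%nat ->
  velocity (hypo m) (INR m * s) = zero3 <-> sin ((INR m + 1) * s) = 0.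
Proof.
  intros Hm. assert (Pm : 0 < INR m) by (apply lt_0_INR; lia).
  rewrite hypo_velocity by auto. unfold zero3. split.
  - intros E. injection E as E1 E2.
    pose proof (sin2_cos2 s) as T. unfold Rsqr in T.
    assert (Z : 2 / INR m * sin ((INR m + 1) * s) = 0).
    { set (q := 2 / INR m * sin ((INR m + 1) * s)) in *.
      replace q with (q * (sin s * sin s + cos s * cos s)) by (rewrite T; ring).
      replace (q * (sin s * sin s + cos s * cos s)) with (- (q * - sin s) * sin s + (q * cos s) * cos s) by ring.
      rewrite E1, E2. ring. }
    apply Rmult_integral in Z. destruct Z as [Z|Z]; auto. exfalso.
    assert (0 < 2 / INR m) by (apply Rdiv_lt_0_compat; lra). lra.
  - intros ->. rewrite Rmult_0_r, !Rmult_0_l. reflexivity.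
Qed.

(** The sign [e] is opposite to that of sin ((m + 1) s), so it flips when a cusp is crossed; up to
    it, the planar normal is the horizontal vector of angle [s]. *)
Lemma hypo_planar_normal (m : nat) (s : R) : (1 <= m)%nat -> sin ((INR m + 1) * s) <> 0 ->
  exists e, e * e = 1 /\ planar_normal (hypo m) (INR m * s) = (e * cos s, e * sin s, 0).
Proof.
  intros Hm Hs. assert (Pm : 0 < INR m) by (apply lt_0_INR; lia).
  unfold planar_normal. rewrite hypo_velocity by auto.
  set (q := 2 / INR m * sin ((INR m + 1) * s)).
  assert (Hq : q <> 0).
  { unfold q. apply Rmult_integral_contrapositive. split; auto.
    assert (0 < 2 / INR m) by (apply Rdiv_lt_0_compat; lra). lra. }
  assert (N : norm3 (q * - sin s, q * cos s, 0) = Rabs q).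
  { unfold norm3, dot3, x1, x2, x3; simpl. rewrite <- sqrt_Rsqr_abs. f_equal. unfold Rsqr.
    pose proof (sin2_cos2 s) as T. unfold Rsqr in T.
    transitivity (q * q * (sin s * sin s + cos s * cos s)); [ring|]. rewrite T. ring. }
  cbv zeta. rewrite N. unfold x1, x2; simpl. exists (- (q / Rabs q)).
  assert (Ha : Rabs q <> 0) by now apply Rabs_no_R0.
  split.
  - assert (Q : Rabs q * Rabs q = q * q) by (rewrite <- Rabs_mult; apply Rabs_pos_eq; nra).
    replace (- (q / Rabs q) * - (q / Rabs q)) with (q * q / (Rabs q * Rabs q)) by (field; auto).
    rewrite Q. field. auto.
  - f_equal. f_equal; field; auto.
Qed.

(** * Counting the cusps *)

Lemma cos_eq_1 (d : R) : - (2 * PI) < d < 2 * PI -> cos d = 1 -> d = 0.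
Proof.
  intros Hd E. replace d with (2 * (d / 2)) in E by field. rewrite cos_2a_sin in E.
  assert (Z : sin (d / 2) = 0) by nra.
  destruct (Rtotal_order d 0) as [L|[L|L]]; auto; exfalso.
  - assert (0 < sin (- (d / 2))) by (apply sin_gt_0; lra). rewrite sin_neg in H. lra.
  - assert (0 < sin (d / 2)) by (apply sin_gt_0; lra). lra.
Qed.

Lemma sin_cos_period_Z (x : R) (k : Z) :
  sin (x + 2 * PI * IZR k) = sin x /\ cos (x + 2 * PI * IZR k) = cos x.
Proof.
  assert (S : sin (IZR k * PI) = 0) by (apply sin_eq_0_1; now exists k).
  replace (2 * PI * IZR k) with (2 * (IZR k * PI)) by ring.
  rewrite sin_plus, cos_plus, sin_2a, cos_2a_sin, S. split; ring.
Qed.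

(** The radius [c] is the outer radius of the hypocycloid: cusps lie on the outer circle. *)
Definition cusp_point (m : nat) (t : R) : R3 :=
  let c := / INR m + / (INR m + 2) in (- c * sin t, - c * cos t, 0).

Lemma hypo_at_cusp (m : nat) (s : R) : (1 <= m)%nat -> sin ((INR m + 1) * s) = 0 ->
  hypo m (INR m * s) = cusp_point m (INR m * s).
Proof.
  intros Hm Hs. rewrite hypo_angle by auto. unfold cusp_point.
  (* At a cusp 2 (m + 1) s is a multiple of 2 pi, so the angle (m + 2) s may be replaced by - m
     s. *)
  replace ((INR m + 2) * s) with (2 * ((INR m + 1) * s) - INR m * s) by ring.
  rewrite sin_minus, cos_minus, sin_2a, cos_2a_sin, Hs. f_equal. f_equal; ring.
Qed.

Lemma hypo_cusp_iff (m : nat) (p : R3) : (1 <= m)%nat ->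
  (cusp (hypo m) p <-> exists j : Z, p = cusp_point m (IZR j * PI * (INR m / (INR m + 1)))).
Proof.
  intros Hm. assert (Pm : 0 < INR m) by (apply lt_0_INR; lia). split.
  - intros [t [Hv Hp]]. replace t with (INR m * (t / INR m)) in Hv, Hp by (field; lra).
    apply hypo_velocity_zero in Hv; auto. rewrite hypo_at_cusp in Hp by auto.
    apply sin_eq_0_0 in Hv. destruct Hv as [j Hj]. exists j. rewrite Hp. f_equal.
    rewrite <- Hj. field. lra.
  - intros [j Hp].
    set (s := IZR j * PI / (INR m + 1)).
    assert (Hs : sin ((INR m + 1) * s) = 0).
    { apply sin_eq_0_1. exists j. unfold s. field. lra. }
    exists (INR m * s). split; [now apply hypo_velocity_zero|].
    rewrite hypo_at_cusp, Hp by auto. f_equal. unfold s. field. lra.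
Qed.

Lemma cusp_point_period (m : nat) (x : R) (k : Z) :
  cusp_point m (x + 2 * PI * IZR k) = cusp_point m x.
Proof. unfold cusp_point. destruct (sin_cos_period_Z x k) as [-> ->]. reflexivity. Qed.

Lemma cusp_point_inj (m : nat) (x y : R) : (1 <= m)%nat -> - (2 * PI) < x - y < 2 * PI ->
  cusp_point m x = cusp_point m y -> x = y.
Proof.
  intros Hm Hxy E. assert (Pm : 0 < INR m) by (apply lt_0_INR; lia).
  unfold cusp_point in E. injection E as E1 E2.
  assert (Hc : 0 < / INR m + / (INR m + 2)).
  { apply Rplus_lt_0_compat; apply Rinv_0_lt_compat; lra. }
  assert (S : sin x = sin y) by (apply (Rmult_eq_reg_l (- (/ INR m + / (INR m + 2)))); lra).
  assert (C : cos x = cos y) by (apply (Rmult_eq_reg_l (- (/ INR m + / (INR m + 2)))); lra).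
  apply Rminus_diag_uniq, cos_eq_1; auto. rewrite cos_minus, S, C.
  pose proof (sin2_cos2 y) as T. unfold Rsqr in T. lra.
Qed.

(* The cusps are the points [2 pi q j / n] of a circle, with [q] invertible modulo [n]. *)
Lemma cusps_card (m n : nat) (q r l : Z) : (1 <= m)%nat -> (1 <= n)%nat ->
  (2 * q * (Z.of_nat m + 1) = Z.of_nat m * Z.of_nat n)%Z -> (r * q = 1 + Z.of_nat n * l)%Z ->
  has_card (cusp (hypo m)) n.
Proof.
  intros Hm Hn Hq Hr. assert (Pm : 0 < INR m) by (apply lt_0_INR; lia).
  assert (Pn : 0 < INR n) by (apply lt_0_INR; lia). pose proof PI_RGT_0 as HPI.
  assert (HQ : INR m / (INR m + 1) = 2 * IZR q / INR n).
  { assert (Q := f_equal IZR Hq). rewrite !mult_IZR, plus_IZR, <- !INR_IZR_INZ in Q.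
    apply (Rmult_eq_reg_r ((INR m + 1) * INR n)); [|apply Rmult_integral_contrapositive; lra].
    transitivity (INR m * INR n); [field; lra|]. rewrite <- Q. field. lra. }
  (* By [HQ] the [j]-th cusp parameter is 2 pi q j / n, so only the residue of q j modulo [n]
     matters. *)
  assert (HJ : forall j i k : Z, (j * q = i + Z.of_nat n * k)%Z ->
    cusp_point m (IZR j * PI * (INR m / (INR m + 1))) = cusp_point m (2 * PI * IZR i / INR n)).
  { intros j i k H. rewrite HQ. rewrite <- (cusp_point_period m (2 * PI * IZR i / INR n) k). f_equal.
    assert (Q := f_equal IZR H). rewrite plus_IZR, !mult_IZR, <- INR_IZR_INZ in Q.
    transitivity (2 * PI * (IZR j * IZR q) / INR n); [field; lra|]. rewrite Q. field. lra. }
  exists (map (fun i => cusp_point m (2 * PI * INR i / INR n)) (seq 0 n)).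
  split; [|split].
  - apply Injective_map_NoDup_in; [|apply seq_NoDup].
    intros i j Hi Hj E. apply in_seq in Hi. apply in_seq in Hj.
    assert (Bi : 0 <= INR i < INR n) by (split; [apply pos_INR|apply lt_INR; lia]).
    assert (Bj : 0 <= INR j < INR n) by (split; [apply pos_INR|apply lt_INR; lia]).
    assert (K : 2 * PI * INR i / INR n = 2 * PI * INR j / INR n).
    { apply (cusp_point_inj m); auto.
      replace (2 * PI * INR i / INR n - 2 * PI * INR j / INR n) with (2 * PI * ((INR i - INR j) / INR n)) by (field; lra).
      assert (-1 < (INR i - INR j) / INR n < 1); [|nra].
      split; [apply Rlt_div_r|apply Rlt_div_l]; lra. }
    apply INR_eq. apply (Rmult_eq_reg_l (2 * PI / INR n)).
    + unfold Rdiv in *. lra.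
    + assert (0 < 2 * PI / INR n) by (apply Rdiv_lt_0_compat; lra). lra.
  - now rewrite length_map, length_seq.
  - intros p. rewrite in_map_iff, hypo_cusp_iff by auto. split.
    (* The inverse [r] of [q] modulo [n] yields an index that hits the [i]-th point of the list. *)
    + intros [i [<- Hi]]. exists (Z.of_nat i * r)%Z.
      rewrite (HJ _ (Z.of_nat i) (Z.of_nat i * l)%Z); [now rewrite <- INR_IZR_INZ|].
      rewrite <- Z.mul_assoc, Hr. ring.
    + intros [j ->]. exists (Z.to_nat (j * q mod Z.of_nat n)).
      assert (B := Z.mod_pos_bound (j * q) (Z.of_nat n) ltac:(lia)).
      split; [|apply in_seq; lia].
      rewrite (HJ j (j * q mod Z.of_nat n)%Z (j * q / Z.of_nat n)%Z).
      * rewrite INR_IZR_INZ, Z2Nat.id by lia. reflexivity.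
      * rewrite Z.add_comm. apply Z.div_mod. lia.
Qed.

Lemma cusps_even (m : nat) : (1 <= m)%nat -> Nat.Even m -> has_card (cusp (hypo m)) (m + 1).
Proof.
  (* With m = 2 p and n = 2 p + 1, q = p has inverse - 2 modulo n: - 2 p = 1 - n. *)
  intros Hm [p Hp]. apply (cusps_card m (m + 1) (Z.of_nat p) (-2) (-1)); lia.
Qed.

Lemma cusps_odd (m : nat) : (1 <= m)%nat -> Nat.Odd m -> has_card (cusp (hypo m)) (2 * m + 2).
Proof.
  (* With m = 2 p + 1 and n = 2 m + 2, q = m is its own inverse modulo n: m^2 - 1 = (m - 1) (m + 1)
     = n p. *)
  intros Hm [p Hp]. apply (cusps_card m (2 * m + 2) (Z.of_nat m) (Z.of_nat m) (Z.of_nat p)); nia.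
Qed.

(** The next zero of sin ((m + 1) s) comes after pi / (m + 1), which is at most pi / 2 because m >=
    1. The bound pi / 2 is the range on which the sine is increasing. *)
Lemma hypo_regular_arc_length (m : nat) (a b : R) : (1 <= m)%nat -> regular_arc (hypo m) a b ->
  (b - a) / INR m <= PI / 2.
Proof.
  intros Hm [Hab [Ha [_ H]]]. assert (Pm : 1 <= INR m) by (apply (le_INR 1); lia).
  pose proof PI_RGT_0 as HPI.
  replace a with (INR m * (a / INR m)) in Ha by (field; lra).
  apply hypo_velocity_zero in Ha; auto.
  destruct (Rle_dec ((b - a) / INR m) (PI / (INR m + 1))) as [L|L].
  - apply Rle_trans with (1 := L). apply Rmult_le_compat_l; [lra|]. apply Rinv_le_contravar; lra.
  - exfalso. apply Rnot_le_lt in L. apply Rlt_div_r in L; [|lra].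
    assert (P : 0 < PI / (INR m + 1)) by (apply Rdiv_lt_0_compat; lra).
    apply (H (INR m * (a / INR m + PI / (INR m + 1)))).
    + replace (INR m * (a / INR m + PI / (INR m + 1))) with (a + PI / (INR m + 1) * INR m) by (field; lra).
      nra.
    + apply hypo_velocity_zero; auto.
      replace ((INR m + 1) * (a / INR m + PI / (INR m + 1))) with ((INR m + 1) * (a / INR m) + PI) by (field; lra).
      rewrite neg_sin, Ha. ring.
Qed.

Lemma sin_sub_le_expi (x y : R) : Rabs (sin (x - y)) <= Cmod (expi x - expi y).
Proof.
  replace (expi x - expi y)%C with ((expi (x - y) - 1) * expi y)%C.
  - rewrite Cmod_mult, Cmod_expi, Rmult_1_r.
    replace (sin (x - y)) with (Im (expi (x - y) - 1)%C) by (simpl; ring). apply im_le_Cmod.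
  - replace (expi x) with (expi ((x - y) + y)) by (f_equal; ring). rewrite expi_plus. ring.
Qed.

(** The chord between two points of the circle is at least the sine of their angle difference, which
    increases up to pi / 2. So [d] is the sine of the angle k e, cut off at pi / 2 to stay in that
    range. *)
Lemma expi_embedding (k a b t e : R) : 0 < k -> (b - a) * k <= PI / 2 -> a < t < b -> 0 < e ->
  exists d, 0 < d /\ forall s, a < s < b -> Cmod (expi (k * s) - expi (k * t)) < d -> Rabs (s - t) < e.
Proof.
  intros Hk Hab Ht He. pose proof PI_RGT_0 as HPI.
  assert (Hke : 0 < k * e) by now apply Rmult_lt_0_compat.
  assert (M0 : 0 < Rmin (k * e) (PI / 2)) by (apply Rmin_pos; lra).
  assert (M2 : Rmin (k * e) (PI / 2) <= PI / 2) by apply Rmin_r.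
  exists (sin (Rmin (k * e) (PI / 2))). split; [apply sin_gt_0; lra|].
  intros s Hs L. destruct (Rlt_le_dec (Rabs (s - t)) e) as [|G]; auto. exfalso.
  assert (B : Rabs (s - t) < b - a) by (apply Rabs_def1; lra).
  assert (A := sin_sub_le_expi (k * s) (k * t)).
  assert (E : Rabs (sin (k * s - k * t)) = sin (k * Rabs (s - t))).
  { replace (k * s - k * t) with (k * (s - t)) by ring.
    destruct (Rlt_le_dec (s - t) 0) as [N|N].
    - rewrite (Rabs_left (s - t)) in * by auto.
      replace (k * (s - t)) with (- (k * - (s - t))) by ring. rewrite sin_neg, Rabs_Ropp.
      apply Rabs_pos_eq, sin_ge_0; nra.
    - rewrite (Rabs_pos_eq (s - t)) in * by auto. apply Rabs_pos_eq, sin_ge_0; nra. }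
  rewrite E in A.
  assert (I : sin (Rmin (k * e) (PI / 2)) <= sin (k * Rabs (s - t))).
  { assert (k * Rabs (s - t) <= PI / 2) by nra.
    assert (k * e <= k * Rabs (s - t)) by (apply Rmult_le_compat_l; lra).
    assert (Rmin (k * e) (PI / 2) <= k * e) by apply Rmin_l.
    apply sin_incr_1; lra. }
  lra.
Qed.

(** * The two surfaces along an arc *)

Lemma sign_constant (f : R -> R) (a b : R) :
  (forall t, a < t < b -> continuous f t) ->
  (forall t, a < t < b -> f t = 1 \/ f t = -1) ->
  (forall t, a < t < b -> f t = 1) \/ (forall t, a < t < b -> f t = -1).
Proof.
  intros Hc Hv.
  assert (I : forall (g : R -> R) s t, (forall x, a < x < b -> continuous g x) ->
    (forall x, a < x < b -> g x <> 0) -> a < s < b -> a < t < b -> s < t -> g s < 0 -> 0 < g t -> False).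
  { intros g s t Cg Ng Hs Ht Hst H1 H2.
    destruct (IVT_interv g s t) as [x [Hx E]]; auto.
    - intros x Hx. apply continuity_pt_filterlim. apply (Cg x). lra.
    - apply (Ng x); auto. lra. }
  assert (Nf : forall x, a < x < b -> f x <> 0) by (intros x Hx; destruct (Hv x Hx); lra).
  assert (J : forall s t, a < s < b -> a < t < b -> f s = -1 -> f t = 1 -> False).
  { intros s t Hs Ht E1 E2. destruct (Rtotal_order s t) as [L|[->|L]]; [|lra|].
    - apply (I f s t); auto; lra.
    - apply (I (fun x => - f x) t s); auto; try lra.
      + intros x Hx. apply (continuous_opp f). auto.
      + intros x Hx. specialize (Nf x Hx). lra. }
  destruct (Rlt_dec a b) as [L|L]; [|left; intros; lra].
  assert (Hmid : a < (a + b) / 2 < b) by lra.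
  destruct (Hv _ Hmid) as [E|E]; [left|right]; intros t Ht; destruct (Hv t Ht) as [E'|E']; auto; exfalso.
  - now apply (J t ((a + b) / 2)).
  - now apply (J ((a + b) / 2) t).
Qed.

(* Null vectors orthogonal to [(cos s, sin s, 0)] form two lines, which complex
   conjugation exchanges. *)
Lemma null_orthogonal (s : R) (p1 p2 p3 : C) :
  (RtoC (cos s) * p1 + RtoC (sin s) * p2)%C = 0 -> (p1 * p1 + p2 * p2 + p3 * p3)%C = 0 ->
  ~ (p1 = 0 /\ p2 = 0 /\ p3 = 0) ->
  exists A, A = (RtoC (cos s) * p2 - RtoC (sin s) * p1)%C /\ A <> 0 /\
    p1 = (- RtoC (sin s) * A)%C /\ p2 = (RtoC (cos s) * A)%C /\ (p3 = Ci * A \/ p3 = - Ci * A)%C.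
Proof.
  intros H N NZ. exists (RtoC (cos s) * p2 - RtoC (sin s) * p1)%C. split; auto.
  assert (T : (RtoC (sin s) * RtoC (sin s) + RtoC (cos s) * RtoC (cos s))%C = 1).
  { rewrite <- !RtoC_mult, <- RtoC_plus. f_equal. exact (sin2_cos2 s). }
  set (c := RtoC (cos s)) in *. set (d := RtoC (sin s)) in *. set (A := (c * p2 - d * p1)%C).
  assert (E1 : p1 = (- d * A)%C).
  { unfold A. transitivity ((d * d + c * c) * p1 - c * (c * p1 + d * p2))%C; [rewrite T, H|]; ring. }
  assert (E2 : p2 = (c * A)%C).
  { unfold A. transitivity ((d * d + c * c) * p2 - d * (c * p1 + d * p2))%C; [rewrite T, H|]; ring. }
  assert (Q : ((p3 - Ci * A) * (p3 - - Ci * A))%C = 0).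
  { transitivity (p3 * p3 - Ci * Ci * (A * A))%C; [ring|]. rewrite Ci2.
    transitivity ((d * d + c * c) * (A * A) + p3 * p3)%C; [rewrite T; ring|].
    rewrite <- N. rewrite E1, E2. ring. }
  assert (S : forall u v : C, (u - v)%C = 0 -> u = v).
  { intros u v E. replace u with (u - v + v)%C by ring. rewrite E. ring. }
  assert (P3 : (p3 = Ci * A \/ p3 = - Ci * A)%C).
  { destruct (Ceq_dec (p3 - Ci * A)%C 0) as [Z|Z]; [left; auto|].
    destruct (Ceq_dec (p3 - - Ci * A)%C 0) as [Z'|Z']; [right; auto|].
    exfalso. now apply (Cmult_neq_0 _ _ Z Z'). }
  split; [|split; [|split]]; auto.
  intros Z. apply NZ. rewrite E1, E2. destruct P3 as [-> | ->]; rewrite Z; repeat split; ring.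
Qed.

(** On the line spanned by (- sin s, cos s, - i), p1 - i p2 is - i exp (- i s) A, so the Gauss map
    p3 / (p1 - i p2) is exp (i s). This is the line that fits the parametrization [beta]. *)
Lemma gauss_of_null_orthogonal (s : R) (p1 p2 p3 A : C) : A <> 0 ->
  p1 = (- RtoC (sin s) * A)%C -> p2 = (RtoC (cos s) * A)%C -> p3 = (- Ci * A)%C ->
  (p1 - Ci * p2)%C <> 0 /\ p3 = (expi s * (p1 - Ci * p2))%C.
Proof.
  intros HA E1 E2 E3.
  assert (E : (p1 - Ci * p2)%C = (- Ci * A * / expi s)%C).
  { rewrite expi_inv, E1, E2. unfold expi. rewrite cos_neg, sin_neg.
    apply C_ext; unfold Re, Im; simpl; ring. }
  rewrite E. split.
  - apply Cmult_neq_0; [apply Cmult_neq_0; auto|apply Cinv_nonzero, expi_neq_0].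
    apply Cmod_gt_0. rewrite Cmod_opp, Cmod_Ci. lra.
  - rewrite E3. field. apply expi_neq_0.
Qed.

Lemma expi_double_neq_1 (x : R) : sin x <> 0 -> expi (2 * x) <> 1.
Proof.
  intros H E. apply (f_equal Re) in E. simpl in E. rewrite cos_2a_sin in E.
  apply H. nra.
Qed.

(** exp (i s) to the power 2 m + 2 has angle 2 (m + 1) s, so branch points on the circle can only
    sit at cusp parameters. *)
Lemma H_coef_circle_neq_0 (m : nat) (s : R) : sin ((INR m + 1) * s) <> 0 -> H_coef m (expi s) <> 0.
Proof.
  intros Hs E. apply H_coef_zero in E; [|apply expi_neq_0]. rewrite expi_pow in E.
  apply (expi_double_neq_1 _ Hs). rewrite <- E. f_equal.
  rewrite plus_INR, mult_INR. simpl. ring.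
Qed.

(** Stereographic projection identifies a Gauss map value exp (i s) on the unit circle with the
    horizontal normal (cos s, sin s, 0). *)
Lemma wei_orthogonal (s : R) :
  (RtoC (cos s) * wei1 (expi s) + RtoC (sin s) * wei2 (expi s))%C = 0.
Proof.
  pose proof (sin2_cos2 s) as T. unfold Rsqr in T.
  unfold wei1, wei2, expi. apply C_ext; unfold Re, Im; simpl; field_simplify.
  - replace (cos s ^ 3) with (cos s * (1 - sin s * sin s)) by (rewrite <- T; ring). field.
  - replace (sin s ^ 3) with (sin s * (1 - cos s * cos s)) by (rewrite <- T; ring). field.
Qed.

Section Arc.

Variables (m : nat) (X : C -> R3) (a b : R).
Hypothesis hm : (1 <= m)%nat.
Hypothesis HX : forall z : C, z <> 0 -> X z = H_surface m z.
Hypothesis Harc : regular_arc (hypo m) a b.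

Let beta (t : R) : C := expi (/ INR m * t).

Lemma arc_regular (t : R) : a < t < b -> sin ((INR m + 1) * (/ INR m * t)) <> 0.
Proof.
  intros Ht E. assert (Pm : 0 < INR m) by (apply lt_0_INR; lia).
  apply hypo_velocity_zero in E; auto. destruct Harc as [_ [_ [_ H]]]. apply (H t Ht).
  now replace (INR m * (/ INR m * t)) with t in E by (field; lra).
Qed.

Lemma arc_trace (t : R) : X (beta t) = hypo m t.
Proof.
  assert (Pm : 0 < INR m) by (apply lt_0_INR; lia).
  unfold beta. rewrite HX, H_surface_circle by (auto; apply expi_neq_0). f_equal. field. lra.
Qed.

Lemma arc_normal (t : R) : a < t < b -> exists e, e * e = 1 /\
  planar_normal (hypo m) t = (e * cos (/ INR m * t), e * sin (/ INR m * t), 0).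
Proof.
  intros Ht. assert (Pm : 0 < INR m) by (apply lt_0_INR; lia).
  destruct (hypo_planar_normal m (/ INR m * t) hm (arc_regular t Ht)) as [e [He E]].
  replace (INR m * (/ INR m * t)) with t in E by (field; lra). eauto.
Qed.

Lemma H_solves_along :
  solves_along punctured_plane X beta (hypo m) (planar_normal (hypo m)) a b.
Proof.
  intros t Ht. split; [|split; [|split]].
  - apply continuous_expi.
  - apply expi_neq_0.
  - apply arc_trace.
  - destruct (arc_normal t Ht) as [e [He ->]].
    destruct (H_surface_partials m X hm HX (beta t) (expi_neq_0 _)) as [A [B _]].
    assert (W := wei_orthogonal (/ INR m * t)). fold (beta t) in W.
    set (c := cos (/ INR m * t)) in *. set (d := sin (/ INR m * t)) in *.
    set (f := H_coef m (beta t)) in *.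
    assert (W' : (RtoC c * (f * wei1 (beta t)) + RtoC d * (f * wei2 (beta t)))%C = 0).
    { transitivity (f * (RtoC c * wei1 (beta t) + RtoC d * wei2 (beta t)))%C; [ring|]. rewrite W. ring. }
    set (p1 := (f * wei1 (beta t))%C) in *. set (p2 := (f * wei2 (beta t))%C) in *.
    set (p3 := (f * beta t)%C) in *.
    assert (W1 := f_equal Re W'). assert (W2 := f_equal Im W').
    split; [|split; [|split]].
    + apply (H_surface_immersed m X hm HX); [apply expi_neq_0|]. now apply H_coef_circle_neq_0, arc_regular.
    + unfold norm3, dot3, x1, x2, x3; simpl. rewrite <- sqrt_1. f_equal.
      transitivity (e * e * (d * d + c * c)); [ring|]. rewrite He.
      assert (T := sin2_cos2 (/ INR m * t)). unfold Rsqr in T. fold c d in T. rewrite T. ring.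
    + rewrite A. clearbody c d p1 p2 p3. unfold dot3, x1, x2, x3, Re, Im in *. simpl in *.
      transitivity (e * (c * fst p1 + d * fst p2)); [ring|].
      replace (c * fst p1 + d * fst p2) with 0 by lra. ring.
    + rewrite B. clearbody c d p1 p2 p3. unfold dot3, x1, x2, x3, Re, Im in *. simpl in *.
      transitivity (- e * (c * snd p1 + d * snd p2)); [ring|].
      replace (c * snd p1 + d * snd p2) with 0 by lra. ring.
Qed.

Lemma H_unique_along (D' : C -> Prop) (Y : C -> R3) (beta' : R -> C) :
  branched_minimal_surface D' Y ->
  solves_along D' Y beta' (hypo m) (planar_normal (hypo m)) a b ->
  coincide_along D' Y beta' punctured_plane X beta a b.
Proof.
  intros HY HS. assert (Pm : 0 < INR m) by (apply lt_0_INR; lia).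
  assert (Pk : 0 < / INR m) by now apply Rinv_0_lt_compat.
  apply branched_minimal_surface_gradient in HY.
  assert (G := fun t Ht => unit_normal_gradient Y (beta' t) _ (proj2 (proj2 (proj2 (HS t Ht))))).
  set (P1 := complex_gradient (fun u v => x1 (Y (u, v)))) in *.
  set (P2 := complex_gradient (fun u v => x2 (Y (u, v)))) in *.
  set (P3 := complex_gradient (fun u v => x3 (Y (u, v)))) in *.
  (* The tangential component of the gradient. Given by a formula in P1 and P2, it is visibly
     continuous in [t], hence so is the ratio P3 / A that tells the two lines apart. *)
  pose (A := fun t => (RtoC (cos (/ INR m * t)) * P2 (beta' t) - RtoC (sin (/ INR m * t)) * P1 (beta' t))%C).
  assert (DICH : forall t, a < t < b -> A t <> 0 /\
    P1 (beta' t) = (- RtoC (sin (/ INR m * t)) * A t)%C /\ P2 (beta' t) = (RtoC (cos (/ INR m * t)) * A t)%C /\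
    (P3 (beta' t) = Ci * A t \/ P3 (beta' t) = - Ci * A t)%C).
  { intros t Ht. destruct (HS t Ht) as [_ [HD _]].
    destruct (arc_normal t Ht) as [e [He En]]. destruct (G t Ht) as [G1 G2]. rewrite En in G1.
    unfold x1, x2, x3 in G1. simpl in G1. 
    change (P1 (beta' t) = 0 /\ P2 (beta' t) = 0 /\ P3 (beta' t) = 0 -> False) in G2.
    destruct (null_orthogonal (/ INR m * t) (P1 (beta' t)) (P2 (beta' t)) (P3 (beta' t))) as [A' [-> K]]; auto.
    - change (RtoC (e * cos (/ INR m * t)) * P1 (beta' t) + RtoC (e * sin (/ INR m * t)) * P2 (beta' t)
        + RtoC 0 * P3 (beta' t) = 0)%C in G1.
      rewrite !RtoC_mult in G1.
      (* A second factor [e], with e * e = 1, removes the sign of the normal. *)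
      transitivity (RtoC e * (RtoC e * RtoC (cos (/ INR m * t)) * P1 (beta' t)
        + RtoC e * RtoC (sin (/ INR m * t)) * P2 (beta' t) + RtoC 0 * P3 (beta' t)))%C.
      + transitivity ((RtoC e * RtoC e) * (RtoC (cos (/ INR m * t)) * P1 (beta' t) + RtoC (sin (/ INR m * t)) * P2 (beta' t)))%C; [|ring].
        rewrite <- RtoC_mult, He. ring.
      + rewrite G1. ring.
    - apply (cg_null _ _ _ _ _ HY _ HD). }
  assert (CP : forall P, C1_holomorphic_on D' P -> forall t, a < t < b -> continuous (fun t => P (beta' t)) t).
  { intros P [P' HP] t Ht. destruct (HS t Ht) as [Cb [HD _]].
    apply (continuous_comp beta' P); auto. eapply is_Cderive_continuous. now apply HP. }
  assert (CA : forall t, a < t < b -> continuous A t).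
  { intros t Ht. unfold A.
    assert (Ce := continuous_expi (/ INR m) t).
    apply continuous_Cminus; apply continuous_Cmult.
    - apply continuous_RtoC. apply (continuous_Re (fun s => expi (/ INR m * s))). exact Ce.
    - exact (CP P2 (cg_hol2 _ _ _ _ _ HY) t Ht).
    - apply continuous_RtoC. apply (continuous_Im (fun s => expi (/ INR m * s))). exact Ce.
    - exact (CP P1 (cg_hol1 _ _ _ _ _ HY) t Ht). }
  assert (Sgn : (forall t, a < t < b -> Im (P3 (beta' t) / A t)%C = 1) \/
    (forall t, a < t < b -> Im (P3 (beta' t) / A t)%C = -1)).
  { apply (sign_constant (fun t => Im (P3 (beta' t) / A t)%C)).
    - intros t Ht. apply (continuous_Im (fun t => P3 (beta' t) / A t)%C).
      apply continuous_Cdiv; auto; [now apply DICH|]. apply CP; auto. apply (cg_hol3 _ _ _ _ _ HY).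
    - intros t Ht. destruct (DICH t Ht) as [NA [_ [_ [E|E]]]]; [left|right]; rewrite E.
      + replace (Ci * A t / A t)%C with Ci by (field; auto). reflexivity.
      + replace (- Ci * A t / A t)%C with (- Ci)%C by (field; auto). reflexivity. }
  assert (HXg := H_surface_conformal_gradient m X hm HX).
  assert (Hbeta : forall t, a < t < b -> is_derive beta t (RtoC (/ INR m) * Ci * expi (/ INR m * t))%C /\
     (RtoC (/ INR m) * Ci * expi (/ INR m * t))%C <> 0 /\ H_coef m (beta t) <> 0).
  { intros t Ht. split; [apply is_derive_expi|]. split.
    - apply Cmult_neq_0; [apply Cmult_neq_0|apply expi_neq_0].
      + intros E. apply RtoC_inj in E. lra.
      + apply Cmod_gt_0. rewrite Cmod_Ci. lra.
    - now apply H_coef_circle_neq_0, arc_regular. }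
  assert (Hemb : forall t e, a < t < b -> 0 < e -> exists d, 0 < d /\
     forall s, a < s < b -> Cmod (beta s - beta t) < d -> Rabs (s - t) < e).
  { intros t e Ht He. apply expi_embedding with (a := a) (b := b); auto.
    now apply (hypo_regular_arc_length m). }
  assert (Hcur : forall t, a < t < b ->
    continuous beta' t /\ D' (beta' t) /\ punctured_plane (beta t) /\ Y (beta' t) = X (beta t)).
  { intros t Ht. destruct (HS t Ht) as [Cb [HD [E _]]]. split; auto. split; auto. split.
    - apply expi_neq_0.
    - rewrite E. symmetry. apply arc_trace. }
  destruct Sgn as [S|S].
  (* Here P3 = i A. Conjugation turns this into - i times the conjugate of A, the line treated
     above, and makes the resulting change of parameters anticonformal. *)
  - destruct (weierstrass_coincidence _ _ _ _ _ punctured_plane X (H_coef m)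
      (fun t => Cconj (beta' t)) beta (fun t => RtoC (/ INR m) * Ci * expi (/ INR m * t))%C a b
      (conformal_gradient_conj _ _ _ _ _ HY) HXg (C1_holomorphic_on_H_coef m))
      as [U [k [H1 [H2 [H3 [H4 H5]]]]]]; auto.
    + intros t Ht. destruct (Hcur t Ht) as [K1 [K2 [K3 K4]]]. rewrite Cconj_conj.
      split; auto. now apply continuous_Cconj.
    + intros t Ht. rewrite Cconj_conj. destruct (DICH t Ht) as [NA [E1 [E2 E3]]].
      apply (gauss_of_null_orthogonal _ _ _ _ (Cconj (A t))).
      * intros Z. apply NA. rewrite <- (Cconj_conj (A t)), Z. apply C_ext; simpl; ring.
      * rewrite E1, Cmult_conj. f_equal. apply C_ext; simpl; ring.
      * rewrite E2, Cmult_conj. f_equal. apply C_ext; simpl; ring.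
      * destruct E3 as [E3|E3].
        -- rewrite E3, Cmult_conj. f_equal. apply C_ext; simpl; ring.
        -- exfalso. specialize (S t Ht). rewrite E3 in S.
           replace (- Ci * A t / A t)%C with (- Ci)%C in S by (field; auto). simpl in S. lra.
    + exists (fun z => U (Cconj z)), (fun z => k (Cconj z)).
      split; [now apply open_conj|]. split; [|split; [|split]].
      * intros t Ht. now apply H2.
      * right. intros z Hz. destruct (H3 _ Hz) as [l Hl]. exists (Cconj l).
        now apply is_Cderive_conj.
      * intros z w Hz Hw E. rewrite <- (Cconj_conj z), <- (Cconj_conj w). f_equal. now apply H4.
      * intros z Hz. specialize (H5 _ Hz). now rewrite Cconj_conj in H5.
  - destruct (weierstrass_coincidence _ _ _ _ _ punctured_plane X (H_coef m)
      beta' beta (fun t => RtoC (/ INR m) * Ci * expi (/ INR m * t))%C a b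
      HY HXg (C1_holomorphic_on_H_coef m))
      as [U [k [H1 [H2 [H3 [H4 H5]]]]]]; auto.
    + intros t Ht. destruct (DICH t Ht) as [NA [E1 [E2 E3]]].
      apply (gauss_of_null_orthogonal _ _ _ _ (A t)); auto.
      destruct E3 as [E3|E3]; auto. exfalso. specialize (S t Ht). rewrite E3 in S.
      replace (Ci * A t / A t)%C with Ci in S by (field; auto). simpl in S. lra.
    + exists U, k. auto 10.
Qed.

End Arc.

Lemma H_bjorling (m : nat) (X : C -> R3) : (1 <= m)%nat ->
  is_Re_integral punctured_plane (H_gradient m) X ->
  exists v, is_the_bjorling_solution punctured_plane (translate v X)
    (hypo m) (planar_normal (hypo m)).
Proof.
  (* The translation is the one that makes the two surfaces agree at the point 1. *)
  intros Hm HX. exists (sub3 (H_surface m 1) (X 1)).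
  assert (E : forall z : C, z <> 0 -> translate (sub3 (H_surface m 1) (X 1)) X z = H_surface m z).
  { intros z Hz. assert (K := Re_integral_H_surface m X Hm HX z Hz). unfold translate.
    destruct (X z) as [[a1 a2] a3], (X 1) as [[c1 c2] c3],
      (H_surface m z) as [[d1 d2] d3], (H_surface m 1) as [[f1 f2] f3].
    unfold add3, sub3, x1, x2, x3 in *. simpl in *. injection K as K1 K2 K3.
    f_equal; [f_equal|]; lra. }
  split; [now apply (H_surface_branched_minimal m)|].
  intros a b Harc. exists (fun t => expi (/ INR m * t)). split.
  - now apply H_solves_along.
  - intros D' Y beta' HY HS. now apply H_unique_along.
Qed.

Theorem mainTheorem4 (m : nat) (hm : (1 <= m)%nat) :
  let gamma := hypocycloid (1 / (INR m + 2))
                 ((2 * INR m + 2) / (INR m * (INR m + 2))) in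
  (Nat.Even m ->
     has_card (cusp gamma) (m + 1) /\
     is_the_bjorling_solution_up_to_translation punctured_plane (is_H m)
       gamma (planar_normal gamma)) /\
  (Nat.Odd m ->
     has_card (cusp gamma) (2 * m + 2) /\
     is_the_bjorling_solution_up_to_translation punctured_plane
       (is_H_conjugate m) gamma (planar_normal gamma)).
Proof.
  intros gamma. change gamma with (hypo m). split; intros Hp; (split; [|split]).
  - now apply cusps_even.
  - exists (H_surface m). apply is_H_even; auto. now apply H_surface_is_Re_integral.
  - intros X HX. apply H_bjorling; [exact hm|exact (proj1 (is_H_even m X Hp) HX)].
  - now apply cusps_odd.
  - exists (H_surface m). apply is_H_conjugate_odd; auto. now apply H_surface_is_Re_integral.
  - intros X HX. apply H_bjorling; [exact hm|exact (proj1 (is_H_conjugate_odd m X Hp) HX)].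
Qed.
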